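(* Given integers $q \geq t \geq 2$, there is an $n_0 = n_0(q,t)$ such that for all integers $n > n_0$, $$f(n;q,t) \geq 2^{n^{\log(q/(t-1))}/4}.$$
   Context: For integers $n > q \geq t \geq 2$, $f(n;q,t)$ denotes the maximum integer $N$ such that there is a coloring of the 3-element subsets (triples) of an $N$-element set $V$ with $q$ colors with the property that every subset of $V$ of size $n$ contains triples of at least $t$ distinct colors. All logarithms are base 2. *)

(* Defs.v *)
From HB Require Import structures.
From mathcomp Require Import all_boot all_order all_algebra.
From mathcomp Require Import reals exp.

Set Implicit Arguments.
Unset Strict Implicit.
Unset Printing Implicit Defensive.

Import Order.TTheory GRing.Theory Num.Theory.

Definition mono (q k n : nat) (T : finType) (A : {set T}) (c : {set T} -> 'I_q) :=
  exists S : {set T}, exists col : 'I_q,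
    [/\ S \subset A, #|S| = n &
        forall e : {set T}, e \subset S -> #|e| = k -> c e = col].

Fixpoint end_homog (q k : nat) (T : finType) (c : {set T} -> 'I_q)
    (s : seq (T * 'I_q)) : Prop :=
  if s is (x, col) :: s' then
    (forall e : {set T}, #|e| = k ->
       (forall y, y \in e -> y \in map fst s') -> c (x |: e) = col) /\
    end_homog k c s'
  else True.

Lemma end_homog_mono q k (T : finType) (c : {set T} -> 'I_q) col s
    (e : {set T}) :
  end_homog k c s -> #|e| = k.+1 ->
  (forall y, y \in e -> y \in map fst [seq p <- s | p.2 == col]) -> c e = col.
Proof.
elim: s => [|[x cx] s IHs] /=.
  move=> _ ce es; have /card_gt0P[y ye] : (0 < #|e|)%N by rewrite ce.
  by have := es _ ye.
move=> [hx hs] ce es.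
have sub y : y \in map fst [seq p <- s | p.2 == col] -> y \in map fst s.
  move=> /mapP[p]; rewrite mem_filter => /andP[_ ps] ->.
  exact: map_f.
case: (boolP (x \in e)) => [xe|xNe].
  have ek : #|e :\ x| = k by have := cardsD1 x e; rewrite ce xe => -[].
  case: (eqVneq cx col) => [ecol|ncol].
    rewrite -(setD1K xe) -ecol; apply: hx => // y; rewrite !inE => /andP[yx ye].
    have := es _ ye; rewrite ecol eqxx /= inE (negPf yx) /=; exact: sub.
  apply: IHs => // y ye; have := es _ ye; by rewrite (negPf ncol).
apply: IHs => // y ye; have := es _ ye.
case: (cx == col) => //=; rewrite inE => /orP[/eqP yx|//].
by rewrite -yx ye in xNe.
Qed.

Lemma ramsey q k n : {B : nat | forall (T : finType) (A : {set T})
  (c : {set T} -> 'I_q), (B <= #|A|)%N -> mono k n A c}.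
Proof.
have shrink (T : finType) (A : {set T}) m : (m <= #|A|)%N ->
    exists2 S : {set T}, S \subset A & #|S| = m.
  move=> mA; exists [set x in take m (enum A)].
    by apply/subsetP => x; rewrite inE => /mem_take; rewrite mem_enum.
  rewrite cardsE; have /card_uniqP -> : uniq (take m (enum A)).
    by rewrite take_uniq ?enum_uniq.
  by rewrite size_takel // -cardE.
elim: k n => [|k IHk] n.
  exists n => T A c /shrink[S SA Sn]; exists S, (c set0); split => // e _.
  by move=> /eqP; rewrite cards_eq0 => /eqP ->.
have eh m : {B : nat | forall (T : finType) (A : {set T})
    (c : {set T} -> 'I_q), (B <= #|A|)%N -> exists s : seq (T * 'I_q),
    [/\ size s = m, uniq (map fst s), end_homog k c s &
        forall y, y \in map fst s -> y \in A]}.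
  elim: m => [|m [Bm IHm]]; first by exists 0%N => T A c _; exists [::].
  have [B hB] := IHk Bm; exists B.+1 => T A c cA.
  have /card_gt0P[x xA] : (0 < #|A|)%N by apply: leq_trans cA.
  have cA' : (B <= #|A :\ x|)%N by move: cA; rewrite (cardsD1 x) xA.
  have [S [col [SA Sm hS]]] := hB T _ (fun e => c (x |: e)) cA'.
  have [s [ss us hs sS]] := IHm T S c (eq_leq (esym Sm)).
  exists ((x, col) :: s); split => /=; first by rewrite ss.
  - rewrite us andbT; apply/negP => /sS /(subsetP SA).
    by rewrite !inE eqxx.
  - split => // e ek es; apply: hS => //; apply/subsetP => y ye.
    exact/sS/es.
  - move=> y; rewrite inE => /orP[/eqP-> //|/sS /(subsetP SA)].
    by rewrite !inE => /andP[].
have [B hB] := eh (q * n)%N; exists B => T A c cA.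
have [s [ss us hs sA]] := hB T A c cA.
have [col hcol] : exists col : 'I_q, (n <= count (fun p => p.2 == col) s)%N.
  apply/existsP; apply: contraT; rewrite negb_exists => /forallP h.
  have q0 : (0 < q)%N by apply: leq_trans (ltn_ord (c set0)).
  have : (\sum_(col < q) count (fun p : T * 'I_q => p.2 == col) s < q * n)%N.
    rewrite -[X in (_ < X * _)%N]card_ord -sum_nat_const.
    have := h (Ordinal q0); rewrite -ltnNge => h0.
    rewrite (bigD1 (Ordinal q0)) //= [X in (_ < X)%N](bigD1 (Ordinal q0)) //=.
    rewrite -addSn leq_add // leq_sum // => i _.
    by have := h i; rewrite -ltnNge => /ltnW.
  suff -> : (\sum_(col < q) count (fun p : T * 'I_q => p.2 == col) s = size s)%N.
    by rewrite ss ltnn.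
  elim: {hs us sA ss h} s => [|p s IHs] /=; first by rewrite big1.
  rewrite big_split /= IHs (bigD1 p.2) //= eqxx big1 // => i.
  by rewrite eq_sym => /negPf ->.
pose F := [set y in map fst [seq p <- s | p.2 == col]].
have [S SF Sn] : exists2 S : {set T}, S \subset F & #|S| = n.
  apply: shrink; rewrite /F cardsE.
  have /card_uniqP -> : uniq (map fst [seq p <- s | p.2 == col]).
    apply: subseq_uniq us; exact/map_subseq/filter_subseq.
  by rewrite size_map size_filter.
have Fs y : y \in F -> y \in map fst s.
  rewrite inE => /mapP[p]; rewrite mem_filter => /andP[_ ps] ->; exact: map_f.
exists S, col; split => //; first by apply/subsetP => y /(subsetP SF) /Fs /sA.
move=> e eS ek; apply: (end_homog_mono hs ek) => y /(subsetP eS) /(subsetP SF).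
by rewrite inE.
Qed.

Definition triples (N : nat) (S : {set 'I_N}) : {set {set 'I_N}} :=
  [set e : {set 'I_N} | (e \subset S) && (#|e| == 3)].

(* The values of c on sets that are not triples play no role. *)
Definition colorable (n q t N : nat) : bool :=
  [exists c : {ffun {set 'I_N} -> 'I_q},
    [forall S : {set 'I_N}, (#|S| == n) ==> (t <= #|c @: triples S|)%N]].

Lemma colorable_bounded n q t : (2 <= t <= q)%N ->
  {B : nat | forall N, colorable n q t N -> (N <= B)%N}.
Proof.
move=> /andP[t2 _]; have [B hB] := ramsey q 3 n; exists B => N /existsP[c /forallP hc].
rewrite leqNgt; apply/negP => BN.
have cT : (B <= #|[set: 'I_N]|)%N by rewrite cardsT card_ord ltnW.
have [S [col [_ Sn hS]]] := hB _ _ (fun e => c e) cT.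
have := hc S; rewrite Sn eqxx /= => tS.
have : (#|c @: triples S| <= 1)%N.
  rewrite -(cards1 col); apply/subset_leq_card/subsetP => d /imsetP[e].
  by rewrite !inE => /andP[eS /eqP e3] ->; apply/eqP/hS.
by rewrite leqNgt (leq_trans t2 tS).
Qed.

Lemma colorable_ex n q t : (2 <= t <= q)%N -> (q < n)%N ->
  exists N, colorable n q t N.
Proof.
move=> /andP[t2 tq] qn; exists 0%N.
have q0 : (0 < q)%N by rewrite (leq_trans _ tq) // ltnW.
apply/existsP; exists [ffun=> Ordinal q0]; apply/forallP => S.
apply/implyP => /eqP Sn; have := max_card (mem S); rewrite card_ord Sn.
by move=> /(leq_trans qn).
Qed.

(* f(n; q, t).  The values of [ex_maxn] do not depend on the proofs or on the
   upper bound it is given (see [ex_maxnP]). *)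
Definition ramsey_f (n q t : nat) (htq : (2 <= t <= q)%N) (hqn : (q < n)%N) :
    nat :=
  ex_maxn (colorable_ex htq hqn) (svalP (colorable_bounded n htq)).
Arguments ramsey_f : clear implicits.

Definition log2 (R : realType) (x : R) : R := (ln x / ln 2)%R.

(* Main.v *)
Require Import Defs.
From HB Require Import structures.
From mathcomp Require Import all_boot all_order all_algebra.
From mathcomp Require Import reals exp sequences.
From mathcomp Require Import ring lra zify.

(* When q < 4(t-1) a uniformly random colouring of the triples works.  Otherwise use a
   step-up colouring: vertices are 0/1 vectors of length m, a triple is split at its top
   level b into a pair (with bit e at b) and a point, the pair is split at a lower level a,
   and the colour is a random function of (b, e, a) whose law depends slightly on e.

   An n-set using only colours from a set C is a binary tree whose nodes are labelled by
   levels and in which (b, e, a) is a "C-edge" whenever a lies below b on side e.  C-edges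
   are independent, with probabilities p_e where p_0^(1/psi) + p_1^(1/psi) <= 1 for some
   psi > log(q/(t-1)); this is where the bias is needed.  One finds in the tree a small set
   of labels spanning so many C-edges that a union bound excludes it.  After pruning, both
   sides of every node carry a constant fraction of the leaves.  Call a label heavy at a
   node if a constant fraction of the leaves below pass through it: then almost every label
   between the node and a heavy label sees it in both directions.  Take the last depth at
   which a substantial part of the labels is still light, a node u there, and boundedly many
   random paths below u.  Their light labels are distinct, the heavy ones are shared and
   cost nothing, and counting the edges from the path above u to light labels, and the
   two-sided edges among the labels below u with a light end, gives at least log n edges
   (suitably weighted) for each light label, whereas a union bound tolerates only
   (log m)/psi. *)

Set Implicit Arguments.
Unset Strict Implicit.
Unset Printing Implicit Defensive.

Import Order.TTheory GRing.Theory Num.Theory.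

Local Open Scope ring_scope.

(** The union bound dictates the shape of the proof. To exclude one path below u one must also name
    the path above u and the heavy labels, which may take more bits than a single path earns. So
    many paths share one context. If heavy means frequency at least 1/T, there can be about [D * T]
    heavy labels, and [V * T] paths are needed to pay for them. Their light labels would collide
    unless light means frequency below 1/(U T), with [U] large against [V]. Labels of intermediate
    frequency are lost; a pigeonhole over the thresholds T = [U ^ j] finds one for which they are
    few. The value of log n per light label is Kraft's inequality. Above u an edge is available only
    on the side taken by the path. Below u both sides are, and together they are worth at least 2
    psi bits because the weights p_e^(1/psi) add up to at most 1. So the weights p_e^(1/psi) above u
    and 1/2 below it both fit Kraft's inequality, and most paths are worth psi log n bits per light
    label, up to a constant. *)

Lemma card_ffun_constrained (T X : finType) (F : {set T}) (good : T -> pred X) :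
  #|[set c : {ffun T -> X} | [forall e in F, good e (c e)]]|
    = ((\prod_(e in F) #|good e|) * #|X| ^ (#|T| - #|F|))%N.
Proof.
pose fam (e : T) := [pred x : X | (e \in F) ==> good e x].
have -> : #|[set c : {ffun T -> X} | [forall e in F, good e (c e)]]|
    = #|(family fam : pred {ffun T -> X})|.
  apply: eq_card => c; rewrite !inE; apply/forall_inP/familyP => [h e|h e eF].
    by rewrite inE; apply/implyP/h.
  by have := h e; rewrite inE eF.
rewrite card_family foldrE big_map big_enum /= (bigID (mem F)) /=.
congr (_ * _)%N.
  by apply: eq_bigr => e eF; apply: eq_card => x; rewrite unfold_in /= eF.
rewrite (eq_bigr (fun=> #|X|)); last first.
  by move=> e /negPf eF; apply: eq_card => x; rewrite unfold_in /= eF.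
by rewrite prod_nat_const -(cardC (mem F)) addKn; congr (_ ^ _)%N; apply: eq_card.
Qed.

(** * Counting probability on a finite set of colourings *)

Section Probability.
Variables (R : realFieldType) (Om : finType).

Definition pr (A : {set Om}) : R := #|A|%:R / #|Om|%:R.

Lemma le_pr (A B : {set Om}) : A \subset B -> pr A <= pr B.
Proof.
by move=> AB; apply: ler_wpM2r; rewrite ?invr_ge0 ?ler_nat ?subset_leq_card.
Qed.

Lemma prU (A B : {set Om}) : pr (A :|: B) <= pr A + pr B.
Proof.
rewrite /pr -mulrDl; apply: ler_wpM2r; rewrite ?invr_ge0 // -natrD ler_nat.
by rewrite cardsU leq_subr.
Qed.

Lemma pr_bigcup (I : finType) (A : I -> {set Om}) :
  pr (\bigcup_i A i) <= \sum_i pr (A i).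
Proof.
elim/big_rec2: _ => [|i x B _ h]; first by rewrite /pr cards0 mul0r.
exact: (le_trans (prU _ _)) (lerD _ _).
Qed.

Lemma pr_lt1_avoid (A : {set Om}) : (0 < #|Om|)%N -> pr A < 1 ->
  exists x, x \notin A.
Proof.
move=> Om0; rewrite /pr ltr_pdivrMr ?ltr0n // mul1r ltr_nat => h.
apply/existsP; apply: contraTT h; rewrite negb_exists -leqNgt => /forallP h.
apply/subset_leq_card/subsetP => x _; by have := h x; rewrite negbK.
Qed.

End Probability.

(** Values at distinct arguments are independent, so the probability is a product over [F]. *)
Lemma pr_ffun_constrained (R : realFieldType) (T X : finType) (F : {set T})
    (good : T -> pred X) (p : T -> R) :
  (0 < #|X|)%N -> (forall e, #|good e|%:R <= p e * #|X|%:R) ->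
  pr R [set c : {ffun T -> X} | [forall e in F, good e (c e)]]
    <= \prod_(e in F) p e.
Proof.
move=> X0 hp; have X0' : 0 < #|X|%:R :> R by rewrite ltr0n.
rewrite /pr card_ffun_constrained card_ffun natrM natr_prod.
rewrite -(subnKC (max_card (mem F))) /= addKn expnD natrM -mulf_div.
rewrite divff ?mulr1 ?pnatr_eq0 ?expn_eq0 ?negb_and -?lt0n ?X0 //.
rewrite natrX -prodr_const -prodf_div.
apply: ler_prod => e eF; rewrite divr_ge0 //=.
by rewrite ler_pdivrMr.
Qed.

(** * Groups of edges and the union bound over them *)

Section Groups.
Variables (lab : finType) (Dq Kz D x0 : nat).

(* [inl (inl _)] is an unused position, [inl (inr (late, a))] a light label [a], [late] telling
   whether it lies below the second cut, and [inr z] the [z]-th shared label of the context. *)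
Definition entry := (unit + (bool * lab) + 'I_Kz)%type.
(** The second component lists for each position [j] up to [x0] positions whose edges to [j] are
    given up because they may be one-sided. *)
Definition group := ({ffun 'I_D -> entry} * {ffun 'I_D -> {ffun 'I_x0 -> 'I_D}})%type.
(** What all groups share: the path above the cut and the heavy labels. *)
Definition context := ({ffun 'I_Dq -> option (lab * bool)} * {ffun 'I_Kz -> lab})%type.

Definition entry_label (zl : {ffun 'I_Kz -> lab}) (x : entry) : option lab :=
  match x with
  | inl (inl _) => None
  | inl (inr y) => Some y.2
  | inr z => Some (zl z)
  end.

Definition is_light (x : entry) : bool :=
  if x is inl (inr _) then true else false.

(** Pairs for which the edges on both sides are available. A shared label sees nearly everything
    below the first cut on both sides, a late light label only what lies below the second cut. Pairs
    of shared labels are left out: without a light end they could recur in other groups. *)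
Definition linked (x y : entry) : bool :=
  match x, y with
  | inl (inr (true, _)), inl (inr (true, _)) => true
  | inl (inr _), inr _ => true
  | inr _, inl (inr (true, _)) => true
  | _, _ => false
  end.

Definition light_size (g : group) : nat := #|[set j | is_light (g.1 j)]|.

Definition group_pair (g : group) (k j : 'I_D) : bool :=
  [&& (k < j)%N, linked (g.1 k) (g.1 j) & k \notin codom (g.2 j)].

(** A context edge carries the bit chosen by the path, an inner edge either bit. *)
Definition group_edges (x : context) (g : group) : {set lab * bool * lab} :=
  [set e | [exists j : 'I_D, (entry_label x.2 (g.1 j) == Some e.2) &&
     ((is_light (g.1 j) && [exists i, x.1 i == Some e.1]) ||
      [exists k, (entry_label x.2 (g.1 k) == Some e.1.1) && group_pair g k j])]].

Variables (R : realFieldType) (p : bool -> R).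

Definition edge_weight (F : {set lab * bool * lab}) : R := \prod_(e in F) p e.1.2.

Lemma sum_light_groups : (0 < #|lab|)%N ->
  \sum_(g : group) (#|lab|%:R^-1) ^+ light_size g
    = (3 + Kz)%:R ^+ D * (D ^ (x0 * D))%:R :> R.
Proof.
move=> lab0.
rewrite -(pair_bigA _ (fun (e : {ffun 'I_D -> entry}) (_ : {ffun 'I_D -> {ffun 'I_x0 -> 'I_D}}) =>
   (#|lab|%:R^-1 : R) ^+ #|[set j | is_light (e j)]|)) /=.
under eq_bigr => e _ do rewrite sumr_const !card_ffun !card_ord -expnM.
rewrite sumrMnl -[LHS]mulr_natr; congr (_ * _).
transitivity (\sum_(e : {ffun 'I_D -> entry})
    \prod_(j < D) (if is_light (e j) then #|lab|%:R^-1 else 1 : R)).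
  apply: eq_bigr => e _; rewrite -big_mkcond /= prodr_const; congr (_ ^+ _).
  by apply: eq_card => j; rewrite !inE.
rewrite -(bigA_distr_bigA (fun (j : 'I_D) (x : entry) =>
   (if is_light x then #|lab|%:R^-1 else 1 : R))) /=.
rewrite prodr_const card_ord; congr (_ ^+ _).
rewrite !big_sumType /= !sumr_const card_prod card_bool card_ord card_unit.
rewrite -[X in _ + X + _]mulr_natr mulrC natrM mulfK ?pnatr_eq0 -?lt0n //.
by rewrite -!natrD; congr (_%:R); lia.
Qed.

Variables (X : finType) (good : bool -> pred X).
Hypotheses (X0 : (0 < #|X|)%N) (lab0 : (0 < #|lab|)%N).
Hypothesis (hp : forall d, #|good d|%:R <= p d * #|X|%:R).

Lemma p_ge0 d : 0 <= p d.
Proof.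
have := le_trans (ler0n R #|good d|) (hp d).
by rewrite pmulr_lge0 // ltr0n.
Qed.

Lemma edge_weight_ge0 F : 0 <= edge_weight F.
Proof. by apply: prodr_ge0 => e _; apply: p_ge0. Qed.

Definition edge_graph (c : {ffun lab * bool * lab -> X}) : {set lab * bool * lab} :=
  [set e | good e.1.2 (c e)].

Lemma pr_edge_graph (F : {set lab * bool * lab}) :
  pr R [set c : {ffun lab * bool * lab -> X} | F \subset edge_graph c] <= edge_weight F.
Proof.
apply: le_trans (@pr_ffun_constrained R _ X F (fun e => good e.1.2) (fun e => p e.1.2) X0 _).
  apply: le_pr; apply/subsetP => c; rewrite !inE => /subsetP h.
  by apply/forall_inP => e /h; rewrite inE.
by move=> e; apply: hp.
Qed.

(** Weighs the probability of the edges against the number of choices of the light labels. *)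
Definition cheap (delta : R) (x : context) (g : group) : bool :=
  edge_weight (group_edges x g) * #|lab|%:R ^+ light_size g <= delta.

Definition has_groups (N : nat) (delta : R) (G : {set lab * bool * lab}) : bool :=
  [exists x : context, exists g : {ffun 'I_N -> group},
    [&& [forall r, cheap delta x (g r)],
        [forall r1, forall r2, (r1 != r2) ==>
           [disjoint group_edges x (g r1) & group_edges x (g r2)]] &
        [forall r, group_edges x (g r) \subset G]]].

Lemma sum_cheap (delta : R) (x : context) : 0 <= delta ->
  \sum_(g | cheap delta x g) edge_weight (group_edges x g)
    <= delta * ((3 + Kz)%:R ^+ D * (D ^ (x0 * D))%:R).
Proof.
move=> d0; rewrite -sum_light_groups // mulr_sumr big_mkcond /=.
apply: ler_sum => g _; case: ifP => [|_]; last first.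
  by rewrite mulr_ge0 // exprn_ge0 // invr_ge0.
by rewrite /cheap exprVn ler_pdivlMr // exprn_gt0 // ltr0n.
Qed.

(** Disjointness makes the probability for [N] groups a product, so for a fixed context the sum over
    families of groups factors. The two leading factors count the contexts. *)
Lemma pr_has_groups (N : nat) (delta : R) : 0 <= delta ->
  pr R [set c : {ffun lab * bool * lab -> X} | has_groups N delta (edge_graph c)]
  <= (2 * #|lab| + 1)%:R ^+ Dq * #|lab|%:R ^+ Kz *
     (delta * ((3 + Kz)%:R ^+ D * (D ^ (x0 * D))%:R)) ^+ N.
Proof.
move=> d0.
pose ok (xg : context * {ffun 'I_N -> group}) :=
   [forall r, cheap delta xg.1 (xg.2 r)] && [forall r1, forall r2, (r1 != r2) ==>
           [disjoint group_edges xg.1 (xg.2 r1) & group_edges xg.1 (xg.2 r2)]].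
pose ev (xg : context * {ffun 'I_N -> group}) : {set {ffun lab * bool * lab -> X}} :=
  if ok xg then [set c | \bigcup_r group_edges xg.1 (xg.2 r) \subset edge_graph c]
  else set0.
have sub : [set c : {ffun lab * bool * lab -> X} | has_groups N delta (edge_graph c)]
    \subset \bigcup_xg ev xg.
  apply/subsetP => c; rewrite inE => /existsP[x /existsP[g /and3P[h1 h2 /forallP h3]]].
  apply/bigcupP; exists (x, g) => //; rewrite /ev /ok h1 h2 inE.
  by apply/bigcupsP => r _; apply: h3.
apply: le_trans (le_pr R sub) _; apply: le_trans (pr_bigcup _ _) _.
apply: (@le_trans _ _ (\sum_(x : context) \sum_(g : {ffun 'I_N -> group})
   \prod_r (if cheap delta x (g r) then edge_weight (group_edges x (g r)) else 0))).
  rewrite pair_bigA /=; apply: ler_sum => -[x g] _; rewrite /ev.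
  have pos : 0 <= \prod_r (if cheap delta x (g r) then edge_weight (group_edges x (g r)) else 0).
    by apply: prodr_ge0 => r _; case: ifP => // _; apply: edge_weight_ge0.
  case: ifP => [/andP[/= /forallP h1 h2]|_]; last by rewrite /pr cards0 mul0r.
  apply: le_trans (pr_edge_graph _) _; rewrite /edge_weight partition_disjoint_bigcup.
    by apply: ler_prod => r _; rewrite h1 lexx andbT; apply: edge_weight_ge0.
  by move=> r1 r2 r12; have /forallP /(_ r2) /implyP := forallP h2 r1; apply.
set Y := delta * _.
have -> : (2 * #|lab| + 1)%:R ^+ Dq * #|lab|%:R ^+ Kz * Y ^+ N
    = \sum_(x : context) Y ^+ N.
  rewrite sumr_const card_prod !card_ffun card_option card_prod card_bool !card_ord.
  by rewrite -[RHS]mulr_natl natrM !natrX [(#|lab| * 2)%N]mulnC addn1.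
apply: ler_sum => x _.
rewrite -(bigA_distr_bigA (fun (r : 'I_N) (g : group) =>
   if cheap delta x g then edge_weight (group_edges x g) else 0 : R)) /=.
rewrite prodr_const card_ord -big_mkcond /=.
by apply: lerXn2r; rewrite ?nnegrE ?sum_cheap // /Y ?mulr_ge0 ?exprn_ge0 //;
  apply: sumr_ge0 => g _; apply: edge_weight_ge0.
Qed.

End Groups.

(** * Counting linked pairs of positions *)

Lemma card_ltn_pairs (D : nat) (sym : rel 'I_D) : symmetric sym ->
  (2 * #|[set x : 'I_D * 'I_D | (x.1 < x.2)%N && sym x.1 x.2]|
   + #|[set k : 'I_D | sym k k]| = #|[set x : 'I_D * 'I_D | sym x.1 x.2]|)%N.
Proof.
move=> symC; set A := [set x | _]; set Dg := [set k | _]; set S := [set x | _].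
have swapK : involutive (fun x : 'I_D * 'I_D => (x.2, x.1)) by case.
(* The increasing pairs, their mirror images and the diagonal partition the relation. *)
pose A' := [set (x.2, x.1) | x in A].
pose Dg' := [set (k, k) | k in Dg].
have <- : #|A'| = #|A| by rewrite card_imset //; apply: inv_inj.
have cD : #|Dg'| = #|Dg| by rewrite card_imset // => k1 k2 [].
have A'E x : (x \in A') = (x.2 < x.1)%N && sym x.1 x.2.
  apply/imsetP/idP => [[y]|h]; first by rewrite inE symC => h -> /=.
  by exists (x.2, x.1); rewrite ?inE /= -?surjective_pairing // symC.
have DgE x : (x \in Dg') = (x.1 == x.2) && sym x.1 x.2.
  apply/imsetP/andP => [[y]|[/eqP h1 h2]]; first by rewrite inE => h -> /=.
  exists x.1; first by rewrite inE {2}h1.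
  by rewrite {1}[x]surjective_pairing -h1.
have cA : #|A'| = #|A| by rewrite card_imset //; apply: inv_inj.
rewrite mul2n -addnn {2}cA -cD.
have -> : S = A' :|: A :|: Dg'.
  apply/setP => x; rewrite !inE A'E DgE.
  have -> : (x.1 == x.2) = (x.1 == x.2 :> nat) by [].
  by case: ltngtP; case: (sym _ _).
rewrite cardsU (_ : (A' :|: A) :&: Dg' = set0); last first.
  apply/setP => x; rewrite !inE A'E DgE.
  have -> : (x.1 == x.2) = (x.1 == x.2 :> nat) by [].
  by case: ltngtP; rewrite ?andbF.
rewrite cardsU (_ : A' :&: A = set0) ?cards0 ?subn0 //.
apply/setP => x; rewrite !inE A'E; by case: ltngtP; rewrite ?andbF.
Qed.

Section LinkCount.
Variables (D : nat) (J1 J2 Z : {set 'I_D}).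
Hypotheses (dJ12 : [disjoint J1 & J2]) (dJ1Z : [disjoint J1 & Z])
  (dJ2Z : [disjoint J2 & Z]).
Hypothesis J1lt : forall k j, k \in J1 -> j \in Z -> (k < j)%N.

(** [J1] stands for the early light positions, [J2] for the late light ones, [Z] for the shared
    ones. *)
Definition link (k j : 'I_D) : bool :=
  [|| (k \in J2) && (j \in J2), (k \in J1 :|: J2) && (j \in Z) | (k \in Z) && (j \in J2)].

(** Apart from the pairs in [J1] times [Z] the relation is symmetric, and those pairs are all
    increasing by [J1lt]. *)
Lemma card_link :
  (2 * #|[set x : 'I_D * 'I_D | (x.1 < x.2)%N && link x.1 x.2]| + #|J2|
   = 2 * (#|J1| + #|J2|) * #|Z| + #|J2| ^ 2)%N.
Proof.
pose core (k j : 'I_D) := [|| (k \in J2) && (j \in J2), (k \in J2) && (j \in Z) | (k \in Z) && (j \in J2)].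
have coreC : symmetric core by move=> k j; rewrite /core; do !case: (_ \in _).
have hc := card_ltn_pairs coreC.
have e1 : [set k | core k k] = J2.
  apply/setP => k; rewrite !inE /core.
  have := disjoint_setI0 dJ2Z => /setP /(_ k); rewrite !inE.
  by case: (k \in J2); case: (k \in Z).
have e2 : #|[set x : 'I_D * 'I_D | core x.1 x.2]| = (#|J2| ^ 2 + 2 * #|J2| * #|Z|)%N.
  have -> : [set x : 'I_D * 'I_D | core x.1 x.2] = (setX J2 J2 :|: setX J2 Z) :|: setX Z J2.
    by apply/setP => -[k j]; rewrite !inE /core /= orbA.
  have z k : (k \in J2) && (k \in Z) = false.
    by have := disjoint_setI0 dJ2Z => /setP /(_ k); rewrite !inE.
  rewrite cardsU (_ : _ :&: _ = set0); last first.
    apply/setP => -[k j]; rewrite !inE /=; have := z k.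
    by do !case: (_ \in _).
  rewrite cardsU (_ : _ :&: _ = set0); last first.
    apply/setP => -[k j]; rewrite !inE /=; have := z j.
    by do !case: (_ \in _).
  rewrite !cards0 !cardsX !subn0 -!mulnn; move: #|J2| #|Z| => a b; lia.
have e3 : #|[set x : 'I_D * 'I_D | (x.1 < x.2)%N && link x.1 x.2]|
   = (#|[set x : 'I_D * 'I_D | (x.1 < x.2)%N && core x.1 x.2]| + #|J1| * #|Z|)%N.
  rewrite -cardsX.
  have -> : [set x : 'I_D * 'I_D | (x.1 < x.2)%N && link x.1 x.2] =
     [set x : 'I_D * 'I_D | (x.1 < x.2)%N && core x.1 x.2] :|: setX J1 Z.
    apply/setP => -[k j]; rewrite !inE /core /link !inE /=.
    have := @J1lt k j.
    case: (k \in J1); case: (j \in Z); rewrite /= ?andbF ?orbF ?andbT ?orbT //.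
    by move=> ->.
  rewrite cardsU (_ : _ :&: _ = set0) ?cards0 ?subn0 //.
  apply/setP => -[k j]; rewrite !inE /core /=.
  have := disjoint_setI0 dJ12 => /setP /(_ k); rewrite !inE.
  have := disjoint_setI0 dJ1Z => /setP /(_ k); rewrite !inE.
  by case: (k \in J1); case: (k \in Z); case: (k \in J2); rewrite /= ?andbF.
rewrite e1 e2 in hc; rewrite e3; move: hc; rewrite -!mulnn.
move: #|J2| #|Z| #|J1| #|_| => j z j1 c; lia.
Qed.

(** A linked pair will count for two edges. Up to a loss of [w + 1], every light position then gets
    one edge for each position of [J2] and [Z]. *)
Lemma card_link_ge (w : nat) : (#|J1| <= w)%N ->
  ((#|J1| + #|J2|) * (#|J2| + #|Z|) <=
   2 * #|[set x : 'I_D * 'I_D | (x.1 < x.2)%N && link x.1 x.2]| +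
   (#|J1| + #|J2|) * (w + 1))%N.
Proof.
move=> hw; have := card_link; set a := #|J1|; set b := #|J2|; set z := #|Z|.
rewrite -/a in hw; set L := #|[set x | _]| => h.
have h1 : (a * b <= b * w)%N by rewrite mulnC leq_mul2l hw orbT.
by move: h; rewrite -mulnn; nia.
Qed.

End LinkCount.

(** * The group of edges found along one path *)

Section WordGroup.
Variables (lab : finType) (d : lab * bool) (Dq Kz D x0 c : nat).
Variables (w : seq (lab * bool)) (J1 J2 Z : pred nat) (zl : {ffun 'I_Kz -> lab}).
Variables (exc : nat -> seq nat) (G : {set lab * bool * lab}).

Local Notation lb j := (nth d w j).1.

Hypotheses (uw : uniq (map fst w)) (sw : (size w <= D)%N) (cw : (c <= size w)%N)
  (cq : (c <= Dq)%N).
Hypothesis J1P : forall j, J1 j -> (c <= j < size w)%N /\ ~~ J2 j && ~~ Z j.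
Hypothesis J2P : forall j, J2 j -> (c <= j < size w)%N /\ ~~ Z j.
Hypothesis ZP : forall j, Z j -> (c <= j < size w)%N /\ exists z, zl z = lb j.
Hypothesis J1Z : forall k j, J1 k -> Z j -> (k < j)%N.
Hypothesis pathG : forall k j, (k < j)%N -> (j < size w)%N -> (nth d w k, lb j) \in G.

Definition linkn (k j : nat) : bool :=
  [|| J2 k && J2 j, (J1 k || J2 k) && Z j | Z k && J2 j].

Hypothesis excP : forall j, (size (exc j) <= x0)%N.
Hypothesis bothG : forall k j e, (k < j)%N -> linkn k j -> k \notin exc j ->
  (lb k, e, lb j) \in G.

Definition word_entry (j : nat) : entry lab Kz :=
  if J1 j then inl (inr (false, lb j)) else
  if J2 j then inl (inr (true, lb j)) else
  if Z j then (if [pick z | zl z == lb j] is Some z then inr z else inl (inl tt))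
  else inl (inl tt).

(** Short exception lists are padded with [j] itself, which excludes nothing since [j] is paired
    only with earlier positions. *)
Definition word_group : group lab Kz D x0 :=
  ([ffun j : 'I_D => word_entry j],
   [ffun j : 'I_D => [ffun i : 'I_x0 => insubd j (nth (val j) (exc j) i)]]).

Definition word_context : context lab Dq Kz :=
  ([ffun i : 'I_Dq => if (i < c)%N then Some (nth d w i) else None], zl).

Lemma word_entry_label j : J1 j || J2 j || Z j ->
  entry_label zl (word_entry j) = Some (lb j).
Proof.
rewrite /word_entry; case: ifP => //= _; case: ifP => //= _ hZ; rewrite hZ.
have [_ [z hz]] := ZP hZ.
by case: pickP => [y /eqP /= -> //|/(_ z)]; rewrite hz eqxx.
Qed.

Lemma word_entry_labelP j a : entry_label zl (word_entry j) = Some a ->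
  a = lb j /\ (c <= j < size w)%N.
Proof.
move=> h; have : J1 j || J2 j || Z j.
  by move: h; rewrite /word_entry; do !case: ifP => //.
move=> hj; move: h; rewrite word_entry_label // => -[<-]; split=> //.
by case/orP: hj => [/orP[/J1P[]|/J2P[]]|/ZP[]].
Qed.

Lemma word_entry_light j : is_light (word_entry j) = J1 j || J2 j.
Proof.
rewrite /word_entry; case: ifP => //= _; case: ifP => //= _; case: ifP => //= _.
by case: pickP.
Qed.

Lemma word_entry_linked k j : linked (word_entry k) (word_entry j) = linkn k j.
Proof.
have cases i : [\/ (J1 i, J2 i, Z i) = (true, false, false) /\ word_entry i = inl (inr (false, lb i)),
      (J1 i, J2 i, Z i) = (false, true, false) /\ word_entry i = inl (inr (true, lb i)),
      (J1 i, J2 i, Z i) = (false, false, true) /\ exists z, word_entry i = inr z |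
      (J1 i, J2 i, Z i) = (false, false, false) /\ word_entry i = inl (inl tt)].
  rewrite /word_entry; case h1 : (J1 i).
    by have [_ /andP[/negPf -> /negPf ->]] := J1P h1; constructor 1.
  case h2 : (J2 i); first by have [_ /negPf ->] := J2P h2; constructor 2.
  case h3 : (Z i); last by constructor 4.
  have [_ [z hz]] := ZP h3; constructor 3; split=> //.
  by case: pickP => [y _|/(_ z)]; [exists y | rewrite hz eqxx].
rewrite /linkn; case: (cases k) => [][[-> -> ->] hk]; case: (cases j) => [][[_ -> ->] hj];
  try (case: hk => zk hk); try (case: hj => zj hj); by rewrite hk hj.
Qed.

Lemma word_light_size : light_size word_group = #|[set j : 'I_D | J1 j || J2 j]|.
Proof. by apply: eq_card => j; rewrite !inE ffunE word_entry_light. Qed.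

Lemma mem_exc (k j : 'I_D) : val k \in exc j -> k \in codom (word_group.2 j).
Proof.
move=> kj; have ix : (index (val k) (exc j) < x0)%N.
  by apply: leq_trans (excP j); rewrite index_mem.
apply/codomP; exists (Ordinal ix); rewrite !ffunE /= nth_index //.
by apply: val_inj; rewrite val_insubd ltn_ord.
Qed.

Lemma word_group_sub : group_edges word_context word_group \subset G.
Proof.
apply/subsetP => -[[b e] a]; rewrite inE => /existsP[j /andP[/eqP]].
rewrite ffunE => /word_entry_labelP[/= -> /andP[cj jw]].
case/orP => [/andP[_ /existsP[i]]|/existsP[k /andP[/eqP]]].
  rewrite ffunE; case: ifP => // ic /eqP[<-].
  by apply: pathG => //; apply: leq_trans cj.
rewrite ffunE => /word_entry_labelP[-> _] /and3P[kj + kex].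
rewrite !ffunE word_entry_linked => lk.
by apply: bothG => //; apply: contra kex; apply: mem_exc.
Qed.

(** Serves to separate groups: a light label that is new to the other groups cannot be an end of
    their edges. *)
Lemma word_group_ends e : e \in group_edges word_context word_group ->
  (exists2 j, J1 j || J2 j & lb j \in [:: e.1.1; e.2]) /\
  (forall b, b \in [:: e.1.1; e.2] -> (exists2 j, J1 j || J2 j & b = lb j) \/
     (exists2 j, Z j & b = lb j) \/ (exists2 i, (i < c)%N & b = lb i)).
Proof.
have light_or j a : entry_label zl (word_entry j) = Some a ->
    (exists2 j, J1 j || J2 j & a = lb j) \/ (exists2 j, Z j & a = lb j).
  move=> h; have [hl _] := word_entry_labelP h.
  case: (boolP (J1 j || J2 j)) => [hj|]; first by left; exists j.
  move: h; rewrite /word_entry; case: ifP => //= _; case: ifP => //= _.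
  by case: ifP => // hZ _ _; right; exists j.
case: e => -[b e] a; rewrite inE => /existsP[j /andP[/eqP]] /=.
rewrite ffunE => hj; have [ea _] := word_entry_labelP hj.
case/orP => [/andP[lj /existsP[i]]|/existsP[k /andP[/eqP]]].
  rewrite ffunE; case: ifP => // ic /eqP[hb].
  split; first by exists j; rewrite -?word_entry_light // -ea !inE eqxx orbT.
  move=> x; rewrite !inE => /orP[] /eqP ->; last by have [] := light_or _ _ hj; auto.
  by right; right; exists i; rewrite // hb.
rewrite ffunE => hk /and3P[_]; rewrite !ffunE word_entry_linked => lk _.
have [eb _] := word_entry_labelP hk.
split; last first.
  move=> x; rewrite !inE => /orP[] /eqP ->.
    by have [] := light_or _ _ hk; auto.
  by have [] := light_or _ _ hj; auto.
case/or3P: lk => /andP[h1 h2].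
- by exists j; rewrite ?h2 ?orbT // -ea !inE eqxx orbT.
- by exists k; rewrite ?h1 // -eb !inE eqxx.
- by exists j; rewrite ?h2 ?orbT // -ea !inE eqxx orbT.
Qed.

Lemma lb_inj i j : (i < size w)%N -> (j < size w)%N -> lb i = lb j -> i = j.
Proof.
move=> iw jw; rewrite -!(nth_map d d.1 fst) // => /eqP.
by rewrite nth_uniq ?size_map // => /eqP.
Qed.

Variables (R : realFieldType) (l : bool -> R).
Hypothesis l0 : forall e, 0 <= l e.

Let J1s := [set j : 'I_D | J1 j].
Let J2s := [set j : 'I_D | J2 j].
Let Zs := [set j : 'I_D | Z j].

Lemma card_group_pairs :
  (#|[set x : 'I_D * 'I_D | (x.1 < x.2)%N && link J1s J2s Zs x.1 x.2]| <=
   #|[set x : 'I_D * 'I_D | group_pair word_group x.1 x.2]| + x0 * D)%N.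
Proof.
set A := [set x | _]; set B := [set x | _].
pose E := [set ((word_group.2 y.2 y.1, y.2) : 'I_D * 'I_D) | y in [set: 'I_x0 * 'I_D]].
have cE : (#|E| <= x0 * D)%N.
  apply: leq_trans (leq_imset_card _ _) _.
  by rewrite cardsT card_prod !card_ord.
apply: leq_trans (leq_add (leqnn _) cE); apply: leq_trans (leq_card_setU _ _).
apply/subset_leq_card/subsetP => -[k j]; rewrite !inE /= => /andP[kj lk].
have lk' : linked (word_group.1 k) (word_group.1 j).
  by rewrite !ffunE word_entry_linked; move: lk; rewrite /link /linkn !inE.
rewrite /group_pair kj lk' andTb.
case: (boolP (k \in codom (word_group.2 j))) => //= /codomP[i ik].
by apply/imsetP; exists (i, j); rewrite ?inE // ik.
Qed.

(** Context edges and inner edges differ because their upper labels lie on opposite sides of the cut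
    and the labels of a path are distinct. A pair contributes both of its directions. *)
Lemma group_cost_ge :
  #|[set j : 'I_D | J1 j || J2 j]|%:R * (\sum_(0 <= i < c) l (nth d w i).2)
  + (l true + l false) * #|[set x : 'I_D * 'I_D | group_pair word_group x.1 x.2]|%:R
  <= \sum_(e in group_edges word_context word_group) l e.1.2.
Proof.
set J := [set j | _]; set P := [set x | _].
pose A := [set x : 'I_Dq * 'I_D | (x.1 < c)%N && (x.2 \in J)].
pose f (x : 'I_Dq * 'I_D) := (nth d w x.1, lb x.2).
pose B := setX [set: bool] P.
pose h (y : bool * ('I_D * 'I_D)) := (lb y.2.1, y.1, lb y.2.2).
have Jw (j : 'I_D) : j \in J -> (c <= j < size w)%N.
  by rewrite inE => /orP[/J1P[]|/J2P[]].
have lkw k j : linkn k j -> (c <= k < size w)%N /\ (c <= j < size w)%N.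
  by case/or3P => /andP[]; first [move=> /J2P[? _] /J2P[? _] |
     move=> /orP[/J1P[? _]|/J2P[? _]] /ZP[? _] | move=> /ZP[? _] /J2P[? _]].
have Pw x : x \in P -> (c <= x.1 < size w)%N /\ (c <= x.2 < size w)%N.
  by rewrite inE => /and3P[_]; rewrite !ffunE word_entry_linked => /lkw.
have finj : {in A &, injective f}.
  move=> [i1 j1] [i2 j2]; rewrite !inE /= => /andP[ic1 J1'] /andP[ic2 J2'] [e1 e2].
  have /andP[_ w1] := Jw j1 ltac:(by rewrite inE).
  have /andP[_ w2] := Jw j2 ltac:(by rewrite inE).
  congr (_, _); apply: val_inj => /=; last exact: (lb_inj w1 w2 e2).
  by apply: lb_inj; rewrite ?e1 ?(leq_trans ic1) ?(leq_trans ic2).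
have hinj : {in B &, injective h}.
  move=> [x1 [k1 j1]] [x2 [k2 j2]]; rewrite !in_setX !in_setT /= => /Pw[/= a1 b1] /Pw[/= a2 b2].
  move=> [e1 -> e2]; congr (_, (_, _)); apply: val_inj => /=.
    by apply: lb_inj => //; [case/andP: a1|case/andP: a2].
  by apply: lb_inj => //; [case/andP: b1|case/andP: b2].
have fsub : f @: A \subset group_edges word_context word_group.
  apply/subsetP => _ /imsetP[[i j] ij ->]; move: ij; rewrite !inE /= => /andP[ic jJ].
  apply/existsP; exists j; rewrite ffunE word_entry_label ?jJ // eqxx /=.
  by rewrite word_entry_light jJ /=; apply/orP; left; apply/existsP; exists i; rewrite ffunE ic.
have hsub : h @: B \subset group_edges word_context word_group.
  apply/subsetP => _ /imsetP[[x [k j]] kj ->]; move: kj; rewrite in_setX in_setT /= inE => kj.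
  have lk : linkn k j by case/and3P: kj => _; rewrite !ffunE word_entry_linked.
  rewrite inE; apply/existsP; exists j; rewrite ffunE /= word_entry_label; last first.
    by case/or3P: lk => /andP[_ ->]; rewrite ?orbT.
  rewrite eqxx /=; apply/orP; right; apply/existsP; exists k; rewrite kj andbT ffunE word_entry_label //.
  by case/or3P: lk => /andP[]; [move=> -> | move=> /orP[] -> | move=> ->]; rewrite ?orbT.
have dis : [disjoint f @: A & h @: B].
  rewrite -setI_eq0; apply/eqP/setP => e; rewrite !inE; apply/negP => /andP[/imsetP[[i j] ij ->]].
  case/imsetP => -[x [k j']] kj [e1 _]; move: kj; rewrite in_setX in_setT /= => /Pw[/= /andP[ck kw] _].
  move: ij; rewrite !inE /= => /andP[ic _].
  have iw := leq_trans ic cw.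
  have ik : i = k :> nat by apply: lb_inj => //; rewrite e1.
  by rewrite -ik leqNgt ic in ck.
apply: (@le_trans _ _ (\sum_(e in f @: A :|: h @: B) l e.1.2)); last first.
  have s : f @: A :|: h @: B \subset group_edges word_context word_group by rewrite subUset fsub.
  rewrite [leRHS](big_setID (f @: A :|: h @: B)) /= (setIidPr s) lerDl.
  by apply: sumr_ge0.
rewrite (eq_bigl [predU f @: A & h @: B]); last by move=> e; rewrite !inE.
rewrite bigU //= !big_imset //=; apply: lerD.
  rewrite (eq_bigl (fun x : 'I_Dq * 'I_D => (x.1 < c)%N && (x.2 \in J))); last by move=> x; rewrite inE.
  rewrite -(pair_big (fun i : 'I_Dq => (i < c)%N) (fun j => j \in J) (fun i _ => l (nth d w i).2)) /=.
  rewrite (eq_bigr (fun i : 'I_Dq => l (nth d w i).2 *+ #|J|)); last first.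
    by move=> i _; rewrite -sumr_const; apply: eq_bigl.
  rewrite sumrMnl -[leRHS]mulr_natl ler_wpM2l // big_mkord.
  rewrite (big_ord_widen_cond Dq predT (fun i => l (nth d w i).2)) //=.
rewrite (eq_bigl (fun y : bool * ('I_D * 'I_D) => predT y.1 && (y.2 \in P))); last first.
  by move=> [y1 y2]; rewrite in_setX in_setT.
rewrite -(pair_big predT (fun x => x \in P) (fun x _ => l x)) /=.
rewrite (eq_bigr (fun x => l x *+ #|P|)); last first.
  by move=> x _; rewrite -sumr_const; apply: eq_bigl.
by rewrite sumrMnl big_bool -[leRHS]mulr_natr.
Qed.

(** Since the two directions of a pair cost at least 2 together, each light label earns the cost of
    the path above the cut and about one unit for each usable level below it. *)
Lemma group_cost (wd : nat) : 2 <= l true + l false -> (#|J1s| <= wd)%N ->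
  let J := #|J1s|%:R + #|J2s|%:R in
  J * (\sum_(0 <= i < c) l (nth d w i).2) + J * (#|J2s| + #|Zs|)%:R
   - J * (wd + 1)%:R - 2 * (x0 * D)%:R
  <= \sum_(e in group_edges word_context word_group) l e.1.2.
Proof.
move=> l2 hw; set J := (_ + _) => /=; apply: le_trans group_cost_ge.
have cJ : #|[set j : 'I_D | J1 j || J2 j]| = (#|J1s| + #|J2s|)%N.
  rewrite -cardsUI (_ : J1s :&: J2s = set0) ?cards0 ?addn0.
    by apply: eq_card => j; rewrite !inE.
  apply/setP => j; rewrite !inE; apply/negP => /andP[/J1P[_ /andP[h _]]].
  exact/negP.
have -> : #|[set j : 'I_D | J1 j || J2 j]|%:R = J :> R by rewrite cJ natrD.
have dj (A B : pred nat) : (forall j, A j -> ~~ B j) ->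
    [disjoint [set j : 'I_D | A j] & [set j : 'I_D | B j]].
  move=> h; rewrite -setI_eq0; apply/eqP/setP => j; rewrite !inE.
  by apply/negP => /andP[/h /negP].
have d1 : [disjoint J1s & J2s] by apply: dj => j /J1P[_ /andP[]].
have d2 : [disjoint J1s & Zs] by apply: dj => j /J1P[_ /andP[]].
have d3 : [disjoint J2s & Zs] by apply: dj => j /J2P[_].
have lt (k j : 'I_D) : k \in J1s -> j \in Zs -> (k < j)%N by rewrite !inE; apply: J1Z.
have hl := card_link_ge d1 d2 d3 lt hw.
have hp := card_group_pairs.
set P := #|[set x : 'I_D * 'I_D | group_pair _ x.1 x.2]| in hp *.
set L := #|[set x : 'I_D * 'I_D | _ && _]| in hp hl.
set S := \sum_(_ <= i < _) _.
have h1 : J * (#|J2s| + #|Zs|)%:R <= 2 * L%:R + J * (wd + 1)%:R.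
  by rewrite /J -!natrD -!natrM -natrD ler_nat.
have h2 : L%:R <= P%:R + (x0 * D)%:R :> R by rewrite -natrD ler_nat.
have h3 : 2 * P%:R <= (l true + l false) * P%:R by rewrite ler_wpM2r.
by lra.
Qed.

End WordGroup.

(** * Labelled binary trees: Kraft's inequality, pruning, one-sided nodes *)

Section Trees.
Variable lab : eqType.

Inductive tree := Leaf | Node of lab & tree & tree.

Fixpoint labels (t : tree) : seq lab :=
  if t is Node b l r then b :: labels l ++ labels r else [::].

Fixpoint paths (t : tree) : seq (seq (lab * bool)) :=
  if t is Node b l r then
    [seq (b, false) :: w | w <- paths l] ++ [seq (b, true) :: w | w <- paths r]
  else [:: [::]].

Definition nleaves (t : tree) : nat := size (paths t).

Lemma nleaves_node b l r : nleaves (Node b l r) = (nleaves l + nleaves r)%N.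
Proof. by rewrite /nleaves /= size_cat !size_map. Qed.

Lemma nleaves_gt0 t : (0 < nleaves t)%N.
Proof. by elim: t => // b l hl r hr; rewrite nleaves_node addn_gt0 hl. Qed.

Lemma paths_labels t w : w \in paths t -> {subset map fst w <= labels t}.
Proof.
elim: t w => [|b l hl r hr] w /=; first by rewrite inE => /eqP -> a.
rewrite mem_cat => /orP[] /mapP[v hv ->] a; rewrite /= !inE mem_cat => /orP[->//|].
  by move=> /(hl _ hv) ->; rewrite orbT.
by move=> /(hr _ hv) ->; rewrite !orbT.
Qed.

Fixpoint wf (G : pred (lab * bool * lab)) (t : tree) : bool :=
  if t is Node b l r then
    [&& all (fun a => G (b, false, a)) (labels l), all (fun a => G (b, true, a)) (labels r),
        wf G l & wf G r]
  else true.

Lemma wf_path G t w (d : lab * bool) k j : wf G t -> w \in paths t ->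
  (k < j)%N -> (j < size w)%N -> G (nth d w k, (nth d w j).1).
Proof.
elim: t w k j => [|b l hl r hr] w k j /=; first by rewrite inE => _ /eqP ->.
move=> /and4P[/allP al /allP ar wl wr].
rewrite mem_cat => /orP[] /mapP[v hv ->]; case: j => // j; case: k => [|k] /= kj jw.
- by apply/al/(paths_labels hv)/map_f/mem_nth.
- exact: hl.
- by apply/ar/(paths_labels hv)/map_f/mem_nth.
- exact: hr.
Qed.

Section Kraft.
Variables (R : realFieldType) (pi : bool -> R).
Hypotheses (pi0 : forall e, 0 <= pi e) (pi1 : pi true + pi false <= 1).

(** The probability that a random descent follows [w], when it takes side [e] with probability
    [pi e] at the first [c] nodes and tosses a fair coin afterwards. *)
Fixpoint hybrid (c : nat) (w : seq (lab * bool)) : R :=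
  match w, c with
  | [::], _ => 1
  | x :: w', 0 => 2^-1 * hybrid 0 w'
  | x :: w', c'.+1 => pi x.2 * hybrid c' w'
  end.

Lemma hybrid_ge0 c w : 0 <= hybrid c w.
Proof.
elim: w c => [|x w ih] [|c] //=; rewrite mulr_ge0 ?invr_ge0 //.
Qed.

Lemma kraft c t : \sum_(w <- paths t) hybrid c w <= 1.
Proof.
elim: t c => [|b l hl r hr] c /=; first by rewrite big_seq1; case: c.
rewrite big_cat !big_map /=; case: c => [|c]; rewrite -!mulr_sumr.
  by have := hl 0%N; have := hr 0%N; lra.
apply: le_trans pi1; rewrite addrC; apply: lerD; exact: ler_piMr.
Qed.

End Kraft.

Section Balance.
Variable E : nat.

(** Bounding both shares by [1 - 1/E] also bounds both from below by [1/E]. *)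
Fixpoint balanced (t : tree) : bool :=
  if t is Node b l r then
    [&& (E * nleaves l <= E.-1 * (nleaves l + nleaves r))%N,
        (E * nleaves r <= E.-1 * (nleaves l + nleaves r))%N, balanced l & balanced r]
  else true.

Fixpoint prune (t : tree) : tree :=
  if t is Node b l r then
    let l' := prune l in let r' := prune r in
    if (E.-1 * (nleaves l' + nleaves r') < E * nleaves l')%N then l' else
    if (E.-1 * (nleaves l' + nleaves r') < E * nleaves r')%N then r' else Node b l' r'
  else Leaf.

Lemma prune_balanced t : balanced (prune t).
Proof.
elim: t => //= b l hl r hr; case: ltnP => // h1; case: ltnP => //= h2.
by rewrite h1 h2 hl hr.
Qed.

Lemma prune_labels t : {subset labels (prune t) <= labels t}.
Proof.
elim: t => //= b l hl r hr a; case: ltnP => h1.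
  by move=> /hl; rewrite inE mem_cat => ->; rewrite orbT.
case: ltnP => h2; first by move=> /hr; rewrite inE mem_cat => ->; rewrite !orbT.
rewrite /= !inE !mem_cat => /or3P[->//|/hl ->|/hr ->]; by rewrite ?orbT.
Qed.

Lemma prune_wf G t : wf G t -> wf G (prune t).
Proof.
elim: t => //= b l hl r hr /and4P[/allP al /allP ar wl wr].
case: ltnP => h1; first exact: hl.
case: ltnP => h2; first exact: hr.
rewrite /= hl // hr // !andbT; apply/andP; split; apply/allP => a.
  by move=> /prune_labels /al.
by move=> /prune_labels /ar.
Qed.

Fixpoint depth (t : tree) : nat :=
  if t is Node b l r then (maxn (depth l) (depth r)).+1 else 0%N.

Lemma depth_path t : exists2 w, w \in paths t & size w = depth t.
Proof.
elim: t => [|b l [wl hl sl] r [wr hr sr]] /=; first by exists [::].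
case: (leqP (depth l) (depth r)) => h.
  exists ((b, true) :: wr); rewrite /= ?sr //.
  by rewrite mem_cat (map_f (cons (b, true)) hr) orbT.
exists ((b, false) :: wl); rewrite /= ?sl //.
by rewrite mem_cat (map_f (cons (b, false)) hl).
Qed.

Lemma size_path_depth t w : w \in paths t -> (size w <= depth t)%N.
Proof.
elim: t w => [|b l hl r hr] w /=; first by rewrite inE => /eqP ->.
by rewrite mem_cat => /orP[] /mapP[v hv ->] /=; rewrite ltnS leq_max; [rewrite hl | rewrite hr ?orbT].
Qed.

(** A discarded side holds less than [1/E] of the leaves left at its node, so each level costs a
    factor of at least [1 - 1/E]. *)
Lemma prune_nleaves t N : (0 < E)%N -> (depth t <= N)%N ->
  (E.-1 ^ N * nleaves t <= E ^ N * nleaves (prune t))%N.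
Proof.
move=> E0; elim: t N => [|b l hl r hr] N.
  by move=> _; rewrite leq_mul //; elim: N => // N ih; rewrite !expnS leq_mul // leq_pred.
case: N => // N; rewrite [depth _]/= ltnS geq_max => /andP[dl dr].
have h : (E.-1 ^ N * nleaves (Node b l r) <= E ^ N * (nleaves (prune l) + nleaves (prune r)))%N.
  by rewrite nleaves_node !mulnDr leq_add ?hl ?hr.
have h' : (E.-1 * (nleaves (prune l) + nleaves (prune r)) <= E * nleaves (prune (Node b l r)))%N.
  rewrite /=; case: ltnP => [/ltnW //|h1]; case: ltnP => [/ltnW //|h2].
  by rewrite nleaves_node leq_mul // leq_pred.
rewrite !expnS; apply: (@leq_trans (E.-1 * (E ^ N * (nleaves (prune l) + nleaves (prune r))))).
  by rewrite -mulnA leq_mul2l h orbT.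
by rewrite mulnCA -mulnA (mulnCA E) leq_mul2l h' orbT.
Qed.

(** The word read so far determines the node reached, so the paths with a common prefix are those of
    one subtree. *)
Lemma subtree_paths c u t : size u = c -> balanced t ->
  [seq w <- paths t | take c w == u] = [::] \/
  exists2 t', balanced t' & [seq w <- paths t | take c w == u] = [seq u ++ w | w <- paths t'].
Proof.
elim: c u t => [|c ih] u t su bt.
  right; exists t => //; case: u su => // _.
  rewrite (eq_map (g := id)) ?map_id //; apply/all_filterP/allP => w _.
  by rewrite take0.
case: u su => // -[b' e] u [su]; case: t bt => [|b l r]; first by left.
move=> /= /and4P[_ _ bl br]; rewrite filter_cat !filter_map.
have fE x (P : seq (seq (lab * bool))) : [seq w <- P | preim (cons x) (fun w => take c.+1 w == (b', e) :: u) w]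
    = if x == (b', e) then [seq w <- P | take c w == u] else [::].
  case: (x =P _) => [->|h].
    by apply: eq_filter => w /=; rewrite eqseq_cons eqxx.
  rewrite (eq_filter (a2 := pred0)) ?filter_pred0 // => w /=.
  by rewrite eqseq_cons; case: eqP => // /h.
rewrite !fE {fE}; case: e; rewrite !xpair_eqE /= ?andbF ?andbT.
  case: eqP => [->|_]; last by left.
  case: (ih u r su br) => [-> /=|[t' bt' ->]]; first by left.
  right; exists t' => //=; by rewrite -map_comp.
case: eqP => [->|_]; last by left.
case: (ih u l su bl) => [-> /=|[t' bt' ->]]; first by left.
right; exists t' => //=; by rewrite cats0 -map_comp.
Qed.

Definition above (a : lab) (w : seq (lab * bool)) := take (index a (map fst w)) w.

(* If only one side of a node leads to [a], going there costs a factor [1 - 1/E] of the leaves. *)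
Lemma count_one_sided (a : lab) (A : pred (lab * bool)) (x0 : nat) t : balanced t ->
  (forall w, w \in paths t -> a \in map fst w -> all A (above a w)) ->
  (count (fun w => (a \in map fst w) &&
      (x0 <= count (fun y => ~~ A (y.1, ~~ y.2)) (above a w))%N) (paths t) * E ^ x0
   <= E.-1 ^ x0 * nleaves t)%N.
Proof.
elim: t x0 => [|b l hl r hr] x0 //= /and4P[b1 b2 bl br] hA.
rewrite count_cat !count_map nleaves_node.
pose cnt x (P : seq (seq (lab * bool))) := count (fun w => (a \in map fst w) &&
      (x <= count (fun y => ~~ A (y.1, ~~ y.2)) (above a w))%N) P.
have [ba|nba] := eqVneq b a.
  case: x0 => [|x0].
    rewrite !expn0 muln1 mul1n leq_add //; apply: count_size.
  rewrite (eq_count (a2 := pred0)) ?count_pred0; last first.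
    by move=> w /=; rewrite /above /= ba eqxx /= andbF.
  rewrite (eq_count (a2 := pred0)) ?count_pred0 //.
  by move=> w /=; rewrite /above /= ba eqxx /= andbF.
have cE e (P : seq (seq (lab * bool))) : count (preim (cons (b, e)) (fun w => (a \in map fst w) &&
      (x0 <= count (fun y => ~~ A (y.1, ~~ y.2)) (above a w))%N)) P
    = count (fun w => (a \in map fst w) &&
      (x0 <= ~~ A (b, ~~ e) + count (fun y => ~~ A (y.1, ~~ y.2)) (above a w))%N) P.
  apply: eq_count => w /=; rewrite /above /= inE [a == b]eq_sym (negPf nba) /=.
  by [].
have hAl w : w \in paths l -> a \in map fst w -> all A (above a w) && A (b, false).
  move=> wl aw; have := hA ((b, false) :: w); rewrite mem_cat (map_f (cons (b, false)) wl) /=.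
  by rewrite inE aw orbT /above /= (negPf nba) /= => /(_ isT isT) /andP[-> ->].
have hAr w : w \in paths r -> a \in map fst w -> all A (above a w) && A (b, true).
  move=> wl aw; have := hA ((b, true) :: w); rewrite mem_cat (map_f (cons (b, true)) wl) orbT /=.
  by rewrite inE aw orbT /above /= (negPf nba) /= => /(_ isT isT) /andP[-> ->].
have hl' x := hl x bl (fun w h1 h2 => proj1 (andP (hAl w h1 h2))).
have hr' x := hr x br (fun w h1 h2 => proj1 (andP (hAr w h1 h2))).
rewrite !cE /=.
have none (P : seq (seq (lab * bool))) (k : nat) : ~~ has (fun w => a \in map fst w) P ->
   count (fun w => (a \in map fst w) &&
      (x0 <= k + count (fun y => ~~ A (y.1, ~~ y.2)) (above a w))%N) P = 0%N.
  move=> /hasPn h; apply/eqP; rewrite -leqn0 leqNgt -has_count; apply/hasPn => w /h /negPf ->.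
  by [].
have one (e : bool) (t : tree) :
    (forall x, cnt x (paths t) * E ^ x <= E.-1 ^ x * nleaves t)%N ->
    (E * nleaves t <= E.-1 * (nleaves l + nleaves r))%N ->
    (nleaves t <= nleaves l + nleaves r)%N ->
    (count (fun w => (a \in map fst w) &&
      (x0 <= e + count (fun y => ~~ A (y.1, ~~ y.2)) (above a w))%N) (paths t) * E ^ x0
     <= E.-1 ^ x0 * (nleaves l + nleaves r))%N.
  move=> ht hb hs; case: x0 cE none => [|x] _ _.
    by rewrite !expn0 muln1 mul1n; apply: leq_trans (count_size _ _) hs.
  apply: (@leq_trans (cnt x (paths t) * E ^ x.+1)).
    rewrite leq_mul2r; apply/orP; right; apply: sub_count => w /= /andP[-> h] /=.
    by case: e h => /=; rewrite ?add1n ?add0n // => /ltnW.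
  rewrite !expnS mulnCA; apply: (@leq_trans (E * (E.-1 ^ x * nleaves t))).
    by rewrite leq_mul2l ht orbT.
  by rewrite mulnCA (mulnC E.-1) -mulnA leq_mul2l hb orbT.
case: (boolP (has (fun w => a \in map fst w) (paths l))) => [/hasP[wl wl1 wl2]|nl]; last first.
  by rewrite (none _ _ nl) add0n; apply: one; rewrite ?leq_addl.
case: (boolP (has (fun w => a \in map fst w) (paths r))) => [/hasP[wr wr1 wr2]|nr]; last first.
  by rewrite (none _ _ nr) addn0; apply: one; rewrite ?leq_addr.
(* Both sides lead to [a], so the root is not one-sided and the two bounds simply add up. *)
have /andP[_ ->] := hAl _ wl1 wl2; have /andP[_ ->] := hAr _ wr1 wr2.
by rewrite /= mulnDl mulnDr leq_add.
Qed.

End Balance.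
End Trees.

(** * Light, heavy and irregular labels below a common prefix *)

Section ClassSum.
Variables (R : Type) (idx : R) (op : Monoid.com_law idx) (I K : eqType).

Lemma big_classes (P : seq I) (f : I -> K) (F : I -> R) :
  \big[op/idx]_(i <- P) F i =
  \big[op/idx]_(u <- undup (map f P)) \big[op/idx]_(i <- P | f i == u) F i.
Proof.
under [RHS]eq_bigr => u _ do rewrite big_mkcond.
rewrite exchange_big /= big_seq [RHS]big_seq; apply: eq_bigr => i iP.
rewrite (bigD1_seq (f i)) ?undup_uniq ?mem_undup ?map_f //= eqxx.
by rewrite big1 ?Monoid.mulm1 // => u /negPf; rewrite eq_sym => ->.
Qed.

End ClassSum.

Lemma class_average (R : realFieldType) (I K : eqType) (P : seq I) (f : I -> K)
    (F : I -> R) (kap : R) : P != [::] ->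
  kap * (size P)%:R <= \sum_(i <- P) F i ->
  exists2 u, (0 < count (fun i => f i == u) P)%N &
    kap * (count (fun i => f i == u) P)%:R <= \sum_(i <- P | f i == u) F i.
Proof.
move=> P0 h.
have cu u : u \in undup (map f P) -> (0 < count (fun i => f i == u) P)%N.
  by rewrite mem_undup => /mapP[i iP ->]; rewrite -has_count; apply/hasP; exists i.
case: (boolP (has (fun u => kap * (count (fun i => f i == u) P)%:R <=
    \sum_(i <- P | f i == u) F i) (undup (map f P)))) => [/hasP[u /cu u1 u2]|/hasPn hn].
  by exists u.
suff : \sum_(i <- P) F i < kap * (size P)%:R by rewrite ltNge h.
rewrite (big_classes _ _ f) /= -sum1_size (big_classes _ _ f) /= natr_sum mulr_sumr.
have [i0 i0P] : exists i0, i0 \in P by case: (P) P0 => // x s _; exists x; rewrite mem_head.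
rewrite big_seq [ltRHS]big_seq; apply: ltr_sum.
  by apply/hasP; exists (f i0); rewrite mem_undup map_f.
by move=> u /hn; rewrite -ltNge sum1_count.
Qed.

Section WordCounts.
Variables (lab : finType) (t : tree lab) (E D : nat).
Hypotheses (bal : balanced E t) (dep : (depth t <= D)%N).
Hypothesis uniqw : forall w, w \in paths t -> uniq (map fst w).

Local Notation P := (paths t).
Local Notation low c w := (map fst (drop c w)).

Definition cnt c u := count (fun w => take c w == u) P.
Definition hit c u a := count (fun w => (take c w == u) && (a \in low c w)) P.
Definition light c T u a := (hit c u a * T < cnt c u)%N.
Definition nlight c T w := count (light c T (take c w)) (low c w).
(** Any path through [u] may be the witness, so the two sides of a label may be seen at different
    nodes carrying it. This suffices because membership in [G] depends on labels only. *)
Definition seen c u a y :=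
  has (fun w => [&& take c w == u, a \in low c w & y \in above a (drop c w)]) P.
Definition one_sided c u a w :=
  [seq y <- above a (drop c w) | ~~ seen c u a (y.1, ~~ y.2)].
Definition irregular c x0 u a w := (x0 <= size (one_sided c u a w))%N.

Lemma size_word w : w \in P -> (size w <= D)%N.
Proof. by move=> /size_path_depth h; apply: leq_trans h dep. Qed.

Lemma uniq_low c w : w \in P -> uniq (low c w).
Proof. by move=> /uniqw; apply: subseq_uniq; rewrite map_subseq // drop_subseq. Qed.

Lemma size_low c w : w \in P -> (size (low c w) <= D)%N.
Proof.
by move=> /size_word h; rewrite size_map size_drop; apply: leq_trans (leq_subr _ _) h.
Qed.

Lemma count_uniq (q : pred lab) (s : seq lab) : uniq s ->
  count q s = (\sum_a (a \in s) && q a)%N.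
Proof.
move=> us; rewrite -sum1_count big_mkcond (big_uniq _ us) big_mkcond /=.
by apply: eq_bigr => a _; case: (a \in s); case: (q a).
Qed.

Lemma sum_count_low c u (q : seq (lab * bool) -> pred lab) :
  (\sum_(w <- P | take c w == u) count (q w) (low c w) =
   \sum_a count (fun w => [&& take c w == u, a \in low c w & q w a]) P)%N.
Proof.
rewrite [RHS](eq_bigr (fun a => \sum_(w <- P) [&& take c w == u, a \in low c w & q w a])%N); last first.
  by move=> a _; rewrite -sum1_count big_mkcond; apply: eq_bigr => w _; case: (_ && _).
rewrite exchange_big /= big_mkcond big_seq [RHS]big_seq; apply: eq_bigr => w wP.
case: ifP => // _; rewrite ?(count_uniq _ (uniq_low c wP)) //.
by rewrite big1.
Qed.

Lemma sum_hit c u : (\sum_a hit c u a <= D * cnt c u)%N.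
Proof.
have := sum_count_low c u (fun _ => predT).
rewrite (eq_bigr (fun a => hit c u a)); last first.
  by move=> a _; apply: eq_count => w; rewrite andbT.
move=> <-; rewrite /cnt -sum1_count big_distrr /= big_seq_cond [leqRHS]big_seq_cond.
apply: leq_sum => w /andP[wP _]; rewrite muln1.
by apply: leq_trans (count_size _ _) (size_low c wP).
Qed.

(** A path meets at most [D] labels, so the frequencies of all labels add up to at most [D]. *)
Lemma card_heavy c u T : (0 < cnt c u)%N -> (#|[set a | ~~ light c T u a]| <= D * T)%N.
Proof.
move=> c0; rewrite -(leq_pmul2r c0); apply: (@leq_trans (T * \sum_a hit c u a)); last first.
  by rewrite (mulnC D) -mulnA leq_mul2l sum_hit orbT.
rewrite -sum1_card big_distrl big_distrr /= big_mkcond /=; apply: leq_sum => a _.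
by rewrite inE /light -leqNgt; case: ifP => // h; rewrite mul1n mulnC.
Qed.

(** There are at most [D * T] heavy labels, and by [count_one_sided] each is irregular on at most a
    fraction [(1 - 1/E)^x0] of the paths. *)
Lemma sum_irregular_class c u T x0 : (0 < E)%N ->
  ((\sum_(w <- P | take c w == u)
     count (fun a => ~~ light c T u a && irregular c x0 u a w) (low c w)) * E ^ x0
   <= D * T * E.-1 ^ x0 * cnt c u)%N.
Proof.
move=> E0; case: (posnP (cnt c u)) => c0.
  rewrite c0 muln0 leqn0 muln_eq0 big_seq_cond big1 // => w /andP[wP tw].
  by move: c0; rewrite /cnt => /eqP; rewrite -leqn0 leqNgt -has_count => /hasPn /(_ _ wP); rewrite tw.
have key a : (count (fun w => [&& take c w == u, a \in low c w & irregular c x0 u a w]) P * E ^ x0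
    <= E.-1 ^ x0 * cnt c u)%N.
  have [su|su] := eqVneq (size u) c; last first.
    rewrite (eq_count (a2 := pred0)) ?count_pred0 // => w /=.
    apply/negP => /and3P[/eqP tw aw _]; move: su; rewrite -tw size_take.
    case: ltnP => [_|h]; first by rewrite eqxx.
    by rewrite drop_oversize in aw.
  pose q := fun w => (a \in map fst w) && (x0 <= count (fun y => ~~ seen c u a (y.1, ~~ y.2)) (above a w))%N.
  have -> : count (fun w => [&& take c w == u, a \in low c w & irregular c x0 u a w]) P
     = count (fun w => q (drop c w)) [seq w <- P | take c w == u].
    rewrite count_filter; apply: eq_count => w /=.
    by rewrite andbC /q /irregular /one_sided size_filter.
  have -> : cnt c u = size [seq w <- P | take c w == u] by rewrite size_filter.
  case: (subtree_paths su bal) => [->|[t' bt' fE]]; first by [].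
  rewrite fE count_map size_map (eq_count (a2 := q)); last first.
    by move=> w /=; rewrite drop_size_cat.
  apply: count_one_sided => // w wt aw; apply/allP => y yw; apply/hasP; exists (u ++ w).
    have : u ++ w \in [seq w <- P | take c w == u] by rewrite fE map_f.
    by rewrite mem_filter => /andP[].
  by rewrite take_size_cat // eqxx drop_size_cat // aw yw.
rewrite (sum_count_low c u (fun w a => ~~ light c T u a && irregular c x0 u a w)).
apply: (@leq_trans (\sum_(a in [set a | ~~ light c T u a]) E.-1 ^ x0 * cnt c u)); last first.
  by rewrite sum_nat_const -mulnA leq_mul2r card_heavy // orbT.
rewrite big_distrl big_mkcond /= [leqRHS]big_mkcond /=; apply: leq_sum => a _; rewrite inE.
case: ifP => hl; last first.
  by rewrite (eq_count (a2 := pred0)) ?count_pred0 // => w /=; rewrite !andbF.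
apply: leq_trans (key a); rewrite leq_mul2r; apply/orP; right; by apply: sub_count => w /=.
Qed.

Lemma sum_irregular c T x0 : (0 < E)%N ->
  ((\sum_(w <- P) count (fun a => ~~ light c T (take c w) a && irregular c x0 (take c w) a w) (low c w))
   * E ^ x0 <= D * T * E.-1 ^ x0 * nleaves t)%N.
Proof.
move=> E0; rewrite (big_classes _ _ (take c)) /=.
have -> : nleaves t = (\sum_(u <- undup (map (take c) P)) cnt c u)%N.
  rewrite /nleaves -sum1_size (big_classes _ _ (take c)) /=.
  by apply: eq_bigr => u _; rewrite sum1_count.
rewrite [leqRHS]big_distrr [X in (X <= _)%N]big_distrl /=; apply: leq_sum => u _.
apply: leq_trans (sum_irregular_class c u T x0 E0); rewrite leq_mul2r; apply/orP; right.
by apply: eq_leq; apply: eq_bigr => w /eqP ->.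
Qed.

(** Each light member of [B] lies on fewer than one path in [T]. *)
Lemma sum_collisions c u T (B : seq lab) :
  ((\sum_(w <- P | take c w == u) count (fun a => light c T u a && (a \in B)) (low c w)) * T
   <= size B * cnt c u)%N.
Proof.
rewrite (sum_count_low c u (fun w a => light c T u a && (a \in B))) big_distrl /=.
apply: (@leq_trans (\sum_(a in B) cnt c u)); last first.
  by rewrite sum_nat_const leq_mul2r card_size orbT.
rewrite [leqRHS]big_mkcond /=; apply: leq_sum => a _.
case: ifP => aB; last first.
  by rewrite (eq_count (a2 := pred0)) ?count_pred0 // => w /=; rewrite ?andbF.
case: (boolP (light c T u a)) => hl; last first.
  by rewrite (eq_count (a2 := pred0)) ?count_pred0 // => w /=; rewrite ?andbF.
apply: leq_trans (ltnW hl); rewrite leq_mul2r; apply/orP; right; by apply: sub_count => w /= /and3P[-> ->].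
Qed.

End WordCounts.

(** * The surplus earned by a single path *)

Section WordGain.
Variables (lab : finType) (d : lab * bool) (t : tree lab) (D x0 : nat).
Variable G : {set lab * bool * lab}.
Hypotheses (wfG : wf (mem G) t) (dep : (depth t <= D)%N).
Hypothesis irrG : forall b e, (b, e, b) \notin G.

Local Notation P := (paths t).
Local Notation low c w := (map fst (drop c w)).

Lemma path_edge w k j : w \in P -> (k < j)%N -> (j < size w)%N ->
  (nth d w k, (nth d w j).1) \in G.
Proof. exact: wf_path. Qed.

Lemma uniq_path_labels w : w \in P -> uniq (map fst w).
Proof.
move=> wP; apply/(uniqP d.1) => i j; rewrite !inE size_map => iw jw.
rewrite !(nth_map d) // => e; case: (ltngtP i j) => // h.
  have := path_edge wP h jw; rewrite -e (surjective_pairing (nth d w i)).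
  by move=> h'; have := irrG (nth d w i).1 (nth d w i).2; rewrite h'.
have := path_edge wP h iw; rewrite e (surjective_pairing (nth d w j)).
by move=> h'; have := irrG (nth d w j).1 (nth d w j).2; rewrite h'.
Qed.

Lemma count_low c w (q : pred lab) : (size w <= D)%N ->
  count q (low c w) = #|[set j : 'I_D | (c <= j < size w)%N && q (nth d w j).1]|.
Proof.
move=> wD.
have -> : low c w = [seq (nth d w j).1 | j <- iota c (size w - c)].
  rewrite -{1}(mkseq_nth d w) /mkseq -map_drop drop_iota add0n -map_comp.
  by [].
rewrite count_map -sum1_card (eq_bigl (fun j : 'I_D => ((c <= j < size w)%N && q (nth d w j).1))); last first.
  by move=> j; rewrite inE.
rewrite -sum1_count.
have -> : iota c (size w - c) = index_iota c (size w) by [].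
rewrite (big_nat_widenl _ 0) //= (big_nat_widen _ _ D) // big_mkord; apply: eq_bigl => j.
by rewrite andbC andbA [in RHS]andbC andbCA [RHS]andbC -!andbA; do !bool_congr.
Qed.

Variables (w : seq (lab * bool)) (c wd : nat) (LJ HZ : pred lab) (B : seq lab).
Variables (Dq Kz : nat) (zl : {ffun 'I_Kz -> lab}).
Hypotheses (wP : w \in P) (cw : (c <= size w)%N) (cq : (c <= Dq)%N).
Hypothesis LJHZ : forall a, LJ a -> ~~ HZ a.
Hypothesis HZz : forall a, a \in low c w -> HZ a -> exists z, zl z = a.

Local Notation lb j := (nth d w j).1.
Local Notation u := (take c w).
Local Notation c' := (c + wd)%N.
Local Notation u' := (take (c + wd) w).

(** Heavy positions have to be regular below the first cut. Late light ones have to be regular only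
    below the second cut, where most of them have become heavy. Light positions between the cuts
    occur in inner edges as upper ends only. *)
Let J1 j := [&& (c <= j < size w)%N, (j < c')%N, LJ (lb j) & lb j \notin B].
Let J2 j := [&& (c <= j < size w)%N, (c' <= j)%N, LJ (lb j), lb j \notin B &
  ~~ irregular t c' x0 u' (lb j) w].
Let Z j := [&& (c <= j < size w)%N, (c' <= j)%N, HZ (lb j) & ~~ irregular t c x0 u (lb j) w].
Let excl q j := [seq k <- iota q (j - q) |
  ~~ seen t q (take q w) (lb j) (lb k, ~~ (nth d w k).2)].
Let exc j := if Z j then excl c j else if J2 j then excl c' j else [::].

Let sw : (size w <= D)%N.
Proof. exact: size_word wP. Qed.
Let uw : uniq (map fst w).
Proof. exact: uniq_path_labels. Qed.

Lemma above_drop q j : (q <= j < size w)%N -> above (lb j) (drop q w) = drop q (take j w).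
Proof.
move=> /andP[qj jw]; rewrite /above.
have jq : (j - q < size (drop q w))%N by rewrite size_drop ltn_sub2r // (leq_ltn_trans qj).
rewrite (_ : index _ _ = (j - q)%N); first by rewrite take_drop subnK.
rewrite -{1}(subnKC qj) -nth_drop -(nth_map d d.1) // index_uniq ?size_map //.
by apply: subseq_uniq uw; rewrite map_subseq // drop_subseq.
Qed.

Lemma size_excl q j : (q <= j < size w)%N ->
  size (excl q j) = size (one_sided t q (take q w) (lb j) w).
Proof.
move=> qj; rewrite /one_sided above_drop // !size_filter.
case/andP: qj => qj jw.
have -> : drop q (take j w) = [seq nth d w k | k <- iota q (j - q)].
  rewrite -{1}(mkseq_nth d w) /mkseq -map_take take_iota (minn_idPl (ltnW jw)).
  by rewrite -map_drop drop_iota add0n.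
by rewrite count_map; apply: eq_count.
Qed.

Lemma seen_edge q a y : seen t q (take q w) a y -> (y, a) \in G.
Proof.
case/hasP => v vP /and3P[_ av yv].
have ia : (index a (low q v) < size (drop q v))%N by rewrite -(size_map fst) index_mem.
move: yv => /(nthP d)[i]; rewrite size_take ia => ii; rewrite nth_take // nth_drop => <-.
have ja : (nth d v (q + index a (low q v))).1 = a.
  by rewrite -nth_drop -(nth_map d d.1) // nth_index.
rewrite -[X in (_, X)]ja; apply: path_edge => //; first by rewrite ltn_add2l.
by move: ia; rewrite size_drop ltn_subRL.
Qed.

Lemma both_edges q k j e : (q <= k)%N -> (k < j)%N -> (j < size w)%N -> k \notin excl q j ->
  (lb k, e, lb j) \in G.
Proof.
move=> qk kj jw; rewrite mem_filter mem_iota qk subnKC ?(leq_trans qk (ltnW kj)) // kj !andbT negbK.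
move=> /seen_edge h; have := path_edge wP kj jw; rewrite (surjective_pairing (nth d w k)).
by case: e; case: (nth d w k).2 h.
Qed.

Let J1P j : J1 j -> (c <= j < size w)%N /\ ~~ J2 j && ~~ Z j.
Proof.
case/and4P=> h1 h2 h3 h4; split=> //; rewrite /J2 /Z.
by rewrite [(c' <= j)%N]leqNgt h2 /= !andbF.
Qed.

Let J2P j : J2 j -> (c <= j < size w)%N /\ ~~ Z j.
Proof.
case/and5P=> h1 h2 h3 h4 h5; split=> //; rewrite /Z.
by rewrite (negPf (LJHZ h3)) !andbF.
Qed.

Let ZP j : Z j -> (c <= j < size w)%N /\ exists z, zl z = lb j.
Proof.
case/and4P=> h1 h2 h3 h4; split=> //; apply: HZz => //.
case/andP: h1 => cj jw; rewrite -(subnKC cj) -nth_drop; apply/map_f/mem_nth.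
by rewrite size_drop ltn_sub2r // (leq_ltn_trans cj).
Qed.

Let J1Z k j : J1 k -> Z j -> (k < j)%N.
Proof. by move=> /and4P[_ h _ _] /and4P[_ h' _ _]; apply: leq_trans h'. Qed.

Let excP j : (size (exc j) <= x0)%N.
Proof.
rewrite /exc; case: ifP => [/and4P[h1 h2 h3 h4]|_].
  by rewrite size_excl // ltnW // ltnNge.
case: ifP => // /and5P[h1 h2 h3 h4 h5]; rewrite size_excl; first by rewrite ltnW // ltnNge.
by rewrite h2; case/andP: h1.
Qed.

Let bothG k j e : (k < j)%N -> linkn J1 J2 Z k j -> k \notin exc j -> (lb k, e, lb j) \in G.
Proof.
have J2ge i : J2 i -> (c' <= i)%N by case/and5P.
have Zge i : Z i -> (c' <= i)%N by case/and4P.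
have J2lt i : J2 i -> (i < size w)%N by case/J2P => /andP[].
have Zlt i : Z i -> (i < size w)%N by case/ZP => /andP[].
move=> kj; rewrite /exc; case/or3P => /andP[h1 h2].
- have [_ /negPf ->] := J2P h2; rewrite h2; apply: both_edges => //; [exact: J2ge|exact: J2lt].
- rewrite h2; apply: both_edges => //; last exact: Zlt.
  by case/orP: h1 => [/J1P[/andP[]]|/J2P[/andP[]]].
- have [_ /negPf ->] := J2P h2; rewrite h2; apply: both_edges => //; [exact: Zge|exact: J2lt].
Qed.

(** Positions lost because the label has intermediate frequency, is heavy and irregular below the
    first cut, is irregular below the second cut, or was used by an earlier path ([B]). *)
Definition trash : nat :=
  (count (fun a => ~~ LJ a && ~~ HZ a) (low c w) +
   count (fun a => HZ a && irregular t c x0 u a w) (low c w) +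
   count (fun a => irregular t c' x0 u' a w) (low c' w) +
   count (fun a => LJ a && (a \in B)) (low c w))%N.

Let g := word_group d D x0 w J1 J2 Z zl exc.
Let x := word_context d Dq c w zl.

Lemma word_gain_light : (count LJ (low c w) <= light_size g + trash)%N.
Proof.
rewrite word_light_size /trash !(count_low _ _ sw).
set S0 := [set j | _]; set SJ := [set j | _]; set S1 := [set j | _]; set S2 := [set j | _].
set S3 := [set j | _]; set S4 := [set j | _].
have : S0 \subset SJ :|: (S3 :|: S4).
  apply/subsetP => j; rewrite !inE => /andP[h1 h2].
  rewrite /J1 /J2 h1 h2 /=; case: (ltnP j c') => [jc|jc] /=.
    by rewrite ?andbF ?orbF /=; case: (_ \in B); rewrite /= ?orbT.
  by case/andP: h1 => _ ->; case: (_ \in B); rewrite /= ?orbT //; case: (irregular _ _ _ _ _ _).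
move=> /subset_leq_card h; apply: leq_trans h _.
apply: leq_trans (leq_card_setU _ _) _; rewrite leq_add2l.
apply: leq_trans (leq_card_setU _ _) _; lia.
Qed.

Lemma word_gain_late : (size w - c <= wd + trash + (#|[set j : 'I_D | J2 j]| + #|[set j : 'I_D | Z j]|))%N.
Proof.
have -> : (size w - c)%N = count predT (low c w) by rewrite count_predT size_map size_drop.
rewrite /trash !(count_low _ _ sw).
set S0 := [set j | _]; set S1 := [set j | _]; set S2 := [set j | _].
set S3 := [set j | _]; set S4 := [set j | _]; set SJ := [set j | _]; set SZ := [set j | _].
pose W := [set j : 'I_D | (c <= j < c')%N].
have cW : (#|W| <= wd)%N.
  have -> : #|W| = count (fun k => (c <= k < c')%N) (iota 0 D).
    rewrite -sum1_card -sum1_count (eq_bigl (fun j : 'I_D => (c <= j < c')%N)); last by move=> j; rewrite inE.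
    by rewrite -(big_mkord (fun k => (c <= k < c')%N) (fun=> 1%N)) /index_iota subn0.
  rewrite -size_filter -{2}(size_iota c wd); apply: uniq_leq_size.
    by rewrite filter_uniq ?iota_uniq.
  by move=> k; rewrite mem_filter => /andP[h _]; rewrite mem_iota.
have : S0 \subset W :|: (SJ :|: SZ) :|: (S1 :|: S2 :|: (S3 :|: S4)).
  apply/subsetP => j; rewrite !inE andbT => h1; rewrite h1 /=.
  have -> : (c <= j)%N by case/andP: h1.
  have -> : (j < size w)%N by case/andP: h1.
  rewrite /J2 /Z h1 /=; case: (ltnP j c') => //= _.
  have := LJHZ (a := lb j).
  case: (LJ _) => [/(_ isT) /negPf -> /=|_ /=].
    by rewrite ?orbF; case: (_ \in B); rewrite /= ?orbT //; case: (irregular _ _ _ _ _ _).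
  by case: (HZ _) => //=; case: (irregular _ _ _ _ _ _); rewrite /= ?orbT.
move=> /subset_leq_card h; apply: leq_trans h _.
apply: leq_trans (leq_card_setU _ _) _.
apply: leq_trans (leq_add (leq_card_setU _ _) (leq_card_setU _ _)) _.
have := (leq_card_setU SJ SZ).1; have := (leq_card_setU S1 S2).1; have := (leq_card_setU S3 S4).1.
lia.
Qed.

Lemma word_gain_sub : group_edges x g \subset G.
Proof.
by apply: word_group_sub => // k j; apply: path_edge.
Qed.

Lemma word_gain_ends e : e \in group_edges x g ->
  (exists2 j, (c <= j < size w)%N && LJ (lb j) && (lb j \notin B) & lb j \in [:: e.1.1; e.2]) /\
  (forall b, b \in [:: e.1.1; e.2] ->
     (exists2 j, (c <= j < size w)%N && LJ (lb j) && (lb j \notin B) & b = lb j) \/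
     HZ b \/ (exists2 i, (i < c)%N & b = lb i)).
Proof.
have JJ j : J1 j || J2 j -> (c <= j < size w)%N && LJ (lb j) && (lb j \notin B).
  by case/orP => [/and4P[-> _ -> ->]|/and5P[-> _ -> -> _]].
move=> eF; have [] := @word_group_ends _ d Dq Kz D x0 c w J1 J2 Z zl exc J1P J2P ZP e eF.
move=> [j /JJ h1 h2] h3; split; first by exists j.
move=> b /h3[[i /JJ]|[[i /and4P[_ _ hz _] ->]|]]; [by left; exists i | by right; left | by right; right].
Qed.

Variables (R : realFieldType) (l : bool -> R).
Hypotheses (l0 : forall e, 0 <= l e) (l2 : 2 <= l true + l false).

(** A light label costs [ell] bits to name, and the hypothesis leaves it a net gain of [h]. A lost
    position forfeits at most its own [h] and a [psi] for each of the at most [D] light positions;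
    the exceptions cost the last term. *)
Lemma word_gain (psi h ell : R) : 0 <= psi -> 0 <= h ->
  h + ell + psi * (2 * wd + 1)%:R <=
    psi * (\sum_(0 <= i < c) l (nth d w i).2 + (size w - c)%:R) ->
  h * (count LJ (low c w))%:R - (h + psi * D%:R) * trash%:R - 2 * psi * (x0 * D)%:R
  <= psi * (\sum_(e in group_edges x g) l e.1.2) - (light_size g)%:R * ell.
Proof.
move=> psi0 h0 hyp.
have cost := @group_cost _ d Dq Kz D x0 c w J1 J2 Z zl exc uw cw cq J1P J2P ZP J1Z R l l0 wd l2.
have c1 : (#|[set j : 'I_D | J1 j]| <= wd)%N.
  rewrite -{1}(size_iota c wd) cardE -(size_map val); apply: uniq_leq_size.
    by rewrite map_inj_uniq ?enum_uniq //; apply: val_inj.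
  by move=> k /mapP[j]; rewrite mem_enum inE => /and4P[/andP[h1 _] h2 _ _] ->; rewrite mem_iota h1.
have := cost c1; rewrite -/x -/g /=; set C := \sum_(e in _) _.
have := word_gain_light; have := word_gain_late; move: trash => tr.
have -> : light_size g = (#|[set j : 'I_D | J1 j]| + #|[set j : 'I_D | J2 j]|)%N.
  rewrite word_light_size -cardsUI (_ : _ :&: _ = set0) ?cards0 ?addn0.
    by apply: eq_card => j; rewrite !inE.
  apply/setP => j; rewrite !inE; apply/negP => /andP[/J1P[_ /andP[hh _]]].
  exact/negP.
have cD : (#|[set j : 'I_D | J1 j]| + #|[set j : 'I_D | J2 j]| <= D)%N.
  rewrite -cardsUI (_ : _ :&: _ = set0) ?cards0 ?addn0.
    by apply: leq_trans (max_card _) _; rewrite card_ord.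
  apply/setP => j; rewrite !inE; apply/negP => /andP[/J1P[_ /andP[hh _]]].
  exact/negP.
move: cD; set j1 := #|_|; set j2 := #|_|; set z := #|_| => cD late light.
rewrite -(ler_nat R) !natrD in late; rewrite -(ler_nat R) !natrD in light.
rewrite -(ler_nat R) !natrD in cD.
have e1 : (2 * wd + 1)%:R = 2 * wd%:R + 1 :> R by rewrite natrD natrM.
rewrite e1 {e1} in hyp; rewrite !natrD !natrM; set S := \sum_(_ <= _ < _) _ in hyp *.
move: hyp late light cD.
set rT := tr%:R; set rJ1 := j1%:R; set rJ2 := j2%:R; set rz := z%:R.
set rs := (size w - c)%:R; set rA := (count _ _)%:R; set rW := wd%:R; set rD := D%:R; set rx := x0%:R.
move=> hyp late light cD cst.
have T0 : 0 <= rT by []. have J0 : 0 <= rJ1 + rJ2 by rewrite addr_ge0.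
have k1 : (rJ1 + rJ2) * (S + rs - (2 * rW + 1) - rT) - 2 * (rx * rD) <= C.
  apply: le_trans cst.
  have : (rJ1 + rJ2) * rs <= (rJ1 + rJ2) * (rW + rT + (rJ2 + rz)) by rewrite ler_wpM2l.
  lra.
have k2 : psi * ((rJ1 + rJ2) * (S + rs - (2 * rW + 1) - rT) - 2 * (rx * rD)) <= psi * C.
  by rewrite ler_wpM2l.
have k3 : (rJ1 + rJ2) * (h + ell + psi * (2 * rW + 1)) <= (rJ1 + rJ2) * (psi * (S + rs)).
  by rewrite ler_wpM2l.
have k4 : psi * rT * (rJ1 + rJ2) <= psi * rT * rD by rewrite ler_wpM2l // mulr_ge0.
have k5 : h * rA <= h * (rJ1 + rJ2 + rT) by rewrite ler_wpM2l.
lra.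
Qed.

Lemma word_gain_ex (psi h ell : R) : 0 <= psi -> 0 <= h ->
  h + ell + psi * (2 * wd + 1)%:R <=
    psi * (\sum_(0 <= i < c) l (nth d w i).2 + (size w - c)%:R) ->
  exists g : group lab Kz D x0, [/\ group_edges (word_context d Dq c w zl) g \subset G,
    h * (count LJ (low c w))%:R - (h + psi * D%:R) * trash%:R - 2 * psi * (x0 * D)%:R
    <= psi * (\sum_(e in group_edges (word_context d Dq c w zl) g) l e.1.2) - (light_size g)%:R * ell &
    forall e, e \in group_edges (word_context d Dq c w zl) g ->
  (exists2 a, [&& a \in low c w, LJ a & a \notin B] & a \in [:: e.1.1; e.2]) /\
  (forall b, b \in [:: e.1.1; e.2] -> [|| b \in low c w, HZ b | b \in map fst (take c w)])].
Proof.
move=> psi0 h0 hyp; exists g; split; [exact: word_gain_sub | exact: word_gain |].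
have lbl j : (c <= j < size w)%N -> lb j \in low c w.
  case/andP=> cj jw; rewrite -(subnKC cj) -nth_drop; apply/map_f/mem_nth.
  by rewrite size_drop ltn_sub2r // (leq_ltn_trans cj).
move=> e /word_gain_ends[[j /andP[/andP[h1 h2] h3] h4] h5]; split.
  by exists (lb j); rewrite ?h2 ?h3 ?lbl.
move=> b /h5[[i /andP[/andP[i1 _] _] ->]|[->|[i ic ->]]]; first by rewrite lbl.
  by rewrite orbT.
apply/orP; right; apply/orP; right; rewrite -(nth_take d ic); apply/map_f/mem_nth.
by rewrite size_takel.
Qed.

End WordGain.

(** * Choosing a node and many paths below it with disjoint groups *)

Section Select.
Variables (lab : finType) (d : lab * bool) (t : tree lab) (D x0 : nat).
Variable G : {set lab * bool * lab}.
Hypotheses (wfG : wf (mem G) t) (dep : (depth t <= D)%N).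
Hypothesis irrG : forall b e, (b, e, b) \notin G.

Local Notation P := (paths t).
Local Notation low c w := (map fst (drop c w)).

Variables (R : realFieldType) (l : bool -> R).
Hypotheses (l0 : forall e, 0 <= l e) (l2 : 2 <= l true + l false).
Variables (N2 : R) (lam : nat).

(** [N2] will be the binary logarithm of the number of leaves. By Kraft's inequality all but a
    fraction [2^-lam] of the paths are typical or shorter than [c]. *)
Definition typical c (w : seq (lab * bool)) : bool :=
  N2 - lam%:R <= \sum_(0 <= i < c) l (nth d w i).2 + (size w - c)%:R.

Variables (psi h ell : R) (c wd : nat).
Hypotheses (psi0 : 0 <= psi) (h0 : 0 <= h).
Hypothesis hN : h + ell + psi * (2 * wd + 1)%:R <= psi * (N2 - lam%:R).

Variables (LJ HZ : seq (lab * bool) -> pred lab).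
Hypothesis LJHZ : forall u a, LJ u a -> ~~ HZ u a.

Local Notation H := (h + psi * D%:R).

Definition trash0 w : nat := trash t x0 w c wd (LJ (take c w)) (HZ (take c w)) [::].
(** An atypical path is charged as if [D] positions were lost, so its gain is never positive and
    selecting a path of positive gain yields a typical one. *)
Definition gain w : R :=
  h * (count (LJ (take c w)) (low c w))%:R
  - H * (trash0 w + D * ((c <= size w)%N && ~~ typical c w))%:R - 2 * psi * (x0 * D)%:R.

Lemma trash_split w (B : seq lab) : trash t x0 w c wd (LJ (take c w)) (HZ (take c w)) B =
  (trash0 w + count (fun a => LJ (take c w) a && (a \in B)) (low c w))%N.
Proof.
rewrite /trash0 /trash; congr (_ + _)%N.
by rewrite (@eq_count _ (fun a => _ && (a \in [::])) pred0) ?count_pred0 ?addn0 // => a /=; rewrite andbF.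
Qed.

(** Averaging over prefixes fixes [u] with mean gain at least [2 * Gam] before [B] is known, so that
    all later paths share it. Collisions with [B] cost at most [Gam] on average, and some path with
    this prefix keeps [Gam]. *)
Lemma select (Gam beta : R) (NB : nat) : 0 < Gam -> H * beta <= Gam ->
  2 * Gam * (nleaves t)%:R <= \sum_(w <- P) gain w ->
  (forall u B, (size B <= NB)%N ->
    (\sum_(w <- P | take c w == u) count (fun a => LJ u a && (a \in B)) (low c w))%:R
      <= beta * (cnt t c u)%:R) ->
  exists2 u, (0 < cnt t c u)%N & forall B, (size B <= NB)%N ->
    exists2 w, [&& w \in P, take c w == u, (c <= size w)%N & typical c w] &
      Gam <= h * (count (LJ u) (low c w))%:R
             - H * (trash t x0 w c wd (LJ u) (HZ u) B)%:R - 2 * psi * (x0 * D)%:R.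
Proof.
move=> G0 hb hsum hB.
have H0 : 0 <= H by rewrite addr_ge0 // mulr_ge0.
have P0 : P != [::] by have := nleaves_gt0 t; rewrite /nleaves; case: (paths t).
have [u u0 hu] := @class_average _ _ _ _ (take c) _ _ P0 hsum.
exists u => // B sB.
pose g2 w := gain w - H * (count (fun a => LJ u a && (a \in B)) (low c w))%:R.
have h2 : Gam * (cnt t c u)%:R <= \sum_(w <- P | take c w == u) g2 w.
  rewrite /g2 sumrB -mulr_sumr -natr_sum; apply: (@le_trans _ _ (2 * Gam * (cnt t c u)%:R - H * (beta * (cnt t c u)%:R))).
    rewrite mulrA -mulrBl ler_wpM2r //; lra.
  by apply: lerB => //; rewrite ler_wpM2l // hB.
have [w wP /andP[/eqP tw hw]] : exists2 w, w \in P & (take c w == u) && (Gam <= g2 w).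
  apply/hasP; apply: contraLR h2 => /hasPn hn; rewrite -ltNge.
  have -> : Gam * (cnt t c u)%:R = \sum_(w <- P | take c w == u) Gam.
    by rewrite /cnt -sum1_count natr_sum mulr_sumr; under eq_bigr do rewrite mulr1.
  rewrite big_seq_cond [ltRHS]big_seq_cond; apply: ltr_sum.
    move: u0; rewrite -has_count => /hasP[w wP tw]; apply/hasP; exists w => //; by rewrite wP.
  by move=> w /andP[/hn]; rewrite negb_and => /orP[/negPf -> //|]; rewrite -ltNge.
have wc : (c <= size w)%N.
  rewrite leqNgt; apply/negP => wc.
  have dw : drop c w = [::] by rewrite drop_oversize // ltnW.
  have := lt_le_trans G0 hw; rewrite /g2 /gain dw /= mulr0 [(c <= size w)%N]leqNgt wc /= muln0 addn0.
  have : 0 <= H * (trash0 w)%:R by rewrite mulr_ge0.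
  have : 0 <= 2 * psi * (x0 * D)%:R by rewrite !mulr_ge0.
  lra.
have ty : typical c w.
  apply: contraT => nty.
  have := lt_le_trans G0 hw; rewrite /g2 /gain wc nty /= muln1 natrD mulrDr.
  have : 0 <= H * (trash0 w)%:R by rewrite mulr_ge0.
  have : 0 <= 2 * psi * (x0 * D)%:R by rewrite !mulr_ge0.
  have : 0 <= H * (count (fun a => LJ u a && (a \in B)) (low c w))%:R by rewrite mulr_ge0.
  have : h * (count (LJ (take c w)) (low c w))%:R <= H * D%:R.
    apply: (@le_trans _ _ (h * D%:R)); last by rewrite ler_wpM2r // lerDl mulr_ge0.
    rewrite ler_wpM2l // ler_nat; apply: leq_trans (count_size _ _) _.
    by rewrite size_map size_drop; apply: leq_trans (leq_subr _ _) (size_word dep wP).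
  lra.
exists w; first by rewrite wP tw eqxx wc ty.
apply: le_trans hw _; rewrite /g2 /gain wc ty /= muln0 addn0 tw.
by have := trash_split w B; rewrite tw => ->; rewrite natrD; lra.
Qed.

Variables (Dq Kz N : nat).
Hypothesis cq : (c <= Dq)%N.

(** Greedy choice, with [B] collecting the labels below the cut on the paths already taken. Every
    edge of the next group has a light end outside [B] and off the prefix, whereas the ends of
    earlier edges are in [B], heavy or on the prefix. *)
Lemma groups_of_select (u : seq (lab * bool)) (zl : {ffun 'I_Kz -> lab}) (Gam : R) :
  (forall a, HZ u a -> exists z, zl z = a) ->
  (forall B, (size B <= N.-1 * D)%N ->
    exists2 w, [&& w \in P, take c w == u, (c <= size w)%N & typical c w] &
      Gam <= h * (count (LJ u) (low c w))%:R
             - H * (trash t x0 w c wd (LJ u) (HZ u) B)%:R - 2 * psi * (x0 * D)%:R) ->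
  exists g : {ffun 'I_N -> group lab Kz D x0},
    let x := word_context d Dq c u zl in
    [/\ forall r, group_edges x (g r) \subset G,
        forall r, Gam <= psi * (\sum_(e in group_edges x (g r)) l e.1.2) - (light_size (g r))%:R * ell &
        forall r1 r2, r1 != r2 -> [disjoint group_edges x (g r1) & group_edges x (g r2)]].
Proof.
move=> hz hB; pose x := word_context d Dq c u zl.
have step (B : seq lab) : (size B <= N.-1 * D)%N -> exists (w : seq (lab * bool)) (g : group lab Kz D x0),
    [/\ group_edges x g \subset G,
      Gam <= psi * (\sum_(e in group_edges x g) l e.1.2) - (light_size g)%:R * ell,
      (size (low c w) <= D)%N &
      forall e, e \in group_edges x g ->
       (exists2 a, [&& a \in low c w, LJ u a, a \notin B & a \notin map fst u] & a \in [:: e.1.1; e.2]) /\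
       (forall b, b \in [:: e.1.1; e.2] -> [|| b \in low c w, HZ u b | b \in map fst u])].
  move=> sB; have [w /and4P[wP /eqP tw wc ty] hw] := hB B sB.
  have xE : word_context d Dq c w zl = x.
    congr (_, _); apply/ffunP => i; rewrite !ffunE; case: ifP => // ic.
    by rewrite -tw nth_take.
  have hyp : h + ell + psi * (2 * wd + 1)%:R <=
      psi * (\sum_(0 <= i < c) l (nth d w i).2 + (size w - c)%:R).
    by apply: le_trans hN _; rewrite ler_wpM2l.
  have hz' a : a \in low c w -> HZ u a -> exists z, zl z = a by move=> _; apply: hz.
  have [g [g1 g2 g3]] := word_gain_ex x0 wfG dep irrG B wP wc cq (LJHZ (u := u)) hz' l0 l2 psi0 h0 hyp.
  rewrite xE in g1 g2 g3; exists w, g; split=> //.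
  - exact: le_trans hw g2.
  - by rewrite size_map size_drop; apply: leq_trans (leq_subr _ _) (size_word dep wP).
  - move=> e /g3[[a /and3P[a1 a2 a3] a4] a5]; rewrite tw in a5; split=> //.
    exists a => //; rewrite a1 a2 a3 /=.
    have := uniq_path_labels d wfG irrG wP; rewrite -{1}(cat_take_drop c w) map_cat tw cat_uniq.
    by case/and3P => _ /hasPn /(_ a a1).
pose prop (B : seq lab) (g : group lab Kz D x0) (B' : seq lab) :=
  [/\ group_edges x g \subset G,
      Gam <= psi * (\sum_(e in group_edges x g) l e.1.2) - (light_size g)%:R * ell &
      forall e, e \in group_edges x g ->
       (exists2 a, [&& LJ u a, a \notin B & a \notin map fst u] & a \in [:: e.1.1; e.2]) /\
       (forall b, b \in [:: e.1.1; e.2] -> [|| b \in B', HZ u b | b \in map fst u])].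
have build k : (k <= N)%N -> exists s : seq (group lab Kz D x0), exists B : seq lab,
    [/\ size s = k, (size B <= k * D)%N,
        forall g, g \in s -> prop [::] g B &
        pairwise (fun g1 g2 => [disjoint group_edges x g1 & group_edges x g2]) s].
  elim: k => [|k ih] kN; first by exists [::], [::].
  have [s [B [s1 s2 s3 s4]]] := ih (ltnW kN).
  have [|w [g [g1 g2 g3 g4]]] := step B; first by apply: leq_trans s2 _; rewrite leq_mul2r -ltnS (ltn_predK kN) kN orbT.
  exists (g :: s), (low c w ++ B); split => /=.
  - by rewrite s1.
  - by rewrite size_cat mulSn leq_add.
  - move=> g'; rewrite inE => /orP[/eqP -> | /s3[q1 q2 q3]]; split=> //.
      move=> e /g4[[a /and4P[_ a2 _ a4] a5] a6]; split; first by exists a; rewrite ?a2 ?a4.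
      by move=> b /a6; rewrite mem_cat => /or3P[] ->; rewrite ?orbT.
    move=> e /q3[q4 q5]; split=> // b /q5; rewrite mem_cat => /or3P[] ->; rewrite ?orbT //.
  - rewrite s4 andbT; apply/allP => g' /s3[_ _ q3].
    rewrite -setI_eq0; apply/eqP/setP => e; rewrite in_setI in_set0; apply/negP => /andP[/g4[[a /and4P[_ a2 a3 a4] a5] _] /q3[_ q5]].
    have := q5 a a5; rewrite (negPf a3) (negPf a4) (negPf (LJHZ a2)) //.
have [s [B [s1 _ s3 s4]]] := build N (leqnn N).
have st : size s == N by rewrite s1.
pose tp : N.-tuple (group lab Kz D x0) := Tuple st.
exists [ffun r => tnth tp r] => /=; rewrite -/x; split.
- by move=> r; rewrite ffunE; have [] := s3 _ (mem_tnth r tp).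
- by move=> r; rewrite ffunE; have [] := s3 _ (mem_tnth r tp).
- move=> r1 r2 r12; rewrite !ffunE.
  pose g0 := tnth tp r1; rewrite !(tnth_nth g0) /=.
  have sr (r : 'I_N) : (r < size s)%N by rewrite s1.
  have hp := pairwiseP g0 s4.
  have : (r1 != r2 :> nat) by [].
  case: ltngtP => // h12 _; first by apply: hp; rewrite ?inE.
  by rewrite disjoint_sym; apply: hp; rewrite ?inE.
Qed.

End Select.

(** * Gain and waste summed over all paths *)

Section Levels.
Variables (lab : finType) (d : lab * bool) (t : tree lab) (D x0 E : nat).
Variable G : {set lab * bool * lab}.
Hypotheses (wfG : wf (mem G) t) (dep : (depth t <= D)%N) (E0 : (0 < E)%N) (bal : balanced E t).
Hypothesis irrG : forall b e, (b, e, b) \notin G.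

Local Notation P := (paths t).
Local Notation low c w := (map fst (drop c w)).
Local Notation n := (nleaves t).

Variables (R : realFieldType) (l : bool -> R).
Hypotheses (l0 : forall e, 0 <= l e) (l2 : 2 <= l true + l false).
Variables (N2 : R) (lam : nat).

Definition natyp c : nat := count (fun w => (c <= size w)%N && ~~ typical d l N2 lam c w) P.
Definition phi c T : nat := (\sum_(w <- P) nlight t c T w)%N.

Lemma light_mono c T0 T1 u a : (T0 <= T1)%N -> light t c T1 u a -> light t c T0 u a.
Proof. by move=> h; apply: leq_ltn_trans; rewrite leq_mul2l h orbT. Qed.

Lemma phi_mono c T0 T1 : (T0 <= T1)%N -> (phi c T1 <= phi c T0)%N.
Proof. by move=> h; apply: leq_sum => w _; apply: sub_count => a; apply: light_mono. Qed.

Lemma phi_le c T : (phi c T <= D * n)%N.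
Proof.
rewrite /phi /nleaves -sum1_size big_distrr /= big_seq [leqRHS]big_seq.
apply: leq_sum => w wP; rewrite muln1; apply: leq_trans (count_size _ _) _.
by rewrite size_map size_drop; apply: leq_trans (leq_subr _ _) (size_word dep wP).
Qed.

Lemma phi0 c T : (D <= c)%N -> phi c T = 0%N.
Proof.
move=> Dc; rewrite /phi big_seq big1 // => w wP; rewrite /nlight drop_oversize //.
exact: leq_trans (size_word dep wP) Dc.
Qed.

Definition sum_irr c T : nat := (\sum_(w <- P)
  count (fun a => ~~ light t c T (take c w) a && irregular t c x0 (take c w) a w) (low c w))%N.

Variables (psi h ell : R) (c wd : nat).
Hypotheses (psi0 : 0 <= psi) (h0 : 0 <= h).

Local Notation H := (h + psi * D%:R).

Lemma sum_gain LJ HZ (S T : nat) :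
  S = (\sum_(w <- P) count (LJ (take c w)) (low c w))%N ->
  (\sum_(w <- P) trash0 t x0 c wd LJ HZ w <= T)%N ->
  h * S%:R - H * (T%:R + D%:R * (natyp c)%:R) - 2 * psi * (x0 * D)%:R * n%:R
  <= \sum_(w <- P) gain d t D x0 l N2 lam psi h c wd LJ HZ w.
Proof.
move=> -> hT; rewrite /gain; move: (2 * psi * (x0 * D)%:R) => K.
rewrite !sumrB -!mulr_sumr -!natr_sum big_split /= -big_distrr /=.
have -> : (\sum_(w <- P) ((c <= size w)%N && ~~ typical d l N2 lam c w))%N = natyp c.
  rewrite /natyp -sum1_count [RHS]big_mkcond; apply: eq_bigr => w _; by case: (_ && _).
have -> : \sum_(w <- P) K = K * n%:R.
  by rewrite big_const_seq count_predT iter_addr_0 mulr_natr.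
rewrite lerD2r lerD2l lerN2 ler_wpM2l ?addr_ge0 ?mulr_ge0 //.
by rewrite natrD natrM lerD2r ler_nat.
Qed.

(** Labels between the two thresholds account for [phi c T0 - phi c T1]. A label irregular below the
    second cut is either still light there or counted by [sum_irr]. *)
Lemma sum_trash_light T0 T1 TL : (T0 <= T1)%N ->
  (\sum_(w <- P) trash0 t x0 c wd (light t c T1) (fun u a => ~~ light t c T0 u a) w
   <= (phi c T0 - phi c T1) + sum_irr c T0 + (phi (c + wd) TL + sum_irr (c + wd) TL))%N.
Proof.
move=> T01.
have -> : (phi c T0 - phi c T1)%N = (\sum_(w <- P)
    count (fun a => ~~ light t c T1 (take c w) a && light t c T0 (take c w) a) (low c w))%N.
  apply/eqP; rewrite -(eqn_add2r (phi c T1)) subnK ?phi_mono // -big_split /=; apply/eqP.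
  apply: eq_bigr => w _; rewrite /nlight addnC -(count_predUI (light t c T1 (take c w))).
  rewrite (@eq_count _ (predI _ _) pred0) ?count_pred0 ?addn0; last by move=> a /=; case: (light _ _ _ _ _).
  apply: eq_count => a /=; have := @light_mono c T0 T1 (take c w) a T01.
  by case: (light t c T1 _ _) => [->|] //.
rewrite /phi /sum_irr -!big_split /=; apply: leq_sum => w _; rewrite /trash0 /trash.
rewrite (@eq_count _ (fun a => _ && (a \in [::])) pred0) ?count_pred0 ?addn0; last by move=> a /=; rewrite andbF.
rewrite leq_add //.
  rewrite leq_add //; apply: sub_count => a /=; by rewrite negbK.
rewrite /nlight -(count_predUI (light t (c + wd) TL (take (c + wd) w))).
apply: leq_trans (leq_addr _ _); apply: sub_count => a /= ->; by rewrite andbT orbN.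
Qed.

Lemma sum_irr_le cc T : ((sum_irr cc T) * E ^ x0 <= D * T * E.-1 ^ x0 * n)%N.
Proof. by apply: sum_irregular => // w; apply: (uniq_path_labels d wfG irrG). Qed.

(** The degenerate choice: cut at the root, every label treated as late and light, none shared. Only
    irregularity at the root is wasteful. *)
Lemma sum_trash_all TL : c = 0%N -> wd = 0%N ->
  (\sum_(w <- P) trash0 t x0 c wd (fun _ => predT) (fun _ => pred0) w
   <= phi 0 TL + sum_irr 0 TL)%N.
Proof.
move=> -> ->; rewrite /phi /sum_irr -!big_split /=; apply: leq_sum => w _; rewrite /trash0 /trash.
have c0 (q : pred lab) s : q =1 pred0 -> count q s = 0%N.
  by move=> /eq_count ->; apply: count_pred0.
rewrite [X in (X + _ + _ + _ <= _)%N]c0 // [X in (_ + X + _ + _ <= _)%N]c0 //.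
rewrite [X in (_ + _ + _ + X <= _)%N]c0 // addn0 !add0n.
rewrite /nlight -(count_predUI (light t 0 TL (take 0 w))).
apply: leq_trans (leq_addr _ _); apply: sub_count => a /= ->; by rewrite andbT orbN.
Qed.

(* [kap] bounds each of the five sources of waste relative to the gain [eta]. *)
Lemma gain_enough LJ HZ (S T : nat) (eta kap : R) : 0 <= eta -> 0 <= kap ->
  S = (\sum_(w <- P) count (LJ (take c w)) (low c w))%N ->
  (\sum_(w <- P) trash0 t x0 c wd LJ HZ w <= T)%N ->
  eta * D%:R * n%:R <= S%:R -> T%:R <= 4 * kap * eta * D%:R * n%:R ->
  (natyp c)%:R <= kap * eta * n%:R ->
  5 * kap * H <= h / 4 -> 2 * psi * x0%:R <= h * eta / 4 ->
  h * eta * D%:R / 2 * n%:R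
  <= \sum_(w <- P) gain d t D x0 l N2 lam psi h c wd LJ HZ w.
Proof.
move=> eta0 kap0 hS hT h1 h2 h3 h4 h5; apply: le_trans (sum_gain hS hT).
have H0 : 0 <= H by rewrite addr_ge0 // mulr_ge0.
have k1 : h * (eta * D%:R * n%:R) <= h * S%:R by rewrite ler_wpM2l.
have k2 : D%:R * (natyp c)%:R <= D%:R * (kap * eta * n%:R) :> R by rewrite ler_wpM2l.
have k3 : H * (T%:R + D%:R * (natyp c)%:R) <= H * (5 * kap * eta * D%:R * n%:R).
  by rewrite ler_wpM2l //; lra.
have edn : 0 <= eta * D%:R * n%:R by rewrite !mulr_ge0.
have k4 : (5 * kap * H) * (eta * D%:R * n%:R) <= h / 4 * (eta * D%:R * n%:R) by rewrite ler_wpM2r.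
have k5 : (2 * psi * x0%:R) * (D%:R * n%:R) <= h * eta / 4 * (D%:R * n%:R) by rewrite ler_wpM2r // mulr_ge0.
rewrite natrM; lra.
Qed.

End Levels.

(** * Powers of two, and costs measured in bits *)

Section Exp2.
Variable R : realType.
Implicit Types x y : R.

Lemma exp2_gt0 x : 0 < 2 `^ x.
Proof. exact: powR_gt0. Qed.

Lemma exp2D x y : 2 `^ (x + y) = 2 `^ x * 2 `^ y.
Proof. by rewrite powRD // pnatr_eq0 implybT. Qed.

Lemma exp2_nat (k : nat) : 2 `^ k%:R = 2 ^+ k :> R.
Proof. by rewrite powR_mulrn. Qed.

Lemma exp2_sum (I : Type) (r : seq I) (Q : pred I) (f : I -> R) :
  2 `^ (\sum_(i <- r | Q i) f i) = \prod_(i <- r | Q i) 2 `^ (f i).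
Proof.
elim/big_rec2: _ => [|i y x _ <-]; first by rewrite powRr0.
by rewrite exp2D.
Qed.

Lemma ler_exp2 x y : (2 `^ x <= 2 `^ y) = (x <= y).
Proof.
apply/idP/idP => [|h]; last by rewrite ler_powR // ler1n.
by rewrite -[2 `^ x <= _]ler_ln ?posrE ?exp2_gt0 // !ln_powR ler_pM2r // ln_gt0 // ltr1n.
Qed.

Lemma exp2_log2 x : 0 < x -> 2 `^ (log2 x) = x.
Proof.
move=> x0; have l2 : ln (2 : R) != 0 by rewrite gt_eqF // ln_gt0 // ltr1n.
by apply: ln_inj; rewrite ?posrE ?exp2_gt0 // ln_powR /log2 divfK.
Qed.

End Exp2.

Section Costs.
Variables (R : realType) (pi : bool -> R).
Hypotheses (pi0 : forall e, 0 < pi e) (pi1 : pi true + pi false <= 1).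

Definition lcost (e : bool) : R := - log2 (pi e).

Lemma exp2_lcost e : 2 `^ (- lcost e) = pi e.
Proof. by rewrite opprK exp2_log2. Qed.

Lemma lcost_ge0 e : 0 <= lcost e.
Proof.
rewrite -oppr_le0 -ler_exp2 exp2_lcost powRr0.
by have := pi0 (~~ e); case: e => /=; have := pi1; lra.
Qed.

(** By the arithmetic-geometric mean inequality the product of the two weights is at most 1/4. *)
Lemma lcost_sum : 2 <= lcost true + lcost false.
Proof.
rewrite -lerN2 -ler_exp2 opprD exp2D !exp2_lcost powRN (exp2_nat R 2).
have := pi0 true; have := pi0 false; set a := pi false; set b := pi true => a0 b0.
have ab : a + b <= 1 by rewrite addrC.
have : 0 <= (a - b) ^+ 2 by rewrite sqr_ge0.
have : (a + b) ^+ 2 <= 1 by rewrite expr_le1 // addr_ge0 // ltW.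
rewrite !expr2 => h1 h2; rewrite -[_^-1]div1r ler_pdivlMr //; nra.
Qed.

Variables (lab : finType) (d : lab * bool) (t : tree lab).

Lemma hybridE c (w : seq (lab * bool)) : (c <= size w)%N ->
  hybrid pi c w = 2 `^ (- (\sum_(0 <= i < c) lcost (nth d w i).2 + (size w - c)%:R)).
Proof.
elim: w c => [|x w ih] [|c] //=.
- by move=> _; rewrite big_geq // add0r subn0 oppr0 powRr0.
- move=> _; rewrite ih // !big_geq // !add0r !subn0 -[(size w).+1%:R]natr1 opprD exp2D mulrC.
  by rewrite powR_inv1.
- rewrite ltnS => cw; rewrite ih // big_nat_recl //= subSS -addrA [in RHS]opprD [in RHS]exp2D.
  by rewrite exp2_lcost.
Qed.

(** An atypical path has hybrid weight at least [2^lam] divided by the number of leaves, and the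
    weights add up to at most 1. *)
Lemma natyp_le (N2 : R) lam c : (nleaves t)%:R = 2 `^ N2 ->
  (natyp d t lcost N2 lam c)%:R * 2 ^+ lam <= (nleaves t)%:R :> R.
Proof.
move=> nE; have k := @kraft lab R pi (fun e => ltW (pi0 e)) pi1 c t.
have n0 : 0 < (nleaves t)%:R :> R by rewrite ltr0n nleaves_gt0.
set q := (fun w : seq (lab * bool) => (c <= size w)%N && ~~ typical d lcost N2 lam c w).
have : (natyp d t lcost N2 lam c)%:R * (2 ^+ lam / (nleaves t)%:R) <= 1 :> R.
  apply: le_trans k; rewrite (bigID q) /=; apply: ler_wpDr.
    by apply: sumr_ge0 => w _; apply: hybrid_ge0 => e; apply: ltW.
  rewrite /natyp -sum1_count natr_sum mulr_suml; apply: ler_sum => w /andP[cw].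
  rewrite -ltNge mul1r hybridE // nE => /ltW h.
  by rewrite -exp2_nat -powRN -exp2D ler_exp2; lra.
by rewrite mulrA ler_pdivrMr // mul1r.
Qed.

Variable psi : R.
(** The edge probability p_e, recovered from its root [pi e] = p_e^(1/psi). *)
Definition pcost (e : bool) : R := 2 `^ (- (psi * lcost e)).

Lemma edge_weightE (F : {set lab * bool * lab}) :
  edge_weight pcost F = 2 `^ (- (psi * \sum_(e in F) lcost e.1.2)).
Proof. by rewrite mulr_sumr -sumrN exp2_sum. Qed.

Lemma cheapP Dq Kz D x0 (x : context lab Dq Kz) (g : group lab Kz D x0) (Gam : R) (ell : nat) :
  #|lab| = (2 ^ ell)%N ->
  Gam <= psi * (\sum_(e in group_edges x g) lcost e.1.2) - (light_size g)%:R * ell%:R ->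
  cheap pcost (2 `^ (- Gam)) x g.
Proof.
move=> cl h; rewrite /cheap edge_weightE cl natrX -exprM -(exp2_nat R) -exp2D ler_exp2.
by rewrite natrM mulrC; lra.
Qed.

End Costs.

(** * From a large balanced tree to a family of cheap groups *)

Section TreeGroups.
Variables (R : realType) (psi g kap etam gam : R) (U V L x0 lam q1 ell E : nat).
Hypotheses (psi0 : 0 < psi) (g0 : 0 < g) (kap0 : 0 < kap) (etam0 : 0 < etam).
Hypotheses (hk : 5 * kap * (g / 2 + 4 * psi) <= g / 8) (gamE : gam = g * etam / 2).
Hypotheses (hL : 1 <= L%:R * kap * etam) (U0 : (0 < U)%N)
  (hU : 4 * V%:R * (g / 2 + 4 * psi) <= gam * U%:R).
Hypotheses (E1 : (1 < E)%N) (hx : (U ^ L)%:R * E.-1%:R ^+ x0 <= kap * etam * E%:R ^+ x0)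
  (hlam : 1 <= kap * etam * 2 ^+ lam).
Hypotheses (ell0 : (0 < ell)%N) (hell : psi * (lam%:R + 1) <= g / 4 * ell%:R)
  (hx0 : 16 * psi * x0%:R <= g * ell%:R * etam) (q10 : (0 < q1)%N) (hq1 : 8 * psi <= g * q1%:R).

Variables (lab : finType) (d : lab * bool) (t : tree lab) (pi : bool -> R) (N2 : R).
Variable G : {set lab * bool * lab}.
Local Notation D := (4 * ell)%N.
Local Notation P := (paths t).
Local Notation n := (nleaves t).
Local Notation wd := (ell %/ q1)%N.
Hypotheses (pi0 : forall e, 0 < pi e) (pi1 : pi true + pi false <= 1).
Hypotheses (wfG : wf (mem G) t) (dep : (depth t <= D)%N) (bal : balanced E t).
Hypothesis irrG : forall b e, (b, e, b) \notin G.
Hypotheses (clab : #|lab| = (2 ^ ell)%N) (nE : n%:R = 2 `^ N2)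
  (hN : (1 + g) * ell%:R <= psi * N2).

Local Notation h := (g / 2 * ell%:R).
Local Notation H := (h + psi * D%:R).
Local Notation Gam := (gam * ell%:R ^+ 2).

Let n0 : 0 < n%:R :> R.
Proof. by rewrite ltr0n nleaves_gt0. Qed.
Let h0 : 0 <= h.
Proof. by rewrite mulr_ge0 // divr_ge0 // ltW. Qed.
Let E0 : (0 < E)%N.
Proof. exact: ltnW. Qed.
Let HE : H = (g / 2 + 4 * psi) * ell%:R.
Proof. by rewrite natrM; ring. Qed.
Let gam0 : 0 < gam.
Proof. by rewrite gamE !mulr_gt0 // invr_gt0. Qed.
Let Gam0 : 0 < Gam.
Proof. by rewrite mulr_gt0 // exprn_gt0 // ltr0n. Qed.
Let D0 : 0 < D%:R :> R.
Proof. by rewrite ltr0n muln_gt0. Qed.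
Let uniqw w : w \in P -> uniq (map fst w).
Proof. exact: (uniq_path_labels d wfG irrG). Qed.

(** Half of the surplus [g] becomes [h]. The other half pays for the levels between the cuts ([hq1])
    and for the slack in Kraft's inequality ([hell]). *)
Lemma hN_wd k : (k <= wd)%N -> h + ell%:R + psi * (2 * k + 1)%:R <= psi * (N2 - lam%:R).
Proof.
move=> kw; have h1 : (q1 * k <= ell)%N.
  by apply: leq_trans (leq_mul (leqnn _) kw) _; rewrite mulnC leq_trunc_div.
rewrite -(ler_nat R) natrM in h1.
have h2 : 8 * psi * k%:R <= g * q1%:R * k%:R by rewrite ler_wpM2r.
have h3 : g * (q1%:R * k%:R) <= g * ell%:R by rewrite ler_wpM2l // ltW.
move: hell hN; rewrite natrD natrM; lra.
Qed.

Lemma irr_small c T eta : etam <= eta -> (T <= U ^ L)%N ->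
  (sum_irr t x0 c T)%:R <= kap * eta * D%:R * n%:R :> R.
Proof.
move=> he hT; apply: (@le_trans _ _ (kap * etam * D%:R * n%:R)); last first.
  by rewrite !ler_wpM2r // ler_wpM2l // ltW.
have Ex : 0 < E%:R ^+ x0 :> R by rewrite exprn_gt0 // ltr0n.
rewrite -(ler_pM2r Ex).
have := sum_irr_le d x0 wfG dep E0 bal irrG c T; rewrite -(ler_nat R) !natrM !natrX.
move=> /le_trans; apply.
have hT' : T%:R <= (U ^ L)%:R :> R by rewrite ler_nat.
have k1 : T%:R * E.-1%:R ^+ x0 <= kap * etam * E%:R ^+ x0.
  by apply: le_trans hx; rewrite ler_wpM2r // exprn_ge0.
have k2 : (4 * ell%:R * n%:R) * (T%:R * E.-1%:R ^+ x0) <= (4 * ell%:R * n%:R) * (kap * etam * E%:R ^+ x0).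
  by rewrite ler_wpM2l // !mulr_ge0.
lra.
Qed.

Lemma atyp_small c eta : etam <= eta ->
  (natyp d t (lcost pi) N2 lam c)%:R <= kap * eta * n%:R.
Proof.
move=> he; apply: (@le_trans _ _ (kap * etam * n%:R)); last first.
  by rewrite ler_wpM2r // ler_wpM2l // ltW.
have := natyp_le pi0 pi1 d lam c nE; set a := (natyp _ _ _ _ _ _)%:R => ha.
have a0 : 0 <= a by [].
have p2 : 0 < 2 ^+ lam :> R by rewrite exprn_gt0.
have k1 : 1 * a <= (kap * etam * 2 ^+ lam) * a by rewrite ler_wpM2r.
have k2 : (kap * etam) * (a * 2 ^+ lam) <= (kap * etam) * n%:R by rewrite ler_wpM2l // mulr_ge0 // ltW.
lra.
Qed.

Lemma gains (eta : R) : etam <= eta ->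
  2 * Gam <= h * eta * D%:R / 2 /\ 5 * kap * H <= h / 4 /\ 2 * psi * x0%:R <= h * eta / 4.
Proof.
move=> he; have l0 : 0 <= ell%:R :> R by []; split; [|split].
- rewrite gamE natrM expr2.
  have : (g * ell%:R * ell%:R) * etam <= (g * ell%:R * ell%:R) * eta by rewrite ler_wpM2l // !mulr_ge0 // ltW.
  lra.
- rewrite HE; have : 5 * kap * (g / 2 + 4 * psi) * ell%:R <= g / 8 * ell%:R by rewrite ler_wpM2r.
  lra.
- have : (g * ell%:R) * etam <= (g * ell%:R) * eta by rewrite ler_wpM2l // mulr_ge0 // ltW.
  by move: hx0; lra.
Qed.

Lemma groups_has Dq Kz N (x : context lab Dq Kz) (gg : {ffun 'I_N -> group lab Kz D x0}) :
  (forall r, group_edges x (gg r) \subset G) ->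
  (forall r, Gam <= psi * (\sum_(e in group_edges x (gg r)) lcost pi e.1.2) - (light_size (gg r))%:R * ell%:R) ->
  (forall r1 r2, r1 != r2 -> [disjoint group_edges x (gg r1) & group_edges x (gg r2)]) ->
  @has_groups lab Dq Kz D x0 R (pcost pi psi) N (2 `^ (- Gam)) G.
Proof.
move=> h1 h2 h3; apply/existsP; exists x; apply/existsP; exists gg; apply/and3P; split.
- by apply/forallP => r; apply: cheapP clab (h2 r).
- by apply/forallP => r1; apply/forallP => r2; apply/implyP/h3.
- by apply/forallP.
Qed.

(** Hardly any label is light at the root, so nearly all positions of a typical path are regular
    there and see each other on both sides. One path is then enough, with an empty context. *)
Lemma level_A (eta : R) : etam <= eta -> eta * D%:R * n%:R <= (\sum_(w <- P) size w)%:R ->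
  (phi t 0 (U ^ L))%:R <= kap * eta * D%:R * n%:R ->
  @has_groups lab 0 0 D x0 R (pcost pi psi) 1 (2 `^ (- Gam)) G.
Proof.
move=> he hS hphi; have [g1 [g2 g3]] := gains he.
have eta0 : 0 <= eta by apply: le_trans he; rewrite ltW.
pose LJ (u : seq (lab * bool)) := (predT : pred lab); pose HZ (u : seq (lab * bool)) := (pred0 : pred lab).
have LJHZ u a : LJ u a -> ~~ HZ u a by [].
have SE : (\sum_(w <- P) size w = \sum_(w <- P) count (LJ (take 0 w)) (map fst (drop 0 w)))%N.
  by apply: eq_bigr => w _; rewrite /LJ count_predT size_map drop0.
have TE := @sum_trash_all lab t x0 0 0 (U ^ L) erefl erefl.
have eD : 0 <= kap * eta * D%:R * n%:R by rewrite !mulr_ge0 // ltW.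
have Tb : (phi t 0 (U ^ L) + sum_irr t x0 0 (U ^ L))%:R <= 4 * kap * eta * D%:R * n%:R.
  by rewrite natrD; have := irr_small 0 he (leqnn (U ^ L)); lra.
have sg := gain_enough (ltW psi0) h0 eta0 (ltW kap0) SE TE hS Tb (atyp_small 0 he) g2 g3.
have sg' : 2 * Gam * n%:R <= \sum_(w <- P) gain d t D x0 (lcost pi) N2 lam psi h 0 0 LJ HZ w.
  by apply: le_trans sg; rewrite ler_wpM2r.
have col u B : (size B <= 0)%N ->
    (\sum_(w <- P | take 0 w == u) count (fun a => LJ u a && (a \in B)) (map fst (drop 0 w)))%:R
      <= 0 * (cnt t 0 u)%:R :> R.
  rewrite leqn0 size_eq0 => /eqP ->; rewrite mul0r big1 // => w _.
  by rewrite (@eq_count _ _ pred0) ?count_pred0 // => a /=; rewrite andbF.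
have [|u u0 hu] := select dep (ltW psi0) h0 Gam0 _ sg' col; first by rewrite mulr0 ltW.
have hz a : HZ u a -> exists z : 'I_0, [ffun _ => d.1] z = a by [].
have hN0 := hN_wd (leq0n wd).
have [gg /= [q1' q2 q3]] := groups_of_select (N := 1) wfG dep irrG (lcost_ge0 pi0 pi1) (lcost_sum pi0 pi1)
  (ltW psi0) h0 hN0 LJHZ (leqnn 0) hz hu.
exact: groups_has q1' q2 q3.
Qed.

(** Many labels are light at depth [c] but few at depth [c + wd], so those light at the first cut
    are mostly regular below the second. *)
Lemma level_B c (eta : R) : etam <= eta -> eta * D%:R * n%:R <= (phi t c (U ^ L))%:R ->
  (phi t (c + wd) (U ^ L))%:R <= kap * eta * D%:R * n%:R ->
  exists2 j, (j < L)%N &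
  @has_groups lab D (D * U ^ j) D x0 R (pcost pi psi) (V * U ^ j) (2 `^ (- Gam)) G.
Proof.
move=> he hS hphi; have [g1 [g2 g3]] := gains he.
have eta0 : 0 < eta by apply: lt_le_trans he.
have Dn : 0 < D%:R * n%:R :> R by rewrite mulr_gt0.
(* Otherwise each of the [L] frequency bands would hold more than a fraction [kap * eta] of the at
   most [D * n] label occurrences, contradicting [hL]. *)
have [j jL hj] : exists2 j, (j < L)%N &
    (phi t c (U ^ j) - phi t c (U ^ j.+1))%:R <= kap * eta * D%:R * n%:R.
  have [/hasP[j]|/hasPn hn] := boolP (has (fun j => (phi t c (U ^ j) - phi t c (U ^ j.+1))%:R <= kap * eta * D%:R * n%:R) (iota 0 L)).
    by rewrite mem_iota => jL hj; exists j.
  have : \sum_(0 <= j < L) (kap * eta * D%:R * n%:R) <= \sum_(0 <= j < L) ((phi t c (U ^ j))%:R - (phi t c (U ^ j.+1))%:R).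
    rewrite !big_nat; apply: ler_sum => j jL; have := hn j; rewrite mem_iota => /(_ jL).
    by rewrite -ltNge => /ltW; rewrite natrB // phi_mono // leq_pexp2l.
  have -> : \sum_(0 <= j < L) ((phi t c (U ^ j))%:R - (phi t c (U ^ j.+1))%:R)
      = (phi t c (U ^ 0))%:R - (phi t c (U ^ L))%:R :> R.
    rewrite -[RHS]opprB -(telescope_sumr (fun j => (phi t c (U ^ j))%:R)) // -sumrN.
    by apply: eq_bigr => j _; rewrite opprB.
  rewrite big_const_nat subn0 iter_addr_0 -[X in X <= _]mulr_natr => hsum.
  have hp : (phi t c (U ^ 0))%:R <= D%:R * n%:R :> R by rewrite -natrM ler_nat phi_le.
  have k1 : (L%:R * kap) * etam <= (L%:R * kap) * eta by rewrite ler_wpM2l // mulr_ge0 // ltW.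
  have k2 : 1 * (D%:R * n%:R) <= (L%:R * kap * eta) * (D%:R * n%:R).
    by rewrite ler_wpM2r ?(ltW Dn) //; apply: le_trans hL _.
  have k3 : 0 < eta * (D%:R * n%:R) by rewrite mulr_gt0.
  exfalso; move: hsum hp k2 k3 hS; set X := _ * _ * L%:R => hsum hp k2 k3 hS.
  have : X = L%:R * kap * eta * (D%:R * n%:R) by rewrite /X; ring.
  lra.
exists j => //.
pose LJ := light t c (U ^ j.+1); pose HZ (u : seq (lab * bool)) a := ~~ light t c (U ^ j) u a.
have Uj : (U ^ j <= U ^ j.+1)%N by rewrite leq_pexp2l.
have LJHZ u a : LJ u a -> ~~ HZ u a by move=> /(light_mono Uj); rewrite /HZ negbK.
have TE := @sum_trash_light lab t x0 c wd (U ^ j) (U ^ j.+1) (U ^ L) Uj.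
have Tb : ((phi t c (U ^ j) - phi t c (U ^ j.+1)) + sum_irr t x0 c (U ^ j) +
    (phi t (c + wd) (U ^ L) + sum_irr t x0 (c + wd) (U ^ L)))%:R <= 4 * kap * eta * D%:R * n%:R.
  rewrite !natrD; have := irr_small (c + wd) he (leqnn (U ^ L)).
  have jL' : (U ^ j <= U ^ L)%N by rewrite leq_pexp2l // ltnW.
  by have := irr_small c he jL'; lra.
have hS' : eta * D%:R * n%:R <= (phi t c (U ^ j.+1))%:R.
  by apply: le_trans hS _; rewrite ler_nat phi_mono // leq_pexp2l.
have sg := gain_enough (ltW psi0) h0 (ltW eta0) (ltW kap0) (erefl (phi t c (U ^ j.+1))) TE hS' Tb (atyp_small c he) g2 g3.
have sg' : 2 * Gam * n%:R <= \sum_(w <- P) gain d t D x0 (lcost pi) N2 lam psi h c wd LJ HZ w.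
  by apply: le_trans sg; rewrite ler_wpM2r.
have Ur : 0 < U%:R :> R by rewrite ltr0n.
(* Earlier paths carry at most [V * U ^ j * D] labels, and a light one has frequency below
   [1 / U ^ j.+1]. *)
pose beta : R := V%:R * D%:R / U%:R.
have hb : H * beta <= Gam.
  have -> : H * beta = (4 * V%:R * (g / 2 + 4 * psi)) * (ell%:R ^+ 2) / U%:R.
    by rewrite HE /beta natrM expr2; ring.
  by rewrite ler_pdivrMr // [leRHS]mulrAC ler_wpM2r // exprn_ge0.
have col u B : (size B <= (V * U ^ j).-1 * D)%N ->
    (\sum_(w <- P | take c w == u) count (fun a => LJ u a && (a \in B)) (map fst (drop c w)))%:R
      <= beta * (cnt t c u)%:R :> R.
  move=> sB; have := sum_collisions uniqw c u (U ^ j.+1) B; rewrite -/LJ.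
  set S := (\sum_(w <- P | _) _)%N => hc.
  have hc2 : (S * U <= V * D * cnt t c u)%N.
    rewrite -(leq_pmul2r (m := U ^ j)) ?expn_gt0 ?U0 // -mulnA -expnS.
    apply: leq_trans hc _; apply: leq_trans (leq_mul sB (leqnn _)) _.
    apply: (@leq_trans (V * U ^ j * D * cnt t c u)); last by apply: eq_leq; ring.
    by rewrite !leq_mul // leq_pred.
  rewrite -(ler_pM2r Ur) /beta mulrAC divfK ?gt_eqF // -!natrM ler_nat.
  exact: hc2.
have [u u0 hu] := select dep (ltW psi0) h0 Gam0 hb sg' col.
have cD : (c <= D)%N.
  have [//|w /and4P[wP _ cw _] _] := hu [::]; exact: leq_trans cw (size_word dep wP).
pose Hs := [set a | ~~ light t c (U ^ j) u a].
have cH : (#|Hs| <= D * U ^ j)%N by apply: card_heavy.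
pose zl := [ffun z : 'I_(D * U ^ j) => nth d.1 (enum Hs) z].
have hz a : HZ u a -> exists z, zl z = a.
  move=> ha; have aH : a \in enum Hs by rewrite mem_enum inE.
  have ia : (index a (enum Hs) < D * U ^ j)%N by apply: leq_trans cH; rewrite cardE index_mem.
  by exists (Ordinal ia); rewrite ffunE nth_index.
have hN0 := hN_wd (leqnn wd).
have [gg /= [q1' q2 q3]] := groups_of_select wfG dep irrG (lcost_ge0 pi0 pi1) (lcost_sum pi0 pi1)
  (ltW psi0) h0 hN0 LJHZ cD hz hu.
exact: groups_has q1' q2 q3.
Qed.

End TreeGroups.

(** * Choice of the constants and of the depth *)

Lemma nat_above (R : realType) (x : R) : exists2 k : nat, (0 < k)%N & x <= k%:R.
Proof.
exists (Num.bound `|x|).+1 => //.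
apply: le_trans (ler_norm x) _; apply: (@le_trans _ _ (Num.bound `|x|)%:R); last by rewrite ler_nat.
exact/ltW/archi_boundP.
Qed.

Lemma bernoulli (R : realType) (y : R) k : 0 <= y -> 1 + k%:R * y <= (1 + y) ^+ k.
Proof.
move=> y0; elim: k => [|k ih]; first by rewrite mul0r addr0 expr0.
rewrite exprS -natr1; have k0 : 0 <= k%:R :> R by [].
have : (1 + y) * (1 + k%:R * y) <= (1 + y) * (1 + y) ^+ k by rewrite ler_wpM2l // addr_ge0.
have : 0 <= k%:R * y * y by rewrite !mulr_ge0.
lra.
Qed.

Lemma tree_groups (R : realType) (psi g : R) (E : nat) : 0 < psi -> 0 < g -> (1 < E)%N ->
  exists (gam : R) (U V L x0 ell0 : nat), [/\ 0 < gam, (0 < U)%N, 64 <= gam * V%:R &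
  forall (ell : nat) (lab : finType) (d : lab * bool) (t : tree lab) (pi : bool -> R) (N2 : R)
     (G : {set lab * bool * lab}), (ell0 <= ell)%N ->
   (forall e, 0 < pi e) -> pi true + pi false <= 1 ->
   wf (mem G) t -> (depth t <= 4 * ell)%N -> balanced E t -> (forall b e, (b, e, b) \notin G) ->
   #|lab| = (2 ^ ell)%N -> (nleaves t)%:R = 2 `^ N2 -> (1 + g) * ell%:R <= psi * N2 ->
   @has_groups lab 0 0 (4 * ell) x0 R (pcost pi psi) 1 (2 `^ (- (gam * ell%:R ^+ 2))) G \/
   exists2 j, (j < L)%N & @has_groups lab (4 * ell) (4 * ell * U ^ j) (4 * ell) x0 R (pcost pi psi)
     (V * U ^ j) (2 `^ (- (gam * ell%:R ^+ 2))) G].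
Proof.
have s1 (a b c e : nat) : [/\ (a <= a + b + c + e)%N, (b <= a + b + c + e)%N,
    (c <= a + b + c + e)%N & (e <= a + b + c + e)%N] by split; lia.
have s2 (q ell : nat) : (0 < q)%N -> (2 * q <= ell)%N -> (4 * ell <= 8 * q * (ell %/ q))%N.
  move=> q0 hq; have := divn_eq ell q; have := ltn_pmod ell q0.
  by move: (ell %/ q)%N (ell %% q)%N => a b; nia.
move=> psi0 g0 E1.
(* The constants [kap], [q1], [etam], [L], [gam], [V], [U], [x0], [lam] are chosen in this order,
   each from [psi], [g], [E] and its predecessors. *)
pose h1 := g / 2 + 4 * psi.
have h10 : 0 < h1 by rewrite /h1; lra.
pose kap := g / (40 * h1).
have kap0 : 0 < kap by rewrite divr_gt0 // mulr_gt0.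
have hk : 5 * kap * h1 <= g / 8.
  have -> : 5 * kap * h1 = g / 8; last by [].
  by rewrite /kap; field; rewrite gt_eqF.
have kap1 : kap <= 1.
  rewrite ler_pdivrMr ?mulr_gt0 // mul1r /h1; lra.
(* At least half of the [n] paths will have length at least [ell / (2 * psi)], and these lengths add
   up to [a0 * (4 * ell) * n]. *)
pose a0 : R := (16 * psi)^-1.
have a00 : 0 < a0 by rewrite invr_gt0 mulr_gt0.
have [q1 q10 hq1'] := nat_above (8 * psi / g).
have hq1 : 8 * psi <= g * q1%:R by move: hq1'; rewrite ler_pdivrMr //; lra.
(* So many steps of [ell %/ q1] levels reach the depth bound [4 * ell] despite the rounding, once
   [2 * q1 <= ell]. *)
pose Bn := (8 * q1)%N.
pose etam := a0 * kap ^+ Bn.+1.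
have etam0 : 0 < etam by rewrite mulr_gt0 // exprn_gt0.
have [L L0 hL'] := nat_above (kap * etam)^-1.
have ke0 : 0 < kap * etam by rewrite mulr_gt0.
have hL : 1 <= L%:R * kap * etam by rewrite -mulrA -ler_pdivrMr // div1r.
pose gam := g * etam / 2.
have gam0 : 0 < gam by rewrite /gam divr_gt0 // mulr_gt0.
have [V V0 hV'] := nat_above (64 / gam).
have hV : 64 <= gam * V%:R by move: hV'; rewrite ler_pdivrMr //; lra.
have [U U0 hU'] := nat_above (4 * V%:R * h1 / gam).
have hU : 4 * V%:R * h1 <= gam * U%:R by move: hU'; rewrite ler_pdivrMr //; lra.
have [x0 _ hx'] := nat_above ((U ^ L)%:R / (kap * etam) * E.-1%:R).
have Ep : 0 < E.-1%:R :> R by rewrite ltr0n -subn1 subn_gt0.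
have hx : (U ^ L)%:R * E.-1%:R ^+ x0 <= kap * etam * E%:R ^+ x0.
  have k1 : 1 + x0%:R * E.-1%:R^-1 <= (1 + E.-1%:R^-1) ^+ x0 :> R by apply: bernoulli; rewrite invr_ge0 ltW.
  have eE : E%:R = E.-1%:R * (1 + E.-1%:R^-1) :> R.
    by rewrite mulrDr mulr1 divff ?gt_eqF // natr1 prednK // ltnW.
  rewrite eE exprMn [leRHS]mulrCA [leRHS]mulrC ler_wpM2r ?exprn_ge0 ?(ltW Ep) //.
  have k2 : (U ^ L)%:R / (kap * etam) <= x0%:R * E.-1%:R^-1 by rewrite ler_pdivlMr.
  have k3 : (U ^ L)%:R <= (kap * etam) * (x0%:R * E.-1%:R^-1) by rewrite mulrC -ler_pdivrMr.
  apply: le_trans k3 _; rewrite ler_wpM2l ?(ltW ke0) //; lra.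
have [lam lam0 hlam'] := nat_above (kap * etam)^-1.
have hlam : 1 <= kap * etam * 2 ^+ lam.
  have k1 : 1 + lam%:R * 1 <= (1 + 1) ^+ lam :> R by apply: bernoulli.
  have k2 : (kap * etam)^-1 <= 2 ^+ lam by apply: le_trans hlam' _; move: k1; rewrite mulr1 (_ : 1 + 1 = 2 :> R) //; lra.
  by rewrite mulrC -ler_pdivrMr // div1r.
have [e1 _ he1] := nat_above (psi * (lam%:R + 1) * 4 / g).
have [e2 _ he2] := nat_above (16 * psi * x0%:R / (g * etam)).
have [e3 _ he3] := nat_above (2 * psi * lam%:R).
exists gam, U, V, L, x0, (e1 + e2 + e3 + 2 * q1)%N; split => //.
move=> ell lab d t pi N2 G hell0 pi0 pi1 wfG dep bal irrG clab nE hN.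
have le_ell k : (k <= e1 + e2 + e3 + 2 * q1)%N -> k%:R <= ell%:R :> R.
  by move=> hkk; rewrite ler_nat; apply: leq_trans hkk hell0.
have [s11 s12 s13 s14] := s1 e1 e2 e3 (2 * q1)%N.
have q2 := leq_trans s14 hell0.
have ell0 : (0 < ell)%N by apply: leq_trans q2; rewrite muln_gt0.
have hell : psi * (lam%:R + 1) <= g / 4 * ell%:R.
  have := le_trans he1 (le_ell e1 s11); rewrite ler_pdivrMr // => k1; lra.
have hx0 : 16 * psi * x0%:R <= g * ell%:R * etam.
  have ge0 : 0 < g * etam by apply: mulr_gt0.
  by have := le_trans he2 (le_ell e2 s12); rewrite ler_pdivrMr // => k1; lra.
have hl3 : 2 * psi * lam%:R <= ell%:R := le_trans he3 (le_ell e3 s13).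
pose wd := (ell %/ q1)%N; pose n := nleaves t; pose D := (4 * ell)%N.
have n0 : 0 < n%:R :> R by rewrite ltr0n nleaves_gt0.
have D0 : 0 < D%:R :> R by rewrite ltr0n muln_gt0.
have cB : (D <= Bn * wd)%N by apply: s2.
(* The required share shrinks by [kap] per step, so that a depth failing its test is negligible
   against the last depth that passes. *)
pose eta i := a0 * kap ^+ i.+1.
have etaB i : (i <= Bn)%N -> etam <= eta i.
  move=> iB; have -> : etam = a0 * kap ^+ (Bn - i + i.+1) by rewrite addnS subnK.
  rewrite /eta ler_wpM2l ?(ltW a00) // exprD.
  by rewrite ler_piMl ?exprn_ge0 ?(ltW kap0) // exprn_ile1 // ltW.
pose good i := (i <= Bn)%N && (eta i * D%:R * n%:R <= (phi t (i * wd) (U ^ L))%:R).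
case: (boolP [exists i : 'I_Bn.+1, good i]) => [/existsP[i0 hi0]|/existsPn hn].
  have ex : exists i, good i by exists i0.
  have ub i : good i -> (i <= Bn)%N by case/andP.
  case: (ex_maxnP ex ub) => i /andP[iB hi] imax; right.
  have i1B : (i.+1 <= Bn)%N.
    rewrite ltn_neqAle iB andbT; apply/eqP => iE; move: hi; rewrite iE (phi0 dep) //.
    by rewrite leNgt !mulr_gt0 // exprn_gt0.
  have nx : (phi t (i * wd + wd) (U ^ L))%:R <= kap * eta i * D%:R * n%:R.
    rewrite leNgt; apply/negP => hlt; have : good i.+1.
      rewrite /good i1B mulSn addnC; apply: le_trans (ltW hlt).
      by rewrite /eta exprS [a0 * (kap * _)]mulrCA.
    by move=> /imax; rewrite ltnn.
  exact: (level_B psi0 g0 kap0 etam0 hk erefl hL U0 hU E1 hx hlam ell0 hell hx0 hq1 d pi0 pi1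
     wfG dep bal irrG clab nE hN (etaB i iB) hi nx).
(* No depth passes, not even 0, so nearly all labels are heavy at the root. *)
left.
have eA : etam <= a0 by rewrite /etam ler_piMr ?(ltW a00) // exprn_ile1 // ltW.
apply: (level_A psi0 g0 kap0 etam0 hk erefl E1 hx hlam ell0 hell hx0 hq1 d pi0 pi1
     wfG dep bal irrG clab nE hN eA).
- have := natyp_le pi0 pi1 d lam 0 nE; set at0 := natyp _ _ _ _ _ _ => hat.
  have half : 2 * at0%:R <= n%:R :> R.
    apply: le_trans hat; rewrite mulrC ler_wpM2l //.
    by rewrite -[X in X <= _]expr1 ler_weXn2l // ler1n.
  have big : (n - at0)%:R * (ell%:R / (2 * psi)) <= (\sum_(w <- paths t) size w)%:R.
    pose ty w := ~~ ((0 <= size w)%N && ~~ typical d (lcost pi) N2 lam 0 w).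
    have -> : (n - at0)%:R = \sum_(w <- paths t | ty w) (1 : R).
      rewrite /n /nleaves /at0 /natyp -(count_predC (fun w => (0 <= size w)%N && ~~ typical d (lcost pi) N2 lam 0 w)) addKn.
      by rewrite -sum1_count natr_sum.
    rewrite mulr_suml natr_sum [leRHS](bigID ty) /=; apply: ler_wpDr; first by apply: sumr_ge0.
    apply: ler_sum => w; rewrite /ty negb_and negbK /= /typical big_geq // add0r subn0 mul1r => hw.
    apply: le_trans hw; rewrite ler_pdivrMr ?mulr_gt0 //.
    have ge0 : 0 <= g * ell%:R by rewrite mulr_ge0 // ltW.
    by move: hN hl3; lra.
  apply: le_trans big.
  have : n%:R / 2 <= (n - at0)%:R :> R.
    have le : (at0 <= n)%N by rewrite -(ler_nat R); have : 0 <= at0%:R :> R by []; lra.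
    by rewrite natrB //; lra.
  move=> hh; apply: (@le_trans _ _ (n%:R / 2 * (ell%:R / (2 * psi)))); last first.
    by rewrite ler_wpM2r // divr_ge0 // mulr_ge0 // ltW.
  rewrite le_eqVlt; apply/orP; left; apply/eqP; rewrite /a0 natrM; field.
  by rewrite gt_eqF.
- have := hn ord0; rewrite /good leq0n /= mul0n -ltNge => /ltW.
  by rewrite /eta expr1 [a0 * kap]mulrC.
Qed.

(** The exponential dominates [(c * ell)^(k+1)], whose spare factor [ell] absorbs [W]. *)
Lemma poly_le_exp2 (R : realType) (k1 W : R) (k : nat) : 0 < k1 ->
  exists e0 : nat, forall ell : nat, (e0 <= ell)%N -> W * ell%:R ^+ k <= 2 `^ (k1 * ell%:R).
Proof.
move=> k10.
have l2 : 0 < ln 2 :> R by rewrite ln_gt0 // ltr1n.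
pose c : R := k1 / k.+1%:R * ln 2.
have c0 : 0 < c by rewrite mulr_gt0 // divr_gt0.
have [e0 _ he0] := nat_above (W / c ^+ k.+1); exists e0 => ell hell.
have -> : 2 `^ (k1 * ell%:R) = (2 `^ (k1 / k.+1%:R * ell%:R)) ^+ k.+1.
  rewrite -powR_mulrn ?powR_ge0 // -powRrM; congr (_ `^ _).
  by rewrite mulrAC divfK // pnatr_eq0.
have ck0 : 0 < c ^+ k.+1 by rewrite exprn_gt0.
have k2 : c * ell%:R <= 2 `^ (k1 / k.+1%:R * ell%:R).
  have -> : 2 `^ (k1 / k.+1%:R * ell%:R) = expR (c * ell%:R).
    by rewrite /powR pnatr_eq0 /= /c mulrAC.
  by apply: le_trans (expR_ge1Dx _); rewrite lerDr.
apply: (@le_trans _ _ ((c * ell%:R) ^+ k.+1)); last first.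
  by apply: lerXn2r; rewrite ?nnegrE ?powR_ge0 // mulr_ge0 // ltW.
rewrite exprMn [ell%:R ^+ k.+1]exprS mulrA ler_wpM2r ?exprn_ge0 //.
move: he0; rewrite ler_pdivrMr // => /le_trans; apply.
by rewrite mulrC ler_wpM2l ?(ltW ck0) // ler_nat.
Qed.

(** * Excluding deep trees, numerical estimates, and the final union bound *)

Section LongPaths.
Variables (R : realType) (lab X : finType) (good : bool -> pred X) (D : nat).
Hypotheses (X0 : (0 < #|X|)%N) (hg : forall e, (2 * #|good e| <= #|X|)%N).

Definition tuple_edges (w : D.-tuple (lab * bool)) : {set lab * bool * lab} :=
  [set (tnth w x.1, (tnth w x.2).1) | x in [set x : 'I_D * 'I_D | (x.1 < x.2)%N]].

Definition long_path (G : {set lab * bool * lab}) : bool :=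
  [exists w : D.-tuple (lab * bool), uniq (map fst w) && (tuple_edges w \subset G)].

Lemma pr_long_path :
  pr R [set c : {ffun lab * bool * lab -> X} | long_path (edge_graph good c)]
    <= (2 * #|lab|)%:R ^+ D * (2^-1) ^+ #|[set x : 'I_D * 'I_D | (x.1 < x.2)%N]|.
Proof.
pose ev (w : D.-tuple (lab * bool)) : {set {ffun lab * bool * lab -> X}} :=
  if uniq (map fst w) then [set c | tuple_edges w \subset edge_graph good c] else set0.
have sub : [set c : {ffun lab * bool * lab -> X} | long_path (edge_graph good c)]
    \subset \bigcup_w ev w.
  apply/subsetP => c; rewrite inE => /existsP[w /andP[h1 h2]].
  by apply/bigcupP; exists w => //; rewrite /ev h1 inE.
apply: le_trans (le_pr R sub) _; apply: le_trans (pr_bigcup _ _) _.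
have -> : (2 * #|lab|)%:R ^+ D * (2^-1) ^+ #|[set x : 'I_D * 'I_D | (x.1 < x.2)%N]|
    = \sum_(w : D.-tuple (lab * bool)) (2^-1 : R) ^+ #|[set x : 'I_D * 'I_D | (x.1 < x.2)%N]|.
  by rewrite sumr_const card_tuple card_prod card_bool [(#|lab| * 2)%N]mulnC -[RHS]mulr_natl natrX.
apply: ler_sum => w _; rewrite /ev; case: ifP => [uw|_]; last first.
  by rewrite /pr cards0 mul0r exprn_ge0 // invr_ge0.
have hp e : #|good e|%:R <= (2^-1) * #|X|%:R :> R.
  by rewrite mulrC ler_pdivlMr // mulrC -natrM ler_nat.
apply: le_trans (@pr_edge_graph lab R (fun=> 2^-1) X good X0 hp _) _.
rewrite /edge_weight prodr_const card_in_imset; last first.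
  move=> [i1 j1] [i2 j2]; rewrite !inE /= => _ _ [e1 e2].
  have inj i j : (tnth w i).1 = (tnth w j).1 -> i = j.
    pose x := tnth w i; rewrite !(tnth_nth x) -!(nth_map x x.1 fst) ?size_tuple //.
    by move=> /eqP; rewrite nth_uniq ?size_map ?size_tuple // => /eqP /val_inj.
  by rewrite (inj j1 j2) // (inj i1 i2) // e1.
by [].
Qed.

Lemma card_pairs : (2 * #|[set x : 'I_D * 'I_D | (x.1 < x.2)%N]| + D = D * D)%N.
Proof.
have := @card_ltn_pairs D (fun _ _ => true) (fun _ _ => erefl).
have -> : [set x : 'I_D * 'I_D | (x.1 < x.2)%N && true] = [set x : 'I_D * 'I_D | (x.1 < x.2)%N].
  by apply/setP => x; rewrite !inE andbT.
by rewrite !cardsT card_prod !card_ord.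
Qed.

Lemma depth_long_path (G : {set lab * bool * lab}) (t : tree lab) :
  wf (mem G) t -> (forall b e, (b, e, b) \notin G) -> (D < depth t)%N -> long_path G.
Proof.
move=> wfG irrG; have [w wt <- Dw] := depth_path t.
have := Dw; case ew : {1}w => [//|d w'] _.
have uw := uniq_path_labels d wfG irrG wt.
have sw : size (take D w) == D by rewrite size_takel // ltnW.
apply/existsP; exists (Tuple sw); apply/andP; split.
  by rewrite /= map_take take_uniq.
apply/subsetP => _ /imsetP[[i j] ij ->]; move: ij; rewrite inE /= => ij.
rewrite !(tnth_nth d) /= !nth_take //; apply: (path_edge d wfG wt) => //.
exact: ltn_trans (ltn_ord j) Dw.
Qed.

End LongPaths.

Lemma has_groupsS (lab : finType) (Dq Kz D x0 : nat) (R : realFieldType) (p : bool -> R) N delta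
    (G G' : {set lab * bool * lab}) : G \subset G' ->
  @has_groups lab Dq Kz D x0 R p N delta G -> @has_groups lab Dq Kz D x0 R p N delta G'.
Proof.
move=> GG /existsP[x /existsP[g /and3P[h1 h2 /forallP h3]]].
apply/existsP; exists x; apply/existsP; exists g; rewrite h1 h2 /=.
by apply/forallP => r; apply: subset_trans (h3 r) GG.
Qed.

Section Numerics.
Variables (R : realType) (gam : R) (U V L x0 : nat).
Hypotheses (gam0 : 0 < gam) (U0 : (0 < U)%N) (hV : 64 <= gam * V%:R).

(** The positions and exceptions of a group take only O(ell log ell) bits, far below half of
    [gam * ell ^ 2]. *)
Lemma group_weight_small : exists e0, forall ell j : nat, (e0 <= ell)%N -> (j < L)%N -> forall Kz : nat,
  (Kz <= 4 * ell * U ^ j)%N ->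
  2 `^ (- (gam * ell%:R ^+ 2)) * ((3 + Kz)%:R ^+ (4 * ell) * ((4 * ell) ^ (x0 * (4 * ell)))%:R)
   <= 2 `^ (- (gam / 2 * ell%:R ^+ 2)) :> R.
Proof.
have g8 : 0 < gam / 8 by rewrite divr_gt0.
have [e0 he0] := poly_le_exp2 ((3 + 4 * U ^ L) * 4 ^ x0)%:R x0.+1 g8.
exists e0.+1 => ell j hell jL Kz hK.
have ell0 : (0 < ell)%N by apply: leq_trans hell.
have k1 : ((3 + Kz) * (4 * ell) ^ x0 <= (3 + 4 * U ^ L) * 4 ^ x0 * ell ^ x0.+1)%N.
  have kk : (3 + Kz <= ell * (3 + 4 * U ^ L))%N.
    apply: leq_trans (leq_add (leqnn 3) hK) _.
    have : (U ^ j <= U ^ L)%N by rewrite leq_pexp2l // ltnW.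
    by move: ell0; move: (U ^ j)%N (U ^ L)%N => a b; clear; nia.
  apply: leq_trans (leq_mul kk (leqnn _)) _; apply: eq_leq.
  by rewrite expnMn expnS; ring.
have k2 : (3 + Kz)%:R * (4 * ell)%:R ^+ x0 <= 2 `^ (gam / 8 * ell%:R) :> R.
  apply: le_trans (he0 ell (ltnW hell)); rewrite -!natrX -!natrM ler_nat.
  exact: k1.
have -> : (3 + Kz)%:R ^+ (4 * ell) * ((4 * ell) ^ (x0 * (4 * ell)))%:R
    = ((3 + Kz)%:R * (4 * ell)%:R ^+ x0) ^+ (4 * ell) :> R by rewrite exprMn natrX -exprM.
apply: (@le_trans _ _ (2 `^ (- (gam * ell%:R ^+ 2)) * (2 `^ (gam / 8 * ell%:R)) ^+ (4 * ell))).
  rewrite ler_wpM2l ?powR_ge0 //; apply: lerXn2r; rewrite ?nnegrE ?powR_ge0 ?mulr_ge0 ?exprn_ge0 //.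
rewrite -[X in _ * X]powR_mulrn ?powR_ge0 // -powRrM -exp2D ler_exp2 natrM expr2; lra.
Qed.

(** The context takes about [4 * ell^2 * (1 + U^j)] bits, while the groups earn
    [gam / 2 * V * U^j * ell^2], which is at least [32 * U^j * ell^2] by the choice of 64. *)
Lemma level_weight_small : exists e0, forall ell j : nat, (e0 <= ell)%N -> (j < L)%N ->
  (2 * 2 ^ ell + 1)%:R ^+ (4 * ell) * (2 ^ ell)%:R ^+ (4 * ell * U ^ j) *
  (2 `^ (- (gam * ell%:R ^+ 2)) *
    ((3 + 4 * ell * U ^ j)%:R ^+ (4 * ell) * ((4 * ell) ^ (x0 * (4 * ell)))%:R)) ^+ (V * U ^ j)
   <= 2 `^ (- ell%:R) :> R.
Proof.
have [e0 he0] := group_weight_small; exists e0.+1 => ell j hell jL.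
have ell0 : (0 < ell)%N by apply: leq_trans hell.
have k1 := he0 ell j (ltnW hell) jL _ (leqnn _).
set Y := 2 `^ _ * _ in k1 *.
have Y0 : 0 <= Y by rewrite mulr_ge0 ?powR_ge0 // mulr_ge0 // exprn_ge0.
have k2 : Y ^+ (V * U ^ j) <= 2 `^ (- (gam / 2 * ell%:R ^+ 2) * (V * U ^ j)%:R).
  by rewrite powRrM powR_mulrn ?powR_ge0 //; apply: lerXn2r; rewrite ?nnegrE ?powR_ge0.
have k3 : (2 * 2 ^ ell + 1)%:R ^+ (4 * ell) <= 2 `^ ((ell + 2) * (4 * ell))%:R :> R.
  rewrite exp2_nat [leRHS]exprM; apply: lerXn2r; rewrite ?nnegrE ?exprn_ge0 // -natrX ler_nat expnD.
  have := expn_gt0 2 ell; lia.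
have k4 : (2 ^ ell)%:R ^+ (4 * ell * U ^ j) = 2 `^ (ell * (4 * ell * U ^ j))%:R :> R.
  by rewrite exp2_nat natrX -exprM.
apply: le_trans (_ : 2 `^ ((ell + 2) * (4 * ell))%:R * 2 `^ (ell * (4 * ell * U ^ j))%:R *
   2 `^ (- (gam / 2 * ell%:R ^+ 2) * (V * U ^ j)%:R) <= _).
  rewrite k4; apply: ler_pM; rewrite ?mulr_ge0 ?exprn_ge0 ?powR_ge0 //.
  by rewrite ler_wpM2r ?powR_ge0.
rewrite -!exp2D ler_exp2 !natrM !natrD.
have u1 : 1 <= (U ^ j)%:R :> R by rewrite ler1n expn_gt0 U0.
have e1 : 1 <= ell%:R :> R by rewrite ler1n.
move: u1 e1 hV; set u := (U ^ j)%:R; set e := ell%:R; set v := V%:R => u1 e1 hv.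
have e2 : e <= e ^+ 2 by rewrite expr2 ler_peMl //; lra.
have e3 : e ^+ 2 * u <= e ^+ 2 * u * (gam * v / 64).
  by rewrite ler_peMr ?mulr_ge0 ?exprn_ge0 //; lra.
have e4 : e ^+ 2 <= e ^+ 2 * u by rewrite ler_peMr ?exprn_ge0 //; lra.
rewrite !expr2 in e2 e3 e4 *; lra.
Qed.

End Numerics.

(** About [8 * ell^2] pairs on a path of length [4 * ell], each of probability at most 1/2, beat the
    roughly [4 * ell^2] bits naming the path. This is the origin of the depth bound. *)
Lemma long_weight_small (R : realType) : exists e0, forall ell K : nat, (e0 <= ell)%N ->
  (2 * K + 4 * ell = (4 * ell) * (4 * ell))%N ->
  (2 * 2 ^ ell)%:R ^+ (4 * ell) * (2^-1) ^+ K <= 2 `^ (- ell%:R) :> R.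
Proof.
exists 3%N => ell K hell hK.
have -> : (2 * 2 ^ ell)%:R ^+ (4 * ell) * (2^-1) ^+ K = 2 `^ ((ell.+1 * (4 * ell))%:R - K%:R) :> R.
  by rewrite exp2D powRN !exp2_nat exprVn -expnS natrX -exprM.
rewrite ler_exp2.
have : (ell.+1 * (4 * ell) + ell <= K)%N by nia.
by rewrite -(ler_nat R) natrD; lra.
Qed.

(** One colouring must serve all colour classes [i]. For each class the bad events are a long path,
    a single cheap group without context, and a family of cheap groups for some [j]; all have
    probability exponentially small in [ell]. *)
Lemma exists_edge_coloring (R : realType) (psi g : R) (E : nat) (I X : finType)
    (good : I -> bool -> pred X) (pi : I -> bool -> R) :
  0 < psi -> 0 < g -> (1 < E)%N -> (0 < #|X|)%N ->
  (forall i e, 0 < pi i e) -> (forall i, pi i true + pi i false <= 1) ->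
  (forall i e, #|good i e|%:R <= pcost (pi i) psi e * #|X|%:R) ->
  (forall i e, 2 * #|good i e| <= #|X|)%N ->
  exists e0 : nat, forall (ell : nat) (lab : finType), (e0 <= ell)%N -> #|lab| = (2 ^ ell)%N ->
  exists c : {ffun lab * bool * lab -> X}, forall i (G : {set lab * bool * lab}),
    G \subset edge_graph (good i) c -> (forall b e, (b, e, b) \notin G) ->
    forall t : tree lab, wf (mem G) t -> (depth t <= 4 * ell)%N /\
      (balanced E t -> forall N2, (nleaves t)%:R = 2 `^ N2 -> psi * N2 < (1 + g) * ell%:R).
Proof.
move=> psi0 g0 E1 X0 pi0 pi1 hp hg.
have [gam [U [V [L [x0 [ell0 [gam0 U0 hV main]]]]]]] := tree_groups psi0 g0 E1.
have [e1 he1] := group_weight_small L.+1 x0 gam0 U0.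
have [e2 he2] := level_weight_small L x0 gam0 U0 hV.
have [e3 he3] := long_weight_small R.
have [e4 he4] := @poly_le_exp2 R 1 (4 * (#|I| * L.+1)%:R) 0 ltr01.
have g2 : 0 < gam / 2 by rewrite divr_gt0.
have [e5 he5] := @poly_le_exp2 R (gam / 2) (4 * #|I|%:R) 0 g2.
exists (maxn 1 (maxn ell0 (maxn e1 (maxn e2 (maxn e3 (maxn e4 e5))))))%N.
move=> ell lab; rewrite !geq_max => /and5P[l1 l0 hl1 hl2 /and3P[hl3 hl4 hl5]] clab.
have lab0 : (0 < #|lab|)%N by rewrite clab expn_gt0.
pose Om : finType := {ffun lab * bool * lab -> X}.
pose delta : R := 2 `^ (- (gam * ell%:R ^+ 2)).
have d0 : 0 <= delta by apply: powR_ge0.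
pose A1 i : {set Om} := [set c | long_path (4 * ell) (edge_graph (good i) c)].
pose A2 i : {set Om} := [set c | @has_groups lab 0 0 (4 * ell) x0 R (pcost (pi i) psi) 1 delta (edge_graph (good i) c)].
pose A3 i (j : 'I_L) : {set Om} := [set c | @has_groups lab (4 * ell) (4 * ell * U ^ j) (4 * ell) x0 R (pcost (pi i) psi)
     (V * U ^ j) delta (edge_graph (good i) c)].
have b1 i : pr R (A1 i) <= 2 `^ (- ell%:R).
  apply: le_trans (@pr_long_path R lab X (good i) (4 * ell) X0 (hg i)) _; rewrite clab.
  by apply: he3 => //; apply: card_pairs.
have b2 i : pr R (A2 i) <= 2 `^ (- (gam / 2 * ell%:R)).
  apply: le_trans (@pr_has_groups lab 0 0 (4 * ell) x0 R (pcost (pi i) psi) X (good i) X0 lab0 (hp i) 1 delta d0) _.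
  rewrite !expr0 !mul1r expr1; apply: le_trans (he1 ell 0%N hl1 (ltn0Sn L) 0%N (leq0n _)) _.
  rewrite ler_exp2 lerN2 ler_wpM2l ?(ltW g2) // expr2 -[X in X <= _]mul1r ler_wpM2r // ler1n.
  by [].
have b3 i j : pr R (A3 i j) <= 2 `^ (- ell%:R).
  apply: le_trans (@pr_has_groups lab (4 * ell) (4 * ell * U ^ j) (4 * ell) x0 R (pcost (pi i) psi) X (good i) X0 lab0 (hp i) (V * U ^ j) delta d0) _.
  by rewrite clab; apply: he2.
pose Bad : {set Om} := \bigcup_i (A1 i :|: (A2 i :|: \bigcup_j A3 i j)).
have bad : pr R Bad < 1.
  apply: (@le_lt_trans _ _ (\sum_(i : I) (2 `^ (- ell%:R) + (2 `^ (- (gam / 2 * ell%:R)) + L%:R * 2 `^ (- ell%:R))))).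
    apply: le_trans (pr_bigcup _ _) _; apply: ler_sum => i _.
    apply: le_trans (prU _ _ _) _; apply: lerD => //.
    apply: le_trans (prU _ _ _) _; apply: lerD => //.
    apply: le_trans (pr_bigcup _ _) _.
    have -> : L%:R * 2 `^ (- ell%:R) = \sum_(j < L) 2 `^ (- ell%:R) :> R.
      by rewrite sumr_const card_ord -[RHS]mulr_natl.
    by apply: ler_sum => j _.
  rewrite sumr_const -[ltLHS]mulr_natl.
  have q1 := he4 ell hl4; have q2 := he5 ell hl5; rewrite !expr0 !mulr1 in q1 q2.
  rewrite mul1r natrM in q1; rewrite !powRN.
  have x1 : 0 < 2 `^ ell%:R :> R by apply: exp2_gt0.
  have x2 : 0 < 2 `^ (gam / 2 * ell%:R) :> R by apply: exp2_gt0.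
  move: q1 q2 x1 x2; set a := 2 `^ ell%:R; set b := 2 `^ _ => q1 q2 x1 x2.
  have r1 : #|I|%:R * L.+1%:R / a <= 4^-1 :> R by rewrite ler_pdivrMr //; lra.
  have r2 : #|I|%:R / b <= 4^-1 :> R by rewrite ler_pdivrMr //; lra.
  rewrite -natr1 in r1.
  have -> : #|I|%:R * (a^-1 + (b^-1 + L%:R * a^-1)) = #|I|%:R * (L%:R + 1) / a + #|I|%:R / b by ring.
  lra.
have [c cB] : exists c, c \notin Bad.
  by apply: (pr_lt1_avoid _ bad); rewrite card_ffun expn_gt0 X0.
exists c => i G GS irrG t wt; have := cB; rewrite /Bad => cN.
have {}cN : c \notin A1 i :|: (A2 i :|: \bigcup_j A3 i j).
  by apply: contra cN => h; apply/bigcupP; exists i.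
rewrite !in_setU !negb_or in cN; case/and3P: cN => n1 n2 n3.
have dt : (depth t <= 4 * ell)%N.
  rewrite leqNgt; apply/negP => dt; move: n1; rewrite inE => /negP; apply.
  have /existsP[w /andP[uw sw]] := depth_long_path wt irrG dt.
  by apply/existsP; exists w; rewrite uw (subset_trans sw).
split=> // bal N2 nE; rewrite ltNge; apply/negP => hN.
have /card_gt0P[a _] : (0 < #|{: lab}|)%N by rewrite lab0.
have [h|[j jL h]] := main ell lab (a, true) t (pi i) N2 G l0 (pi0 i) (pi1 i) wt dt bal irrG clab nE hN.
  by move: n2; rewrite inE => /negP; apply; apply: has_groupsS h.
move: n3 => /negP; apply; apply/bigcupP; exists (Ordinal jL) => //; rewrite inE.
by apply: has_groupsS h.
Qed.

(** * The step-up colouring of the triples of 0/1 vectors *)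

Lemma colorable_transfer (V : finType) (n q t : nat) (col : {set V} -> 'I_q) :
  (forall S : {set V}, #|S| = n -> (t <= #|col @: [set e : {set V} | (e \subset S) && (#|e| == 3)]|)%N) ->
  colorable n q t #|V|.
Proof.
move=> h; apply/existsP; exists [ffun e : {set 'I_#|V|} => col (enum_val @: e)].
apply/forallP => S; apply/implyP => /eqP cS.
have inj : injective (@enum_val V predT) := enum_val_inj.
have cS' : #|[set enum_val x | x in S]| = n by rewrite card_imset.
apply: leq_trans (h _ cS') _; apply/subset_leq_card/subsetP => _ /imsetP[e he ->].
move: he; rewrite inE => /andP[eS /eqP ce]; apply/imsetP.
have eE : enum_val @: [set enum_rank x | x in e] = e.
  rewrite -imset_comp (eq_imset _ (g := id)) ?imset_id // => x /=; exact: enum_rankK.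
exists [set enum_rank x | x in e]; last by rewrite ffunE eE.
rewrite inE card_imset ?ce ?eqxx ?andbT; last exact: enum_rank_inj.
apply/subsetP => _ /imsetP[x xe ->]; have /imsetP[y yS ->] := subsetP eS _ xe.
by rewrite enum_valK.
Qed.

Section StepUp.
Variable m : nat.
Local Notation V := {ffun 'I_m -> bool}.

Definition topdiff (x y : V) (a : 'I_m) : bool :=
  (x a != y a) && [forall i : 'I_m, (a < i)%N ==> (x i == y i)].

Lemma topdiffP (x y : V) (a : 'I_m) : reflect (x a <> y a /\ forall i : 'I_m, (a < i)%N -> x i = y i) (topdiff x y a).
Proof.
apply: (iffP andP) => -[h1 h2]; split; try exact/eqP.
  by move=> i ai; apply/eqP; have /implyP := forallP h2 i; apply.
by apply/forallP => i; apply/implyP => ai; apply/eqP/h2.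
Qed.

Lemma topdiffC x y a : topdiff x y a = topdiff y x a.
Proof.
by rewrite /topdiff eq_sym; congr (_ && _); apply: eq_forallb => i; rewrite [x i == _]eq_sym.
Qed.

Lemma topdiff_uniq x y a a' : topdiff x y a -> topdiff x y a' -> a = a'.
Proof.
move=> /topdiffP[h1 h2] /topdiffP[h3 h4]; apply: val_inj => /=.
by case: (ltngtP a a') => // h; [case: h3; apply: h2 | case: h1; apply: h4].
Qed.

(* A three element set is split at level [p.1.1] into a pair, with bit [p.1.2], that is split at level [p.2], and a single point. *)
Definition shape (S : {set V}) (p : 'I_m * bool * 'I_m) : bool :=
  [exists x : V, exists y : V, exists z : V,
    [&& S == [set x; y; z], topdiff x y p.2, topdiff x z p.1.1, (p.2 < p.1.1)%N & x p.1.1 == p.1.2]].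

(** The upper level is the largest coordinate at which the three vectors are not all equal. The
    majority bit there determines the pair, and the pair its own level. *)
Lemma shape_uniq S p p' : shape S p -> shape S p' -> p = p'.
Proof.
have top (x y z x' y' z' : V) (a b a' b' : 'I_m) : [set x; y; z] = [set x'; y'; z'] ->
    topdiff x y a -> topdiff x z b -> (a < b)%N -> topdiff x' z' b' -> (b' <= b)%N.
  move=> e /topdiffP[xy1 xy2] /topdiffP[xz1 xz2] ab /topdiffP[h1 h2]; rewrite leqNgt; apply/negP => bb.
  have c (v : V) : v \in [set x; y; z] -> v b' = x b'.
    rewrite !inE => /orP[/orP[]|] /eqP -> //; first by rewrite xy2 // (ltn_trans ab).
    by rewrite xz2.
  by apply: h1; rewrite !c // e !inE eqxx ?orbT.
move=> /existsP[x /existsP[y /existsP[z /and5P[/eqP eS xy xz ab /eqP xb]]]].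
move=> /existsP[x' /existsP[y' /existsP[z' /and5P[/eqP eS' xy' xz' ab' /eqP xb']]]].
have e : [set x; y; z] = [set x'; y'; z'] by rewrite -eS.
case: p p' xy xz ab xb xy' xz' ab' xb' => [[b dr] a] [[b' dr'] a'] /= xy xz ab xb xy' xz' ab' xb'.
have bb : b = b'.
  apply: val_inj; apply/eqP; rewrite eqn_leq.
  rewrite (top _ _ _ _ _ _ _ _ a' b (esym e) xy' xz' ab' xz) ?(top _ _ _ _ _ _ _ _ a' b' e xy xz ab xz') //.
subst b'.
have [h1 h2] := topdiffP _ _ _ xy; have [h3 h4] := topdiffP _ _ _ xz.
have [h1' h2'] := topdiffP _ _ _ xy'; have [h3' h4'] := topdiffP _ _ _ xz'.
have yb : y b = x b by rewrite h2.
have yb' : y' b = x' b by rewrite h2'.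
have inS v : v \in [set x'; y'; z'] -> v b = x b -> v = x \/ v = y.
  rewrite -e !inE => /orP[/orP[]|] /eqP ->; auto => zb; by case: h3.
have inZ v : v \in [set x'; y'; z'] -> v b <> x b -> v = z.
  by rewrite -e !inE => /orP[/orP[]|] /eqP -> //; rewrite ?yb.
have x'S : x' \in [set x'; y'; z'] by rewrite !inE eqxx.
have y'S : y' \in [set x'; y'; z'] by rewrite !inE eqxx orbT.
case: (eqVneq (x' b) (x b)) => [xx|/eqP xx]; last first.
  by case: h1'; rewrite (inZ _ x'S xx) (inZ _ y'S) ?yb'.
have -> : dr = dr' by rewrite -xb -xb' xx.
suff -> : a = a' by [].
have yy : y' b = x b by rewrite yb'.
case: (inS _ x'S xx) => ex; case: (inS _ y'S yy) => ey; rewrite ex ey in xy'.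
- by case/topdiffP: xy'.
- exact: topdiff_uniq xy xy'.
- by rewrite topdiffC in xy'; apply: topdiff_uniq xy xy'.
- by case/topdiffP: xy'.
Qed.

(** The binary trie of the vectors read from the top coordinate, with a node only where the current
    set splits. A vector on the other side of the node completes a pair to a triple. *)
Lemma set_tree (G : {set 'I_m * bool * 'I_m}) (A : {set V}) : (0 < #|A|)%N ->
  (forall x y z a b, x \in A -> y \in A -> z \in A -> topdiff x y a -> topdiff x z b ->
     (a < b)%N -> (b, x b, a) \in G) ->
  exists2 t : tree 'I_m, nleaves t = #|A| & wf (mem G) t /\
    forall a, a \in labels t -> exists x y, [/\ x \in A, y \in A & topdiff x y a].
Proof.
move: {2}#|A| (leqnn #|A|) => k; elim: k A => [|k ih] A; first by rewrite leqn0 => /eqP ->.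
move=> cA A0 hG; case: (leqP #|A| 1) => [A1|A1].
  by exists (Leaf _) => //; rewrite /nleaves /=; apply/eqP; rewrite eqn_leq A0 A1.
pose nc i := [exists x in A, exists y in A, x i != y i].
have [x1 [y1 [x1A y1A xy]]] : exists x y : V, [/\ x \in A, y \in A & x != y].
  have /card_gt0P[x xA] := A0; have := cardsD1 x A; rewrite xA => e.
  have /card_gt0P[y] : (0 < #|A :\ x|)%N by move: A1; rewrite e; case: #|_|.
  by rewrite !inE => /andP[yx yA]; exists x, y; rewrite eq_sym.
have [i0 hi0] : exists i, nc i.
  have [/existsP[i hi]|/existsPn h] := boolP [exists i, x1 i != y1 i].
    by exists i; apply/exists_inP; exists x1 => //; apply/exists_inP; exists y1.
  by case/eqP: xy; apply/ffunP => i; have := h i; rewrite negbK => /eqP.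
pose b := [arg max_(i > i0 | nc i) val i].
have [hb bmax] : nc b /\ forall i, nc i -> (i <= b)%N by rewrite /b; case: arg_maxnP.
have cst (i : 'I_m) x y : x \in A -> y \in A -> (b < i)%N -> x i = y i.
  move=> xA yA bi; apply/eqP; apply: contraTT bi => xyi; rewrite -leqNgt; apply: bmax.
  by apply/exists_inP; exists x => //; apply/exists_inP; exists y.
pose S e := [set x in A | x b == e].
have S0 e : exists x, x \in S e.
  case/exists_inP: hb => x xA /exists_inP[y yA xyb].
  case: (eqVneq (x b) e) => [h|h]; first by exists x; rewrite inE xA h eqxx.
  by exists y; rewrite inE yA; move: xyb h; case: (x b); case: (y b); case: (e).
have SA e x : x \in S e -> x \in A by rewrite inE => /andP[].
have SU : (#|S false| + #|S true| = #|A|)%N.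
  have AE : A = S false :|: S true by apply/setP => x; rewrite !inE -andb_orr; case: (x b); rewrite andbT.
  have dS : S false :&: S true = set0.
    by apply/setP => x; rewrite !inE; case: (x \in A); case: (x b).
  by rewrite -cardsUI dS cards0 addn0 -AE.
have Sp e : (0 < #|S e|)%N by have [x xS] := S0 e; apply/card_gt0P; exists x.
have Sk e : (#|S e| <= k)%N.
  have := Sp true; have := Sp false; move: SU cA; case: e; lia.
have rec e := ih (S e) (Sk e) (Sp e) (fun x y z a b' hx hy hz => hG x y z a b' (SA _ _ hx) (SA _ _ hy) (SA _ _ hz)).
have [t0 n0 [w0 l0]] := rec false; have [t1 n1 [w1 l1]] := rec true.
have tdb e x z : x \in S e -> z \in S (~~ e) -> topdiff x z b.
  rewrite !inE => /andP[xA /eqP xb] /andP[zA /eqP zb]; apply/topdiffP; split.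
    by rewrite xb zb; case: (e).
  by move=> i bi; apply: cst.
have edge e a x y : x \in S e -> y \in S e -> topdiff x y a -> (b, e, a) \in G.
  move=> xS yS xya; have [z zS] := S0 (~~ e).
  have xb : x b = e by move: xS; rewrite inE => /andP[_ /eqP].
  have yb : y b = e by move: yS; rewrite inE => /andP[_ /eqP].
  have ab : (a < b)%N.
    have [h1 _] := topdiffP _ _ _ xya; rewrite ltnNge; apply/negP; rewrite leq_eqVlt => /orP[/eqP /val_inj ba|ba].
      by apply: h1; rewrite -ba xb yb.
    by apply: h1; apply: cst => //; apply: SA; [exact: xS|exact: yS].
  by rewrite -{1}xb; apply: (hG x y z) => //; [exact: SA xS|exact: SA yS|exact: SA zS|exact: tdb xS zS].
exists (Node b t0 t1); first by rewrite nleaves_node n0 n1.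
split=> /=.
  rewrite w0 w1 !andbT; apply/andP; split; apply/allP => a.
    by move=> /l0[x [y [xS yS xya]]]; apply: (edge false a x y).
  by move=> /l1[x [y [xS yS xya]]]; apply: (edge true a x y).
move=> a; rewrite inE mem_cat => /or3P[/eqP ->|/l0[x [y [xS yS xya]]]|/l1[x [y [xS yS xya]]]].
- have [x xS] := S0 false; have [z zS] := S0 true; exists x, z; split; [exact: SA xS|exact: SA zS|].
  exact: (tdb false).
- by exists x, y; split=> //; [exact: SA xS|exact: SA yS].
- by exists x, y; split=> //; [exact: SA xS|exact: SA yS].
Qed.

Variables (q : nat) (X : finType) (cm : bool -> X -> 'I_q) (v0 : 'I_q).

Definition stepup_color (c : {ffun 'I_m * bool * 'I_m -> X}) (S : {set V}) : 'I_q :=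
  if [pick p | shape S p] is Some p then cm p.1.2 (c p) else v0.

Lemma stepup_colorE c S p : shape S p -> stepup_color c S = cm p.1.2 (c p).
Proof.
move=> h; rewrite /stepup_color; case: pickP => [p' /(shape_uniq h) -> //|/(_ p)].
by rewrite h.
Qed.

(** The clause [e.2 < e.1.1] makes the graph irreflexive, as the results on trees require. *)
Lemma stepup_tree (c : {ffun 'I_m * bool * 'I_m -> X}) (A : {set V}) (C : {set 'I_q}) :
  (0 < #|A|)%N ->
  (forall e : {set V}, e \subset A -> #|e| = 3 -> stepup_color c e \in C) ->
  exists2 t : tree 'I_m, nleaves t = #|A| &
    wf (mem [set e : 'I_m * bool * 'I_m | (cm e.1.2 (c e) \in C) && (e.2 < e.1.1)%N]) t.
Proof.
move=> A0 hC.
have [|t nt [wt _]] := @set_tree [set e : 'I_m * bool * 'I_m | (cm e.1.2 (c e) \in C) && (e.2 < e.1.1)%N] A A0; last by exists t.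
move=> x y z a b xA yA zA xy xz ab; rewrite inE /= ab andbT.
have sh : shape [set x; y; z] (b, x b, a).
  by apply/existsP; exists x; apply/existsP; exists y; apply/existsP; exists z; rewrite !eqxx xy xz ab.
have [h1 h2] := topdiffP _ _ _ xy; have [h3 _] := topdiffP _ _ _ xz.
rewrite -(stepup_colorE c sh); apply: hC.
  by apply/subsetP => v; rewrite !inE => /orP[/orP[]|] /eqP ->.
have e1 : x != y by apply/eqP => e; rewrite e in h1.
have e2 : x != z by apply/eqP => e; rewrite e in h3.
have e3 : y != z by apply/eqP => e; apply: h3; rewrite -e h2.
by rewrite -setUA cardsU1 !inE negb_or e1 e2 cards2 e3.
Qed.

End StepUp.

(** * The biased colour law and its slack *)

Lemma bernoulli_powR (R : realType) (p y : R) : 1 <= p -> 0 <= y -> 1 + p * (y - 1) <= y `^ p.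
Proof.
rewrite le_eqVlt => /orP[/eqP <-|p1] y0; first by rewrite powRr1 //; lra.
have p0 : 0 < p by lra.
have q0 : 0 < p / (p - 1) by rewrite divr_gt0 // subr_gt0.
have pq : p^-1 + (p / (p - 1))^-1 = 1.
  by rewrite invf_div; field; rewrite !gt_eqF // subr_gt0.
(* Young's inequality for [y] and 1 with the exponents [p] and [p / (p - 1)]. *)
have := conjugate_powR y0 ler01 p0 q0 pq; rewrite mulr1 powR1 mul1r invf_div => h.
have := ler_wpM2l (ltW p0) h; rewrite mulrDr [p * (_ / p)]mulrC divfK ?gt_eqF //.
by rewrite [p * ((p - 1) / p)]mulrC divfK ?gt_eqF //; lra.
Qed.

(* The weights [(1 +- e/alpha)/2] beat the colour densities [2^-alpha (1 +- e)] with room to spare. *)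
Lemma biased_weights (R : realType) (alpha e0 : R) : 2 <= alpha -> 0 < e0 ->
  exists2 psi, alpha < psi & forall e : R, e0 <= `|e| <= 2^-1 ->
    let pi := (1 + e / alpha) / 2 in
    0 < pi /\ 2 `^ (- alpha) * (1 + e) <= 2 `^ (psi * log2 pi).
Proof.
move=> a2 e00; have a0 : 0 < alpha by lra.
(* The square of [1 + e / 2] exceeds [1 + e] by [e^2 / 4]. As [pi] is at least 1/4, raising the
   exponent by [mu] costs at most a factor [1 + e0^2 / 8], which this excess covers. *)
pose mu := log2 (1 + e0 ^+ 2 / 8) / 2.
have l2 : 0 < ln 2 :> R by rewrite ln_gt0 // ltr1n.
have e2 : 0 < e0 ^+ 2 by rewrite exprn_gt0.
have mu0 : 0 < mu by rewrite /mu /log2 !divr_gt0 // ln_gt0; lra.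
exists (alpha + mu); first by lra.
move=> e /andP[he1 he2] pi.
have eb : - 2^-1 <= e <= 2^-1 by rewrite -ler_norml.
have ee : e0 ^+ 2 <= e ^+ 2.
  by rewrite -[leRHS]real_normK ?num_real //; apply: lerXn2r; rewrite ?nnegrE // ltW.
have ea : - 4^-1 <= e / alpha <= 4^-1.
  by apply/andP; split; [rewrite ler_pdivlMr // | rewrite ler_pdivrMr //]; lra.
have pi4 : 4^-1 <= pi by rewrite /pi; lra.
have pi0 : 0 < pi by lra.
split=> //.
have lpi : 2 `^ (log2 pi) = pi by apply: exp2_log2.
rewrite mulrDl exp2D.
have k1 : 2 `^ (alpha * log2 pi) = 2 `^ (- alpha) * (1 + e / alpha) `^ alpha.
  rewrite mulrC powRrM lpi /pi powRM ?invr_ge0 //; last by lra.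
  by rewrite mulrC -(powR_inv1 (ler0n R 2)) -powRrM mulN1r.
(* Bernoulli's inequality with exponent [alpha / 2]; here [alpha] has to be at least 2. *)
have k2 : (1 + e / 2) ^+ 2 <= (1 + e / alpha) `^ alpha.
  have -> : (1 + e / alpha) `^ alpha = ((1 + e / alpha) `^ (alpha / 2)) ^+ 2.
    by rewrite -powR_mulrn ?powR_ge0 // -powRrM divfK // pnatr_eq0.
  apply: lerXn2r; rewrite ?nnegrE ?powR_ge0 //; first by lra.
  have al : 1 <= alpha / 2 by lra.
  have b0 : 0 <= 1 + e / alpha by lra.
  apply: le_trans (bernoulli_powR al b0).
  rewrite le_eqVlt; apply/orP; left; apply/eqP; field; by rewrite gt_eqF.
have k3 : (1 + e0 ^+ 2 / 8)^-1 <= 2 `^ (mu * log2 pi).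
  have -> : (1 + e0 ^+ 2 / 8)^-1 = 2 `^ (- (mu * 2)).
    by rewrite powRN /mu divfK ?pnatr_eq0 // exp2_log2 //; lra.
  have : -2 <= log2 pi.
    rewrite -ler_exp2 lpi; apply: le_trans pi4.
    by rewrite powRN (exp2_nat R 2) (_ : 2 ^+ 2 = 4 :> R) // expr2; lra.
  by move=> h; rewrite ler_exp2; have := ler_wpM2l (ltW mu0) h; lra.
rewrite k1 -mulrA ler_wpM2l ?powR_ge0 //.
apply: (@le_trans _ _ ((1 + e / 2) ^+ 2 * (1 + e0 ^+ 2 / 8)^-1)).
  rewrite ler_pdivlMr; last by lra.
  rewrite expr2 in ee *; rewrite expr2 in e2.
  have : (1 + e) * (e0 * e0 / 8) <= (1 + e) * (e * e / 8) by rewrite ler_wpM2l; lra.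
  have : e * (e * e) <= 2^-1 * (e * e) by rewrite ler_wpM2r; lra.
  rewrite expr2; lra.
have p1 : 0 <= (1 + e / 2) ^+ 2 by rewrite sqr_ge0.
have p2 : 0 <= (1 + e0 ^+ 2 / 8)^-1 by rewrite invr_ge0 addr_ge0 // divr_ge0 // ltW.
exact: ler_pM p1 p2 k2 k3.
Qed.

Section BiasedColors.
Variables (q' s : nat).
Local Notation q := q'.+1.
Hypotheses (s0 : (0 < s)%N) (hs : (4 * s <= q)%N).

(** Colour 0 gets probability 1/(2q) on one side and 3/(2q) on the other, instead of 1/q; the other
    colours share the rest evenly. *)
Definition bias (e : bool) : nat := if e then 1 else 3.
Definition biased_color (e : bool) (v : 'I_q' * 'I_(2 * q)) : 'I_q :=
  if (v.2 < bias e)%N then ord0 else lift ord0 v.1.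

Lemma card_biased (C : {set 'I_q}) e : #|C| = s ->
  #|[pred v | biased_color e v \in C]| =
  (if ord0 \in C then q' * bias e + s.-1 * (2 * q - bias e) else s * (2 * q - bias e))%N.
Proof.
move=> cC; set k := bias e.
have k3 : (k <= 2 * q)%N by rewrite /k /bias; case: (e); move: s0 hs; lia.
have cC' : (s = (ord0 \in C) + #|[set i : 'I_q' | lift ord0 i \in C]|)%N.
  rewrite -cC -sum1_card big_mkcond big_ord_recl /= -big_mkcond sum1dep_card.
  by case: (ord0 \in C).
have cj (b1 b2 : bool) : (\sum_(j < 2 * q) (if (j < k)%N then b1 else b2) = b1 * k + b2 * (2 * q - k))%N.
  rewrite -(big_mkord predT (fun j => nat_of_bool (if (j < k)%N then b1 else b2))) (big_cat_nat (n := k)) //=.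
  congr (_ + _)%N.
    rewrite big_nat (eq_bigr (fun=> nat_of_bool b1)); last by move=> i /andP[_ ->].
    by rewrite -big_nat sum_nat_const_nat subn0 mulnC.
  rewrite big_nat (eq_bigr (fun=> nat_of_bool b2)); last by move=> i /andP[h _]; rewrite ltnNge h.
  by rewrite -big_nat sum_nat_const_nat mulnC.
have -> : #|[pred v | biased_color e v \in C]| =
    (\sum_(i < q') \sum_(j < 2 * q) (if (j < k)%N then ord0 \in C else lift ord0 i \in C))%N.
  rewrite -sum1_card pair_bigA /= big_mkcond; apply: eq_bigr => -[i j] _ /=.
  by rewrite inE /biased_color /= -/k; case: (j < k)%N => /=; case: (_ \in C).
under eq_bigr => i _ do rewrite cj.
rewrite big_split /= sum_nat_const card_ord -big_distrl /=.
have -> : (\sum_(i < q') (lift ord0 i \in C) = #|[set i : 'I_q' | lift ord0 i \in C]|)%N.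
  by rewrite -sum1dep_card [RHS]big_mkcond; apply: eq_bigr => i _; case: (_ \in C).
by move: cC'; case: (ord0 \in C) => ->; rewrite ?mul1n ?mul0n ?muln0 ?add0n ?add1n.
Qed.

(* [2 q' s] is the unbiased count; the deviation has opposite signs in the two directions. *)
Lemma biased_deviation (C : {set 'I_q}) : #|C| = s ->
  exists del : nat, [/\ (0 < del)%N, (del <= q' * s)%N &
   (#|[pred v | biased_color false v \in C]| = 2 * q' * s + del /\
    #|[pred v | biased_color true v \in C]| + del = 2 * q' * s)%N \/
   (#|[pred v | biased_color true v \in C]| = 2 * q' * s + del /\
    #|[pred v | biased_color false v \in C]| + del = 2 * q' * s)%N].
Proof.
move=> cC; rewrite !(card_biased _ cC) /bias; case: ifP => _.
  (* The deviation is [q - s] if colour 0 lies in [C] and [s] otherwise. Neither vanishes, so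
     biasing one colour serves all classes at once. *)
  exists (q - s)%N; split; [lia | nia | left]; split.
    by case: (s) s0 hs => // r _ hr; rewrite /=; nia.
  by case: (s) s0 hs => // r _ hr; rewrite /=; nia.
by exists s; split; [by [] | nia | right; split; nia].
Qed.

End BiasedColors.

Lemma set_of_card_above (T : finType) (K : {set T}) (k : nat) : (#|K| <= k)%N -> (k <= #|T|)%N ->
  exists2 C : {set T}, K \subset C & #|C| = k.
Proof.
elim: k => [|k ih]; first by rewrite leqn0 => /eqP h _; exists K.
rewrite leq_eqVlt => /orP[/eqP h _|]; first by exists K.
rewrite ltnS => Kk kT; have [C KC cC] := ih Kk (ltnW kT).
have /card_gt0P[x] : (0 < #|~: C|)%N by have := cardsC C; rewrite cC; move: kT; lia.
rewrite inE => xC; exists (x |: C); first by apply: subset_trans KC (subsetUr _ _).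
by rewrite cardsU1 xC cC.
Qed.

Lemma min_pow2_above (R : realType) (x : R) : exists ell : nat,
  x <= 2 ^+ ell /\ ((0 < ell)%N -> 2 ^+ ell < 2 * x).
Proof.
have ex : exists k : nat, x <= 2 ^+ k.
  have [k _ hk] := nat_above x; exists k; apply: le_trans hk _.
  by rewrite -natrX ler_nat ltnW // ltn_expl.
case: (ex_minnP ex) => ell h1 h2; exists ell; split=> // l0; rewrite ltNge; apply/negP => h.
have : x <= 2 ^+ ell.-1 by move: h; rewrite -{1}(prednK l0) exprS; lra.
by move=> /h2; rewrite -ltnS prednK // ltnn.
Qed.

(** * The case of q at least 4(t-1) *)

Section StepUpCase.
Variables (R : realType) (q' s : nat).
Local Notation q := q'.+1.
Hypotheses (s0 : (0 < s)%N) (hs : (4 * s <= q)%N).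
Local Notation alpha := (log2 (q%:R / s%:R : R)).

Let q0 : (0 < q')%N.
Proof. move: s0 hs; lia. Qed.

Lemma alpha_ge2 : 2 <= alpha.
Proof.
have s0' : 0 < s%:R :> R by rewrite ltr0n.
rewrite -ler_exp2 exp2_log2 ?divr_gt0 // (exp2_nat R 2) ler_pdivlMr // -natrX -natrM ler_nat.
exact: hs.
Qed.

Lemma exp2_alpha : 2 `^ (- alpha) = s%:R / q%:R.
Proof. by rewrite powRN exp2_log2 ?invf_div // divr_gt0 // ltr0n. Qed.

Definition color_class : finType := {C : {set 'I_q} | #|C| == s}.
Definition class_good (C : color_class) (e : bool) : pred ('I_q' * 'I_(2 * q)) :=
  [pred v | biased_color e v \in val C].
(** The class has density [2^-alpha] times [1 + deviation C e], the form treated by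
    [biased_weights]. *)
Definition deviation (C : color_class) (e : bool) : R :=
  (#|class_good C e|%:R - (2 * q' * s)%:R) / (2 * q' * s)%:R.

Lemma deviationP C : deviation C true + deviation C false = 0 /\
  forall e, ((2 * q' * s)%:R^-1 <= `|deviation C e| <= 2^-1) /\ (2 * #|class_good C e| <= q' * (2 * q))%N.
Proof.
have [del [d0 d1 h]] := biased_deviation s0 hs (eqP (valP C)).
have W0 : 0 < (2 * q' * s)%:R :> R by rewrite ltr0n !muln_gt0 s0 q0.
have dW : (2 * del%:R <= (2 * q' * s)%:R :> R) by rewrite -natrM ler_nat -mulnA leq_mul2l d1.
have d0' : 1 <= del%:R :> R by rewrite ler1n.
have bnd (r : R) : r = del%:R / (2 * q' * s)%:R \/ r = - (del%:R / (2 * q' * s)%:R) ->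
    (2 * q' * s)%:R^-1 <= `|r| <= 2^-1.
  move=> hr; have -> : `|r| = del%:R / (2 * q' * s)%:R.
    by case: hr => ->; rewrite ?normrN ger0_norm // divr_ge0.
  by rewrite ler_pdivlMr // mulVf ?gt_eqF // d0' ler_pdivrMr //; move: dW; lra.
have hq := leq_mul (leqnn q') hs.
have small1 (A : nat) : (A = 2 * q' * s + del)%N -> (2 * A <= q' * (2 * q))%N.
  by move: hq d1; clear; lia.
have small2 (A : nat) : (A + del = 2 * q' * s)%N -> (2 * A <= q' * (2 * q))%N.
  by move: hq d1; clear; lia.
rewrite /deviation /class_good.
case: h => -[h1 h2]; split.
- rewrite h1 -h2 !natrD; ring.
- case; split.
  + apply: bnd; right; rewrite -h2 natrD; ring.
  + first [exact: small1 h1 | exact: small2 h2].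
  + apply: bnd; left; rewrite h1 natrD; ring.
  + first [exact: small1 h1 | exact: small2 h2].
- rewrite h1 -h2 !natrD; ring.
- case; split.
  + apply: bnd; left; rewrite h1 natrD; ring.
  + first [exact: small1 h1 | exact: small2 h2].
  + apply: bnd; right; rewrite -h2 natrD; ring.
  + first [exact: small1 h1 | exact: small2 h2].
Qed.

Lemma stepup_case : exists n0 : nat, forall n, (n0 < n)%N -> exists2 N, colorable n q s.+1 N &
  2 `^ ((n%:R `^ alpha) / 4) <= N%:R :> R.
Proof.
have a2 := alpha_ge2; have a0 : 0 < alpha by lra.
have W0 : 0 < (2 * q' * s)%:R :> R by rewrite ltr0n !muln_gt0 s0 q0.
have e00 : 0 < (2 * q' * s)%:R^-1 :> R by rewrite invr_gt0.
have [psi psia hpsi] := biased_weights a2 e00.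
have psi0 : 0 < psi by lra.
(* Of the relative slack [2 * g], one half is spent on pruning and the other is the surplus required
   by [tree_groups]. *)
pose g := (psi / alpha - 1) / 2.
have g0 : 0 < g by rewrite divr_gt0 // subr_gt0 ltr_pdivlMr // mul1r.
have gE : psi / alpha = 1 + 2 * g by rewrite /g; lra.
have l2 : 0 < ln 2 :> R by rewrite ln_gt0 // ltr1n.
(* With [1 - 1/E] at least [2^-y], pruning to depth [4 * ell] costs [4 * y * ell] bits, that is
   [g * ell] after multiplication by [psi]. *)
pose y := g / (4 * psi).
have y0 : 0 < y by rewrite divr_gt0 // mulr_gt0.
have [E' E'0 hE'] := nat_above (y * ln 2)^-1.
have E'r : 0 < E'%:R :> R by rewrite ltr0n.
have hE : E'.+1%:R <= E'%:R * 2 `^ y.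
  have h1 : 1 + y * ln 2 <= 2 `^ y by rewrite /powR pnatr_eq0 /= expR_ge1Dx.
  have yl : 0 < y * ln 2 by apply: mulr_gt0.
  have h2 : 1 <= E'%:R * (y * ln 2) by move: hE'; rewrite -[_^-1]div1r ler_pdivrMr.
  by have := ler_wpM2l (ltW E'r) h1; rewrite -natr1; lra.
pose pi (C : color_class) (e : bool) := (1 + deviation C e / alpha) / 2.
have pi0 C e : 0 < pi C e by have [_ /(_ e)[/hpsi[]]] := deviationP C.
have pi1 C : pi C true + pi C false <= 1.
  have [h _] := deviationP C; have h' : deviation C true = - deviation C false by lra.
  by rewrite /pi h' mulNr; lra.
have cX : #|{: 'I_q' * 'I_(2 * q)}| = (q' * (2 * q))%N by rewrite card_prod !card_ord.
have hp C e : #|class_good C e|%:R <= pcost (pi C) psi e * #|{: 'I_q' * 'I_(2 * q)}|%:R.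
  have [_ /(_ e)[/hpsi[_ h] _]] := deviationP C.
  rewrite /pcost /lcost mulrN opprK.
  apply: le_trans (ler_wpM2r _ h) => //; rewrite exp2_alpha cX /deviation !natrM.
  have q1 : q%:R != 0 :> R by rewrite pnatr_eq0.
  have q2 : q'%:R != 0 :> R by rewrite pnatr_eq0 -lt0n.
  have s1 : s%:R != 0 :> R by rewrite pnatr_eq0 -lt0n.
  rewrite le_eqVlt; apply/orP; left; apply/eqP; field.
  have q3 : q'%:R + 1 != 0 :> R by rewrite natr1.
  have q4 : 1 + q'%:R != 0 :> R by rewrite addrC.
  by rewrite ?q1 ?q2 ?q3 ?q4 ?s1.
have hg C e : (2 * #|class_good C e| <= #|{: 'I_q' * 'I_(2 * q)}|)%N.
  by rewrite cX; have [_ /(_ e)[]] := deviationP C.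
have X0 : (0 < #|{: 'I_q' * 'I_(2 * q)}|)%N by rewrite cX !muln_gt0 q0.
have [e0 he0] := exists_edge_coloring (E := E'.+1) psi0 g0 E'0 X0 pi0 pi1 hp hg.
(* Since n is at most n^alpha, which is at most 4 times [2 ^ ell], this forces [e0 < ell]. *)
exists (4 * 2 ^ e0.+1)%N => n hn.
have n1 : 1 <= n%:R :> R by rewrite ler1n (leq_trans _ hn).
have n0 : 0 < n%:R :> R by lra.
have nE : n%:R = 2 `^ (log2 n%:R) :> R by rewrite exp2_log2.
(* The number [2 ^ ell] of levels is between a quarter and a half of n^alpha. The lower bound is the
   1/4 of the theorem, the upper one gives [ell <= alpha * log2 n]. *)
have [ell [hl1 hl2]] := min_pow2_above (n%:R `^ alpha / 4).
have na : n%:R <= n%:R `^ alpha by apply: le1r_powR => //; lra.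
have le0 : (e0 < ell)%N.
  rewrite ltnNge; apply/negP => le; have : (2 ^ ell <= 2 ^ e0.+1)%N by rewrite leq_exp2l // ltnW.
  rewrite -(ler_nat R) natrX => h; move: hn; rewrite -(ltr_nat R) natrM; lra.
have lell : ell%:R <= alpha * log2 n%:R.
  rewrite -ler_exp2 exp2_nat mulrC powRrM -nE.
  have := hl2 (leq_ltn_trans (leq0n _) le0); have : 0 < n%:R `^ alpha by lra.
  lra.
pose m := (2 ^ ell)%N.
have [c hc] := he0 ell 'I_m (ltnW le0) (card_ord m).
pose V : finType := {ffun 'I_m -> bool}.
exists #|V|; last first.
  rewrite card_ffun card_bool card_ord natrX -exp2_nat ler_exp2 /m natrX; exact: hl1.
apply: (@colorable_transfer V n q s.+1 (stepup_color (@biased_color q') ord0 c)) => S cS.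
rewrite leqNgt; apply/negP; rewrite ltnS => few.
have sq : (s <= #|'I_q|)%N by rewrite card_ord (leq_trans _ hs) // leq_pmull.
have [C KC cC] := set_of_card_above few sq.
have S0 : (0 < #|S|)%N by rewrite cS -(ltr_nat R).
have [|t nt wt] := @stepup_tree m q _ (@biased_color q') ord0 c S C S0.
  by move=> e eS ce; apply: (subsetP KC); apply: imset_f; rewrite inE eS ce eqxx.
set G := [set e | _] in wt.
have cC' : #|C| == s by rewrite cC.
pose i : color_class := exist _ C cC'.
have GS : G \subset edge_graph (class_good i) c.
  by apply/subsetP => e; rewrite !inE => /andP[].
have irr b e : (b, e, b) \notin G by rewrite inE /= ltnn andbF.
have [dt _] := hc i G GS irr t wt.
(* The depth bound for [t] controls the loss by pruning; the bound on leaves needs the balanced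
   tree. *)
have [_ bt] := hc i G GS irr (prune E'.+1 t) (prune_wf E'.+1 wt).
pose n' := nleaves (prune E'.+1 t).
have n'0 : 0 < n'%:R :> R by rewrite ltr0n nleaves_gt0.
have n'E : n'%:R = 2 `^ (log2 n'%:R) :> R by rewrite exp2_log2.
have := bt (prune_balanced E'.+1 t) _ n'E; rewrite ltNge => /negP; apply.
have lb : log2 n%:R - y * (4 * ell)%:R <= log2 n'%:R.
  rewrite -ler_exp2 exp2D -nE -n'E powRN ler_pdivrMr ?exp2_gt0 //.
  have := prune_nleaves (ltn0Sn E') dt; rewrite nt cS /= -(ler_nat R) !natrM !natrX -/n' => h.
  have E'p : 0 < E'%:R ^+ (4 * ell) :> R by rewrite exprn_gt0.
  rewrite -(ler_pM2l E'p); apply: le_trans h _.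
  have : E'.+1%:R ^+ (4 * ell) <= (E'%:R * 2 `^ y) ^+ (4 * ell).
    by apply: lerXn2r; rewrite ?nnegrE ?mulr_ge0 ?powR_ge0.
  rewrite exprMn -[(2 `^ y) ^+ _]powR_mulrn ?powR_ge0 // -powRrM natrM => h2.
  have := ler_wpM2r (ltW n'0) h2; lra.
have k1 : psi * (log2 n%:R - y * (4 * ell)%:R) <= psi * log2 n'%:R by rewrite ler_wpM2l // ltW.
have k2 : psi * y * 4 = g by rewrite /y; field; rewrite gt_eqF.
have k3 : (1 + 2 * g) * ell%:R <= psi * log2 n%:R.
  rewrite -gE; have : 0 <= psi / alpha by rewrite divr_ge0 // ltW.
  move=> h; have := ler_wpM2l h lell; rewrite mulrA divfK ?gt_eqF //.
have k4 : psi * (y * (4 * ell)%:R) = g * ell%:R by rewrite -k2 natrM; ring.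
lra.
Qed.

End StepUpCase.

(** * The case of q below 4(t-1) *)

Lemma leq_bin_expn (N n : nat) : ('C(N, n) <= N ^ n)%N.
Proof.
apply: (@leq_trans (N ^_ n)).
  by rewrite -bin_ffact leq_pmulr // fact_gt0.
elim: n N => [|n ih] [|N] //; rewrite ffactSS expnS leq_mul //.
by apply: leq_trans (ih N) _; case: n {ih} => // n; rewrite leq_exp2r.
Qed.

Lemma leq_cube_bin3 (n : nat) : (4 <= n)%N -> (n ^ 3 <= 48 * 'C(n, 3))%N.
Proof.
move=> n4; have := bin_ffact n 3; rewrite !ffactnS ffactn0 !factS fact0 => h.
have h3 : (n ^ 3 = n * (n * n))%N by rewrite !expnS expn0 muln1.
case: n n4 h h3 => [|[|n]] // n4; rewrite /= => h ->; nia.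
Qed.

(** Now [alpha < 2], so naming an n-set takes about n^(1+alpha)/4 bits, of smaller order than the
    [alpha * 'C(n, 3)] bits earned when all its triples avoid the colours outside a given class. *)
Lemma random_case (R : realType) (q s : nat) : (0 < s)%N -> (s < q)%N -> (q < 4 * s)%N ->
  exists n0 : nat, forall n, (n0 < n)%N -> exists2 N, colorable n q s.+1 N &
  2 `^ ((n%:R `^ (log2 (q%:R / s%:R))) / 4) <= N%:R :> R.
Proof.
move=> s0 sq q4; set alpha := log2 _.
have sr : 0 < s%:R :> R by rewrite ltr0n.
have qr : 0 < q%:R :> R by rewrite ltr0n (leq_ltn_trans (leq0n _) sq).
have aE : 2 `^ alpha = q%:R / s%:R by rewrite exp2_log2 // divr_gt0.
have a0 : 0 < alpha.
  by rewrite ltNge -ler_exp2 aE powRr0 ler_pdivrMr // mul1r ler_nat -ltnNge.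
have a2 : alpha < 2.
  by rewrite ltNge -ler_exp2 aE (exp2_nat R 2) ler_pdivlMr // -natrX -natrM ler_nat -ltnNge.
have b0 : 0 < 2 - alpha by lra.
(* Ensures that 50 n^alpha is at most alpha n^2. The main naming cost is then at most alpha n^3/200,
   against a gain of at least alpha n^3/48. *)
have [n1 n10 hn1] := nat_above ((50 / alpha) `^ (2 - alpha)^-1).
pose Q := #|{: {set 'I_q}}|.
(* Pays for the choice of the colour class and for rounding [M] up. *)
have [n2 n20 hn2] := nat_above (200 * Q.+1%:R / alpha).
exists (n1 + n2 + 4)%N => n hn.
have nr1 : 1 <= n%:R :> R by rewrite ler1n; move: hn; clear; lia.
have nr : 0 < n%:R :> R by lra.
have hn1' : n1%:R <= n%:R :> R by rewrite ler_nat; move: hn; clear; lia.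
have hn2' : n2%:R <= n%:R :> R by rewrite ler_nat; move: hn; clear; lia.
have hn4 : (4 <= n)%N by move: hn; clear; lia.
have k1 : 50 / alpha <= n%:R `^ (2 - alpha).
  have c0 : 0 <= 50 / alpha by rewrite divr_ge0 // ltW.
  have -> : 50 / alpha = ((50 / alpha) `^ (2 - alpha)^-1) `^ (2 - alpha).
    by rewrite -powRrM mulVf ?gt_eqF // powRr1.
  apply: ge0_ler_powR; rewrite ?nnegrE ?powR_ge0 ?(ltW nr) ?(ltW b0) //.
  exact: le_trans hn1 hn1'.
have k2 : n%:R `^ alpha * 50 <= alpha * n%:R ^+ 2.
  have -> : n%:R ^+ 2 = n%:R `^ alpha * n%:R `^ (2 - alpha).
    rewrite -powRD; last by rewrite (gt_eqF nr) implybT.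
    by rewrite -(powR_mulrn 2 (ltW nr)); congr (_ `^ _); lra.
  have k1' : 50 <= n%:R `^ (2 - alpha) * alpha by move: k1; rewrite ler_pdivrMr.
  by have := ler_wpM2l (powR_ge0 n%:R alpha) k1'; lra.
have k3 : 200 * Q.+1%:R <= alpha * n%:R.
  by have := le_trans hn2 hn2'; rewrite ler_pdivrMr //; lra.
have [M hM1 hM2] : exists2 M : nat, n%:R `^ alpha / 4 <= M%:R & M%:R <= n%:R `^ alpha / 4 + 1.
  have ex : exists k : nat, n%:R `^ alpha / 4 <= k%:R by have [k _ hk] := nat_above (n%:R `^ alpha / 4); exists k.
  case: (ex_minnP ex) => M h1 h2; exists M => //; case: M h1 h2 => [|M] h1 h2.
    by have := powR_ge0 n%:R alpha; lra.
  rewrite -natr1 lerD2r leNgt; apply/negP => /ltW /h2; by rewrite ltnn.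
exists (2 ^ M)%N; last by rewrite natrX -exp2_nat ler_exp2.
pose N := (2 ^ M)%N; pose Om : finType := {ffun {set 'I_N} -> 'I_q}.
pose ev (x : {set 'I_N} * {set 'I_q}) : {set Om} :=
  if (#|x.1| == n) && (#|x.2| == s) then [set c : Om | [forall e in triples x.1, c e \in x.2]] else set0.
have c3 (S : {set 'I_N}) : #|S| = n -> #|triples S| = 'C(n, 3) by move=> <-; rewrite cards_draws.
have bound : pr R (\bigcup_x ev x) < 1.
  apply: (@le_lt_trans _ _ (\sum_(S : {set 'I_N} | #|S| == n) \sum_(C : {set 'I_q}) 2 `^ (- (alpha * 'C(n, 3)%:R)))).
    apply: le_trans (pr_bigcup _ _) _.
    rewrite -(pair_bigA _ (fun S C => pr R (ev (S, C)))) /= [leRHS]big_mkcond /=.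
    apply: ler_sum => S _; case: ifP => [/eqP cS|nS]; last first.
      by rewrite big1 // => C _; rewrite /ev /= nS /pr cards0 mul0r.
    apply: ler_sum => C _; rewrite /ev /= cS eqxx /=; case: ifP => [/eqP cC|_]; last first.
      by rewrite /pr cards0 mul0r powR_ge0.
    have hp (e : {set 'I_N}) : #|mem C|%:R <= s%:R / q%:R * #|'I_q|%:R :> R.
      by rewrite cC card_ord divfK ?gt_eqF.
    have q0 : (0 < #|'I_q|)%N by rewrite card_ord (leq_ltn_trans (leq0n _) sq).
    apply: le_trans (@pr_ffun_constrained R _ _ (triples S) (fun=> mem C) (fun=> s%:R / q%:R) q0 hp) _.
    by rewrite prodr_const (c3 _ cS) powRN powRrM aE powR_mulrn ?divr_ge0 // -exprVn invf_div.
  have inner (x : R) : \sum_(C : {set 'I_q}) x = Q%:R * x by rewrite sumr_const -[LHS]mulr_natl.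
  have -> : \sum_(S : {set 'I_N} | #|S| == n) \sum_(C : {set 'I_q}) 2 `^ (- (alpha * 'C(n, 3)%:R))
      = 'C(N, n)%:R * (Q%:R * 2 `^ (- (alpha * 'C(n, 3)%:R))) :> R.
    rewrite (eq_bigl (fun S => S \in [set S : {set 'I_N} | #|S| == n])); last by move=> S; rewrite inE.
    by rewrite inner sumr_const card_draws card_ord -[LHS]mulr_natl.
  apply: (@le_lt_trans _ _ ((N ^ n)%:R * ((2 ^ Q)%:R * 2 `^ (- (alpha * 'C(n, 3)%:R))))).
    apply: ler_pM; rewrite ?mulr_ge0 ?powR_ge0 // ?ler_nat ?leq_bin_expn //.
    by rewrite ler_wpM2r ?powR_ge0 // ler_nat ltnW // ltn_expl.
  rewrite /N -expnM !natrX -!exp2_nat -!exp2D -[ltRHS](powRr0 2) ltNge ler_exp2 -ltNge natrM.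
  have c48 : n%:R ^+ 3 <= 48 * 'C(n, 3)%:R :> R by rewrite -natrX -natrM ler_nat leq_cube_bin3.
  have m1 : alpha * n%:R ^+ 3 <= alpha * (48 * 'C(n, 3)%:R) by rewrite ler_wpM2l // ltW.
  have m2 : M%:R * n%:R <= (n%:R `^ alpha / 4 + 1) * n%:R by rewrite ler_wpM2r // ltW.
  have m3 : (n%:R `^ alpha * 50) * n%:R <= alpha * n%:R ^+ 2 * n%:R by rewrite ler_wpM2r // ltW.
  have m4 : 200 * Q.+1%:R * n%:R <= alpha * n%:R * n%:R by rewrite ler_wpM2r // ltW.
  have z1 := mulr_gt0 (mulr_gt0 a0 nr) nr.
  have m5 : alpha * n%:R * n%:R <= alpha * n%:R * n%:R * n%:R by rewrite (ler_peMr (ltW z1)).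
  have m6 : Q%:R <= Q%:R * n%:R :> R by rewrite ler_peMr.
  have m7 := mulr_gt0 z1 nr.
  rewrite -natr1 in m4; rewrite !exprS expr0 in m1 m3; lra.
have Om0 : (0 < #|Om|)%N by rewrite card_ffun card_ord expn_gt0 (leq_ltn_trans (leq0n _) sq).
have [c hc] := pr_lt1_avoid Om0 bound.
apply/existsP; exists c; apply/forallP => S; apply/implyP => /eqP cS.
rewrite leqNgt; apply/negP; rewrite ltnS => few.
have sq' : (s <= #|'I_q|)%N by rewrite card_ord ltnW.
have [C KC cC] := set_of_card_above few sq'.
move/negP: hc; apply; apply/bigcupP; exists (S, C) => //; rewrite /ev /= cS cC !eqxx inE.
by apply/forall_inP => e eS; apply: (subsetP KC); apply: imset_f.
Qed.

Theorem theorem1p3 (R : realType) (q t : nat) (htq : (2 <= t <= q)%N) :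
  exists n0 : nat, forall (n : nat) (hqn : (q < n)%N), (n0 < n)%N ->
    2 `^ ((n%:R `^ (log2 (q%:R / (t%:R - 1)))) / 4)
      <= (ramsey_f n q t htq hqn)%:R :> R.
Proof.
have [t2 tq] := andP htq; pose s := t.-1.
have tE : t = s.+1 by rewrite prednK // (leq_trans _ t2).
have s0 : (0 < s)%N by rewrite -ltnS -tE.
have sq : (s < q)%N by rewrite -tE.
have [n0 hn0] : exists n0 : nat, forall n, (n0 < n)%N -> exists2 N, colorable n q s.+1 N &
    2 `^ ((n%:R `^ (log2 (q%:R / s%:R))) / 4) <= N%:R :> R.
  case: (leqP (4 * s) q) => h; last exact: random_case.
  by have := @stepup_case R q.-1 s s0; rewrite (ltn_predK sq); apply.
exists n0 => n hqn hn; have [N cN hN] := hn0 n hn.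
have -> : t%:R - 1 = s%:R :> R by rewrite tE -natr1 addrK.
apply: le_trans hN _; rewrite ler_nat /ramsey_f.
by case: ex_maxnP => M _; apply; rewrite tE.
Qed.
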